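(* Minimal models of operads in bicomplexes are unique up to isomorphism: if $\mathcal P$ is an operad in bicomplexes over a field $\mathbf k$ of characteristic zero and $\alpha\colon\mathcal M\xrightarrow{\sim}\mathcal P$ and $\alpha'\colon\mathcal N\xrightarrow{\sim}\mathcal P$ are two minimal models of $\mathcal P$, then $\mathcal M$ and $\mathcal N$ are isomorphic operads.
   Context: A bicomplex is a bigraded $\mathbf k$-vector space $A=\bigoplus_{p,q\in\mathbb Z}A^{p,q}$ with linear maps $\partial$ of bidegree $(1,0)$ and $\bar\partial$ of bidegree $(0,1)$ with $\partial^2=\bar\partial^2=\partial\bar\partial+\bar\partial\partial=0$; they form a symmetric monoidal category under $\otimes$ (Leibniz rule, Koszul signs with respect to total degree) in which operads are taken. $H_{BC}(A)=\frac{\ker\partial\cap\ker\bar\partial}{\operatorname{Im}\partial\bar\partial}$, $H_{A}(A)=\frac{\ker\partial\bar\partial}{\operatorname{Im}\partial+\operatorname{Im}\bar\partial}$. A morphism of bicomplexes is a pluripotential weak equivalence if it induces isomorphisms on $H_{BC}$ and $H_A$; a morphism of operads is one if it is so in each arity. $\mathbb T(M)$ is the free operad on $M$, graded by weight (number of generators composed). An operad is quasi-free if it is free when the differentials are forgotten. For $n\ge2$ and a quasi-free operad $\mathcal Q=\mathbb T(M)$ with $M(0)=M(1)=0$, an arity $n$ principal extension of $\mathcal Q$ is $\mathcal Q\sqcup_d\mathbb T(E):=\mathbb T(M\oplus E)$, where $E$ is a bigraded $\mathbb S$-module concentrated in arity $n$ and $d\colon E\to\ker(\partial_{\mathcal Q}+\bar\partial_{\mathcal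 Q})\subseteq\mathcal Q(n)$ is equivariant and is the sum of components of bidegrees $(1,0)$ and $(0,1)$, which define $\partial$ and $\bar\partial$ on $E$ (extended by the Leibniz rule). An operad is cofibrant if it is the colimit of a sequence of principal extensions starting from the initial operad $\mathrm I=(0,\mathbf k,0,\dots)$. A minimal operad is a cofibrant operad $\mathcal M$ with $\partial\bar\partial(\mathcal M)\subseteq\mathcal M^{(\ge2)}$ (weight at least two). A minimal model of $\mathcal P$ is a minimal operad $\mathcal M$ together with a pluripotential weak equivalence of operads $\mathcal M\to\mathcal P$. *)

(* Defs.v *)
From HB Require Import structures.
From mathcomp Require Import all_boot all_order all_fingroup all_algebra.
From mathcomp Require Import boolp classical_sets functions.

Set Implicit Arguments.
Unset Strict Implicit.
Unset Printing Implicit Defensive.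

Import GRing.Theory.
Local Open Scope classical_set_scope.
Local Open Scope ring_scope.

(* A bigraded vector space is given by its total space, the direct sum of the
   A^{p,q}; [bg_hom p q] is the subspace of elements of bidegree (p, q). *)
Record bigraded (k : fieldType) := Bigraded {
  bg_total :> lmodType k;
  bg_hom : int -> int -> set bg_total;
  bg_hom0 : forall p q, bg_hom p q 0;
  bg_homP : forall p q (a : k) x y,
    bg_hom p q x -> bg_hom p q y -> bg_hom p q (a *: x + y);
  bg_span : forall x, exists s : seq bg_total,
    (forall v, v \in s -> exists p q, bg_hom p q v) /\ x = \sum_(v <- s) v;
  bg_direct : forall (s : seq (int * int)) (f : int * int -> bg_total),
    uniq s -> (forall e, bg_hom e.1 e.2 (f e)) ->
    \sum_(e <- s) f e = 0 -> forall e, e \in s -> f e = 0 }.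
Arguments bg_hom {k b} p q.

Record bicomplex_axioms (k : fieldType) (A : bigraded k) (d db : A -> A) :
    Prop := BicomplexAxioms {
  bc_d_deg : forall p q x, bg_hom p q x -> bg_hom (p + 1) q (d x);
  bc_db_deg : forall p q x, bg_hom p q x -> bg_hom p (q + 1) (db x);
  bc_dd : forall x, d (d x) = 0;
  bc_dbdb : forall x, db (db x) = 0;
  bc_ddb : forall x, d (db x) + db (d x) = 0 }.

Record bicomplex (k : fieldType) := Bicomplex {
  bc_space :> bigraded k;
  bc_d : {linear bc_space -> bc_space};
  bc_db : {linear bc_space -> bc_space};
  bc_axioms : bicomplex_axioms bc_d bc_db }.
Arguments bc_d {k b}.
Arguments bc_db {k b}.

(* [subquotient Z B] is the quotient Z / B, as a set of cosets; for B' a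
   subspace of the target and f mapping B into B', [induced f B'] sends the
   coset z + B to f z + B'. *)
Definition vcoset (V : zmodType) (B : set V) (x : V) : set V :=
  [set y | B (y - x)].

Definition subquotient (V : zmodType) (Z B : set V) : set (set V) :=
  vcoset B @` Z.

Definition induced (V W : zmodType) (f : V -> W) (B' : set W) (S : set V) :
    set W :=
  [set y | exists2 x, S x & B' (y - f x)].

Section Cohomology.
Variables (k : fieldType) (A : bicomplex k).

Definition BC_cycles : set A := [set x | bc_d x = 0 /\ bc_db x = 0].
Definition BC_boundaries : set A := [set x | exists y, x = bc_d (bc_db y)].
Definition H_BC : set (set A) := subquotient BC_cycles BC_boundaries.

Definition A_cycles : set A := [set x | bc_d (bc_db x) = 0].
Definition A_boundaries : set A := [set x | exists y z, x = bc_d y + bc_db z].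
Definition H_A : set (set A) := subquotient A_cycles A_boundaries.

End Cohomology.
Arguments BC_cycles {k} A.
Arguments BC_boundaries {k} A.
Arguments H_BC {k} A.
Arguments A_cycles {k} A.
Arguments A_boundaries {k} A.
Arguments H_A {k} A.

Definition pluripotential_weq (k : fieldType) (A B : bicomplex k) (f : A -> B) :
    Prop :=
  set_bij (H_BC A) (H_BC B) (induced f (BC_boundaries B)) /\
  set_bij (H_A A) (H_A B) (induced f (A_boundaries B)).

(* [sm_act s x] is x with its input i renamed s i.  As (s * t)%g is s followed
   by t, this is a right action of the MathComp group 'S_n; in terms of the
   usual composition of permutations it is x . s^-1 for the usual right action. *)
Record smodule (k : fieldType) := SModule {
  sm_space :> nat -> bigraded k;
  sm_act : forall n, 'S_n -> {linear sm_space n -> sm_space n};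
  sm_act_deg : forall n (s : 'S_n) p q x,
    bg_hom p q x -> bg_hom p q (sm_act s x);
  sm_act1 : forall n (x : sm_space n), sm_act 1%g x = x;
  sm_actM : forall n (s t : 'S_n) (x : sm_space n),
    sm_act (s * t)%g x = sm_act t (sm_act s x) }.
Arguments sm_act {k s0 n}.

Record smod_hom (k : fieldType) (M N : smodule k) := SModHom {
  smh_fun :> forall n, {linear M n -> N n};
  smh_deg : forall n p q (x : M n), bg_hom p q x -> bg_hom p q (smh_fun n x);
  smh_act : forall n (s : 'S_n) (x : M n),
    smh_fun n (sm_act s x) = sm_act s (smh_fun n x) }.

Section BigradedSum.
Variables (k : fieldType) (A B : bigraded k).

Definition bgsum_hom (p q : int) : set (A * B)%type :=
  [set x | bg_hom p q x.1 /\ bg_hom p q x.2].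

Lemma bgsum_hom0 p q : bgsum_hom p q 0.
Proof. by split; exact: bg_hom0. Qed.

Lemma bgsum_homP p q (a : k) x y :
  bgsum_hom p q x -> bgsum_hom p q y -> bgsum_hom p q (a *: x + y).
Proof. by move=> [? ?] [? ?]; split; apply: bg_homP. Qed.

Lemma bgsum_span (x : (A * B)%type) : exists s : seq (A * B)%type,
  (forall v, v \in s -> exists p q, bgsum_hom p q v) /\ x = \sum_(v <- s) v.
Proof.
case: x => a b.
have [s [hs ->]] := bg_span a; have [t [ht ->]] := bg_span b.
exists ([seq (v, 0 : B) | v <- s] ++ [seq (0 : A, v) | v <- t]); split.
  move=> v; rewrite mem_cat => /orP[] /mapP[w hw ->].
    by have [p [q h]] := hs _ hw; exists p, q; split => //; exact: bg_hom0.
  by have [p [q h]] := ht _ hw; exists p, q; split => //; exact: bg_hom0.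
rewrite [RHS]surjective_pairing !(raddf_sum fst, raddf_sum snd) !big_cat !big_map /=.
by rewrite ![\sum_(_ <- _) 0]big1 // addr0 add0r.
Qed.

Lemma bgsum_direct (s : seq (int * int)) (f : int * int -> (A * B)%type) :
  uniq s -> (forall e, bgsum_hom e.1 e.2 (f e)) ->
  \sum_(e <- s) f e = 0 -> forall e, e \in s -> f e = 0.
Proof.
move=> us hf f0 e es.
have f1 : \sum_(e <- s) (f e).1 = 0.
  by rewrite -(raddf_sum fst) f0.
have f2 : \sum_(e <- s) (f e).2 = 0.
  by rewrite -(raddf_sum snd) f0.
have := bg_direct us (fun e => (hf e).1) f1 es.
have := bg_direct us (fun e => (hf e).2) f2 es.
by case: (f e) => a b /= -> ->.
Qed.

Definition bgsum : bigraded k :=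
  Bigraded bgsum_hom0 bgsum_homP bgsum_span bgsum_direct.

End BigradedSum.

Section SModuleSum.
Variables (k : fieldType) (M E : smodule k).

Definition smsum_fun n (s : 'S_n) (x : bgsum (M n) (E n)) : bgsum (M n) (E n) :=
  (sm_act s x.1, sm_act s x.2).

Fact smsum_linear n (s : 'S_n) : linear (smsum_fun s).
Proof. by move=> a x y; rewrite /smsum_fun /= !linearP. Qed.

HB.instance Definition _ n (s : 'S_n) :=
  GRing.isLinear.Build k (bgsum (M n) (E n)) (bgsum (M n) (E n)) _
    (smsum_fun s) (smsum_linear s).

Definition smsum_act n (s : 'S_n) :
  {linear bgsum (M n) (E n) -> bgsum (M n) (E n)} := smsum_fun s.

Lemma smsum_act_deg n (s : 'S_n) p q (x : bgsum (M n) (E n)) :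
  bg_hom p q x -> bg_hom p q (smsum_act s x).
Proof. by move=> [? ?]; split; apply: sm_act_deg. Qed.

Lemma smsum_act1 n (x : bgsum (M n) (E n)) : smsum_act 1%g x = x.
Proof. by case: x => a b; rewrite /= /smsum_fun /= !sm_act1. Qed.

Lemma smsum_actM n (s t : 'S_n) (x : bgsum (M n) (E n)) :
  smsum_act (s * t)%g x = smsum_act t (smsum_act s x).
Proof. by case: x => a b; rewrite /= /smsum_fun /= !sm_actM. Qed.

Definition smsum : smodule k := SModule smsum_act_deg smsum_act1 smsum_actM.

End SModuleSum.

(* The inputs of the partial composite of x (m inputs) and y (n inputs) at the
   input i of x are the inputs j <> i of x and the inputs of y, in the order
   0, ..., i-1 of x; 0, ..., n-1 of y; i+1, ..., m-1 of x.
   [graft_slot i s u] says that s becomes the input u of the composite (so no u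
   corresponds to [inl i]). *)
Definition graft_slot (m n r : nat) (i : 'I_m) (s : 'I_m + 'I_n) (u : 'I_r) :
    bool :=
  match s with
  | inl j => (j < i)%N && (u == j :> nat)
             || (i < j)%N && (u.+1 == j + n :> nat)%N
  | inr j => u == (i + j)%N :> nat
  end.

(* [rho] is the permutation of the inputs of a composite at i induced by a
   permutation [s] of the inputs of x and [t] of those of y, the result being
   composed at [s i]. *)
Definition graft_perm (m n r : nat) (i : 'I_m) (s : 'S_m) (t : 'S_n)
    (rho : 'S_r) : Prop :=
  forall (a : 'I_m + 'I_n) (u : 'I_r), graft_slot i a u ->
    graft_slot (s i) (match a with inl j => inl (s j) | inr j => inr (t j) end)
               (rho u).

Definition koszul (k : fieldType) (n : int) : k := (-1) ^ n.

(* Operads in bigraded vector spaces (no differentials), by partial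
   compositions.  [op_comp e i x y] is x o_i y, inputs being numbered from 0; its
   arity is a variable r with m + n = r + 1, so that no transport along
   equalities of arities is needed. *)
Record goperad (k : fieldType) := GOperad {
  op_smod :> smodule k;
  op_id : op_smod 1%N;
  op_comp : forall (m n r : nat), r.+1 = (m + n)%N -> 'I_m ->
    op_smod m -> op_smod n -> op_smod r;
  op_id_deg : bg_hom 0 0 op_id;
  op_comp_deg : forall m n r (e : r.+1 = (m + n)%N) (i : 'I_m) p q p' q' x y,
    bg_hom p q x -> bg_hom p' q' y ->
    bg_hom (p + p') (q + q') (op_comp e i x y);
  op_comp_linl : forall m n r (e : r.+1 = (m + n)%N) (i : 'I_m) y,
    linear (fun x => op_comp e i x y);
  op_comp_linr : forall m n r (e : r.+1 = (m + n)%N) (i : 'I_m) x,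
    linear (op_comp e i x);
  op_id_l : forall n (e : n.+1 = (1 + n)%N) (i : 'I_1) (y : op_smod n),
    op_comp e i op_id y = y;
  op_id_r : forall m (e : m.+1 = (m + 1)%N) (i : 'I_m) (x : op_smod m),
    op_comp e i x op_id = x;
  op_comp_seq : forall l m n r s t
      (e1 : r.+1 = (l + m)%N) (e2 : t.+1 = (r + n)%N)
      (e3 : s.+1 = (m + n)%N) (e4 : t.+1 = (l + s)%N)
      (i : 'I_l) (j : 'I_m) (u : 'I_r)
      (x : op_smod l) (y : op_smod m) (z : op_smod n),
    u = (i + j)%N :> nat ->
    op_comp e2 u (op_comp e1 i x y) z = op_comp e4 i x (op_comp e3 j y z);
  op_comp_par : forall l m n r s t
      (e1 : r.+1 = (l + m)%N) (e2 : t.+1 = (r + n)%N)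
      (e3 : s.+1 = (l + n)%N) (e4 : t.+1 = (s + m)%N)
      (i j : 'I_l) (u : 'I_r) (v : 'I_s) p q p' q'
      (x : op_smod l) (y : op_smod m) (z : op_smod n),
    (i < j)%N -> u.+1 = (j + m)%N :> nat -> v = i :> nat ->
    bg_hom p q y -> bg_hom p' q' z ->
    op_comp e2 u (op_comp e1 i x y) z =
    koszul k ((p + q) * (p' + q')) *: op_comp e4 v (op_comp e3 j x z) y;
  op_comp_act : forall m n r (e : r.+1 = (m + n)%N) (i : 'I_m)
      (s : 'S_m) (t : 'S_n) (rho : 'S_r) (x : op_smod m) (y : op_smod n),
    graft_perm i s t rho ->
    op_comp e (s i) (sm_act s x) (sm_act t y) = sm_act rho (op_comp e i x y) }.
Arguments op_id {k} g.
Arguments op_comp {k g m n r}.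

Record goperad_hom (k : fieldType) (P Q : goperad k) := GOperadHom {
  gh_smod :> smod_hom P Q;
  gh_id : gh_smod 1%N (op_id P) = op_id Q;
  gh_comp : forall m n r (e : r.+1 = (m + n)%N) (i : 'I_m) (x : P m) (y : P n),
    gh_smod r (op_comp e i x y) = op_comp e i (gh_smod m x) (gh_smod n y) }.

(* The Leibniz sign is that of a map of total degree 1; the bidegree of [d] is
   specified in [bicomplex_axioms]. *)
Record operad_derivation (k : fieldType) (P : goperad k)
    (d : forall n, P n -> P n) : Prop := OperadDerivation {
  od_act : forall n (s : 'S_n) (x : P n), d n (sm_act s x) = sm_act s (d n x);
  od_id : d 1%N (op_id P) = 0;
  od_comp : forall m n r (e : r.+1 = (m + n)%N) (i : 'I_m) p q
      (x : P m) (y : P n), bg_hom p q x ->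
    d r (op_comp e i x y) =
    op_comp e i (d m x) y + koszul k (p + q) *: op_comp e i x (d n y) }.

(* Operads in bicomplexes; the coercion to [goperad] forgets the
   differentials. *)
Record bioperad (k : fieldType) := BiOperad {
  bo_op :> goperad k;
  bo_d : forall n, {linear bo_op n -> bo_op n};
  bo_db : forall n, {linear bo_op n -> bo_op n};
  bo_bicomplex : forall n, bicomplex_axioms (bo_d n) (bo_db n);
  bo_d_der : operad_derivation bo_d;
  bo_db_der : operad_derivation bo_db }.
Arguments bo_d {k b n}.
Arguments bo_db {k b n}.

Definition bo_arity (k : fieldType) (P : bioperad k) (n : nat) : bicomplex k :=
  Bicomplex (bo_bicomplex P n).

Record bioperad_hom (k : fieldType) (P Q : bioperad k) := BiOperadHom {
  bh_op :> goperad_hom P Q;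
  bh_d : forall n (x : P n), bh_op n (bo_d x) = bo_d (bh_op n x);
  bh_db : forall n (x : P n), bh_op n (bo_db x) = bo_db (bh_op n x) }.

Definition operad_weq (k : fieldType) (P Q : bioperad k)
    (f : bioperad_hom P Q) : Prop :=
  forall n, @pluripotential_weq k (bo_arity P n) (bo_arity Q n) (f n).

Definition bioperad_isomorphic (k : fieldType) (P Q : bioperad k) : Prop :=
  exists (f : bioperad_hom P Q) (g : bioperad_hom Q P),
    (forall n, cancel (f n) (g n)) /\ (forall n, cancel (g n) (f n)).

(* The universal property of T(M), in operads without differentials. *)
Definition is_free_operad (k : fieldType) (M : smodule k) (T : goperad k)
    (inc : smod_hom M T) : Prop :=
  forall (O : goperad k) (f : smod_hom M O),
    exists g : goperad_hom T O,
      (forall n (x : M n), g n (inc n x) = f n x) /\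
      (forall g' : goperad_hom T O,
         (forall n (x : M n), g' n (inc n x) = f n x) ->
         forall n (x : T n), g' n x = g n x).

(* [weight G w x]: x is a linear combination of composites of w elements of G.
   If G is the set of generators of a free operad, these are its weight w
   components. *)
Inductive weight (k : fieldType) (P : goperad k) (G : forall n, set (P n)) :
    nat -> forall n, P n -> Prop :=
| weight_id : weight G 0%N (op_id P)
| weight_gen n (x : P n) : G n x -> weight G 1%N x
| weight_comp w w' m n r (e : r.+1 = (m + n)%N) (i : 'I_m)
    (x : P m) (y : P n) :
    weight G w x -> weight G w' y -> weight G (w + w') (op_comp e i x y)
| weight_act w n (s : 'S_n) (x : P n) : weight G w x -> weight G w (sm_act s x)
| weight_zero w n : weight G w (0 : P n)
| weight_lin w n (a : k) (x y : P n) :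
    weight G w x -> weight G w y -> weight G w (a *: x + y).

Inductive weight_ge (k : fieldType) (P : goperad k) (G : forall n, set (P n))
    (w0 : nat) (n : nat) : P n -> Prop :=
| weight_ge_zero : weight_ge G w0 (0 : P n)
| weight_ge_add w (x y : P n) :
    (w0 <= w)%N -> weight G w x -> weight_ge G w0 y -> weight_ge G w0 (x + y).

Definition concentrated_in (k : fieldType) (E : smodule k) (n : nat) : Prop :=
  forall m (x : E m), m <> n -> x = 0.

(* A quasi-free operad T(M) with M(0) = M(1) = 0, together with M. *)
Record quasi_free (k : fieldType) := QuasiFree {
  qf_op :> bioperad k;
  qf_gen : smodule k;
  qf_inc : smod_hom qf_gen qf_op;
  qf_free : is_free_operad qf_inc;
  qf_gen0 : forall x : qf_gen 0%N, x = 0;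
  qf_gen1 : forall x : qf_gen 1%N, x = 0 }.
Arguments qf_inc {k q}.

(* The map d : E -> ker (del + delbar), E being concentrated in arity n. *)
Record attaching_map (k : fieldType) (Q : bioperad k) (E : smodule k) (n : nat) :=
  AttachingMap {
  at_d : {linear E n -> Q n};
  at_10 : {linear E n -> Q n};
  at_01 : {linear E n -> Q n};
  at_sum : forall x, at_d x = at_10 x + at_01 x;
  at_10_deg : forall p q x, bg_hom p q x -> bg_hom (p + 1) q (at_10 x);
  at_01_deg : forall p q x, bg_hom p q x -> bg_hom p (q + 1) (at_01 x);
  at_act : forall (s : 'S_n) x, at_d (sm_act s x) = sm_act s (at_d x);
  at_ker : forall x, bo_d (at_d x) + bo_db (at_d x) = 0 }.

(* [j] exhibits R as the principal extension of Q = T(M) along some d on E: R is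
   free on a copy (along [theta]) of M + E, and j is the inclusion of T(M).  The
   differential of R is then determined by the Leibniz rule. *)
Definition is_principal_extension (k : fieldType) (Q R : quasi_free k)
    (j : bioperad_hom Q R) : Prop :=
  exists (n : nat) (E : smodule k) (d : attaching_map Q E n)
         (theta : smod_hom (smsum (qf_gen Q) E) (qf_gen R)),
    [/\ (2 <= n)%N,
        concentrated_in E n,
        (forall m, bijective (theta m)),
        (forall m (x : qf_gen Q m), qf_inc m (theta m (x, 0)) = j m (qf_inc m x)) &
        (forall x : E n,
           bo_d (qf_inc n (theta n (0, x)) : R n) = j n (at_10 d x) /\
           bo_db (qf_inc n (theta n (0, x)) : R n) = j n (at_01 d x))].

(* The operad (0, k, 0, ...). *)
Definition is_unit_operad (k : fieldType) (P : goperad k) : Prop :=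
  [/\ forall n (x : P n), n <> 1%N -> x = 0,
      op_id P <> 0 &
      forall x : P 1%N, exists a : k, x = a *: op_id P].

Definition is_colimit (k : fieldType) (Q : nat -> bioperad k)
    (j : forall i, bioperad_hom (Q i) (Q i.+1))
    (M : bioperad k) (c : forall i, bioperad_hom (Q i) M) : Prop :=
  (forall i n (x : Q i n), c i.+1 n (j i n x) = c i n x) /\
  forall (O : bioperad k) (f : forall i, bioperad_hom (Q i) O),
    (forall i n (x : Q i n), f i.+1 n (j i n x) = f i n x) ->
    exists g : bioperad_hom M O,
      (forall i n (x : Q i n), g n (c i n x) = f i n x) /\
      (forall g' : bioperad_hom M O,
         (forall i n (x : Q i n), g' n (c i n x) = f i n x) ->
         forall n (x : M n), g' n x = g n x).

Record cofibrant_presentation (k : fieldType) (M : bioperad k) :=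
  CofibrantPresentation {
  cp_op : nat -> quasi_free k;
  cp_map : forall i, bioperad_hom (cp_op i) (cp_op i.+1);
  cp_cocone : forall i, bioperad_hom (cp_op i) M;
  cp_start : is_unit_operad (cp_op 0%N);
  cp_ext : forall i, is_principal_extension (cp_map i);
  cp_colimit : is_colimit cp_map cp_cocone }.

Definition is_cofibrant (k : fieldType) (M : bioperad k) : Prop :=
  inhabited (cofibrant_presentation M).

(* Forgetting differentials, M is free on the colimit of the generators of its
   successive stages. *)
Definition cp_generators (k : fieldType) (M : bioperad k)
    (C : cofibrant_presentation M) (n : nat) : set (M n) :=
  [set x | exists i (y : qf_gen (cp_op C i) n), x = cp_cocone C i n (qf_inc n y)].

(* The weight >= 2 part of M does not depend on C: as the generators have
   arity >= 2, it is spanned by the x o_i y with x, y of arity >= 2. *)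
Definition is_minimal (k : fieldType) (M : bioperad k) : Prop :=
  exists C : cofibrant_presentation M,
    forall n (x : M n), weight_ge (@cp_generators k M C) 2 (bo_d (bo_db x)).

Definition is_minimal_model (k : fieldType) (P M : bioperad k)
    (alpha : bioperad_hom M P) : Prop :=
  is_minimal M /\ operad_weq alpha.

(* Main.v *)
Require Import Defs.
From mathcomp Require Import all_boot all_order all_fingroup all_algebra.
From HB Require Import structures.
From mathcomp Require Import boolp classical_sets functions.

(* Let [alpha : M -> P] and [alpha' : N -> P] be minimal models.

   Homotopies are maps to the path object of P whose value in arity n is
   P(n) (x) (k + I (x) I'), with I and I' the augmentation ideals at 0 of the
   polynomial forms k[s, ds] and k[t, dt], ds of bidegree (1, 0) and dt of
   bidegree (0, 1).  Integration in s and in t makes I (x) I' acyclic, and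
   evaluation at (1, 1) is onto on it.  So the map from N x_P P^I to P given by the
   other end point is onto, with a kernel on which H_BC vanishes.  Cell by cell,
   [alpha] lifts along it, and one obtains f : M -> N such that [alpha] and
   [alpha' f] induce the same maps on H_BC and H_A; the choices are made
   equivariant by averaging over the symmetric groups.

   Then f is bijective by induction on the arity n.  Being bijective in arities
   < n, it is bijective on the decomposable elements of arity n: injectivity holds
   because N is free, so that the inverse of f in arities < n extends to a map of
   operads without differentials.  As del delbar takes decomposable values in M
   and in N, the isomorphisms on H_BC and H_A then force f to be bijective in
   arity n. *)

Set Implicit Arguments.
Unset Strict Implicit.
Unset Printing Implicit Defensive.

Import GRing.Theory.
Local Open Scope ring_scope.

(** * Bigraded vector spaces *)

(** One form variable would not do: already for P = k, I is a sum of arrows t^i -> d(t^i), and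
    d(t^i) is closed for both differentials without being in Im del delbar, so H_BC does not vanish.
    A tensor product of two arrows in different directions is a square, on which H_BC and H_A
    vanish; and I (x) I' being an ideal, k + I (x) I' is closed under products.

    Vanishing of H_BC is what attaching a cell requires: the image z of the cell must have both del
    z and delbar z prescribed, and [BC_acyclic_solve] solves this by three uses of H_BC = 0. On the
    kernel in question H_BC vanishes because alpha' is injective on H_BC and surjective on H_A.

    In the last step the inverse of f in arities < n is extended by zero to the other arities, so
    the resulting map on generators ignores the differentials, whereas N is a colimit of operads
    with differentials. That the colimit may be taken after forgetting them is proved with a cofree
    construction. *)

Definition lin_of (k : fieldType) (V W : lmodType k) (f : V -> W)
    (lf : linear f) : {linear V -> W} :=
  HB.pack f (GRing.isLinear.Build k V W _ f lf).

(** Unique choice. Maps that are only characterised by a property, as in the operads of functions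
    below, are obtained from it together with their linearity. *)
Lemma linear_of_rel (k : fieldType) (V W : lmodType k) (R : V -> W -> Prop) :
  (forall x, exists y, R x y) -> (forall x y z, R x y -> R x z -> y = z) ->
  (forall a x y x' y', R x y -> R x' y' -> R (a *: x + x') (a *: y + y')) ->
  {f : {linear V -> W} | forall x, R x (f x)}.
Proof.
move=> ex uni lin; pose f x := projT1 (cid (ex x)).
have fR x : R x (f x) by rewrite /f; case: cid.
have lf : linear f by move=> a x y; apply: uni (fR _) _; apply: lin.
by exists (lin_of lf).
Qed.

Section Koszul.
Variable k : fieldType.

Lemma koszulD a b : koszul k (a + b) = koszul k a * koszul k b.
Proof. by rewrite /koszul expfzDr // oppr_eq0 oner_eq0. Qed.

Lemma koszul_sqr a : koszul k a * koszul k a = 1.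
Proof.
rewrite /koszul -expfzMl mulrNN mulr1; exact: exp1rz.
Qed.

Lemma koszul1 : koszul k 1 = -1.
Proof. by []. Qed.

Lemma koszulN a : koszul k (- a) = koszul k a.
Proof.
by rewrite -[LHS]mulr1 -(koszul_sqr a) mulrA -koszulD addNr mul1r.
Qed.

Lemma koszul_odd a : koszul k a = -1 -> forall b, koszul k (a * b) = koszul k b.
Proof.
move=> ha b; have h : forall n : nat, koszul k (a * n%:Z) = koszul k n%:Z.
  elim=> [|n IH]; first by rewrite mulr0.
  by rewrite -addn1 PoszD mulrDr mulr1 !koszulD IH ha koszul1.
case: b => n; first exact: h.
by rewrite NegzE mulrN !koszulN h.
Qed.

End Koszul.

Section Projection.
Variables (k : fieldType) (V : bigraded k).
Implicit Types (x y : V) (e : int * int).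

(** The list only has to contain the support, so decompositions with different supports can be
    added; the function [f] is unique, the list is not. *)
Definition bg_decomp x (f : int * int -> V) : Prop :=
  (forall e, bg_hom e.1 e.2 (f e)) /\
  exists s : seq (int * int), [/\ uniq s, forall e, e \notin s -> f e = 0
     & x = \sum_(e <- s) f e].

Lemma sum_support (W : zmodType) (s t : seq (int * int)) (f : int * int -> W) :
  uniq s -> uniq t -> {subset s <= t} -> (forall e, e \notin s -> f e = 0) ->
  \sum_(e <- t) f e = \sum_(e <- s) f e.
Proof.
move=> us ut st f0; rewrite (bigID (mem s)) /= [X in _ + X]big1; last first.
  by move=> e; apply: f0.
rewrite addr0 -big_filter; apply: perm_big; apply: uniq_perm => //.
  exact: filter_uniq.
move=> e; rewrite mem_filter; case es: (e \in s) => //=; exact: st.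
Qed.

Lemma bg_decomp_lin a x y f g : bg_decomp x f -> bg_decomp y g ->
  bg_decomp (a *: x + y) (fun e => a *: f e + g e).
Proof.
move=> [hf [s [us fs ->]]] [hg [t [ut gt ->]]]; split.
  by move=> e; apply: bg_homP.
exists (undup (s ++ t)); split; first exact: undup_uniq.
  move=> e; rewrite mem_undup mem_cat negb_or => /andP[es et].
  by rewrite fs // gt // scaler0 addr0.
rewrite big_split /= -scaler_sumr; congr (_ *: _ + _); apply/esym/sum_support => //;
  rewrite ?undup_uniq // => e h; rewrite mem_undup mem_cat h ?orbT //.
Qed.

Lemma bg_decomp_hom p q x : bg_hom p q x ->
  bg_decomp x (fun e => if e == (p, q) then x else 0).
Proof.
move=> hx; split.
  by move=> e; case: eqP => [->//|_]; apply: bg_hom0.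
exists [:: (p, q)]; split => //; last by rewrite big_seq1 eqxx.
by move=> e; rewrite inE => /negPf ->.
Qed.

Lemma bg_decomp_ex x : exists f, bg_decomp x f.
Proof.
have [s [hs ->]] := bg_span x.
elim: s hs => [|v s IH] hs.
  exists (fun=> 0); split; first by move=> e; apply: bg_hom0.
  by exists [::]; split => //; rewrite !big_nil.
have [|f hf] := IH; first by move=> w hw; apply: hs; rewrite inE hw orbT.
have [|p [q hv]] := hs v; first by rewrite inE eqxx.
rewrite big_cons -[v]scale1r.
by eexists; apply: bg_decomp_lin hf; apply: bg_decomp_hom hv.
Qed.

Lemma bg_decomp0 f : bg_decomp 0 f -> forall e, f e = 0.
Proof.
move=> [hf [s [us fs /esym s0]]] e; have [es|] := boolP (e \in s); last exact: fs.
exact: (bg_direct us hf s0).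
Qed.

Lemma bg_decomp_uniq x f g : bg_decomp x f -> bg_decomp x g -> f =1 g.
Proof.
move=> hf hg e; have := bg_decomp_lin (-1) hf hg.
rewrite scaleN1r addNr => /bg_decomp0/(_ e)/eqP.
by rewrite scaleN1r addrC subr_eq0 => /eqP.
Qed.

Fact bg_proj_key : {f : int * int -> {linear V -> V} |
  forall x, bg_decomp x (fun e => f e x)}.
Proof.
pose f e x := projT1 (cid (bg_decomp_ex x)) e.
have fP x : bg_decomp x (fun e => f e x).
  by rewrite /f; case: cid => g hg; rewrite /=; congr (bg_decomp _ _): hg.
have lf e : linear (f e).
  move=> a x y; have := bg_decomp_uniq (fP (a *: x + y)) (bg_decomp_lin a (fP x) (fP y)).
  exact.
by exists (fun e => lin_of (lf e)).
Qed.

Definition bg_proj : int * int -> {linear V -> V} := projT1 bg_proj_key.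

Lemma bg_projP x : bg_decomp x (fun e => bg_proj e x).
Proof. by rewrite /bg_proj; case: bg_proj_key. Qed.

Lemma bg_proj_hom e x : bg_hom e.1 e.2 (bg_proj e x).
Proof. by have [/(_ e)] := bg_projP x. Qed.

Lemma bg_projE p q x e : bg_hom p q x ->
  bg_proj e x = if e == (p, q) then x else 0.
Proof.
by move=> hx; apply: bg_decomp_uniq (bg_projP x) (bg_decomp_hom hx) _.
Qed.

Lemma bg_proj_id p q x : bg_hom p q x -> bg_proj (p, q) x = x.
Proof. by move/bg_projE ->; rewrite eqxx. Qed.

Lemma bg_proj_sum x : exists s : seq (int * int), uniq s /\
  (forall e, e \notin s -> bg_proj e x = 0) /\ x = \sum_(e <- s) bg_proj e x.
Proof. by have [_ [s []]] := bg_projP x; exists s. Qed.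

Lemma bg_ind (Q : V -> Prop) : Q 0 -> (forall x y, Q x -> Q y -> Q (x + y)) ->
  (forall p q x, bg_hom p q x -> Q x) -> forall x, Q x.
Proof.
move=> Q0 QD Qh x; have [s [hs ->]] := bg_span x.
rewrite big_seq; elim/big_ind: _ => // v /hs[p [q]]; exact: Qh.
Qed.

Lemma bg_homD p q x y : bg_hom p q x -> bg_hom p q y -> bg_hom p q (x + y).
Proof. by move=> hx hy; rewrite -[x]scale1r; apply: bg_homP. Qed.

Lemma bg_homZ p q a x : bg_hom p q x -> bg_hom p q (a *: x).
Proof. by move=> hx; rewrite -[_ *: _]addr0; apply: bg_homP => //; apply: bg_hom0. Qed.

Lemma bg_homN p q x : bg_hom p q x -> bg_hom p q (- x).
Proof. by rewrite -scaleN1r; apply: bg_homZ. Qed.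

Lemma bg_hom_sum p q I (r : seq I) (P : pred I) (F : I -> V) :
  (forall i, P i -> bg_hom p q (F i)) -> bg_hom p q (\sum_(i <- r | P i) F i).
Proof.
move=> h; elim/big_ind: _ => //; [exact: bg_hom0|exact: bg_homD].
Qed.

Lemma bg_hom3_eq0 e1 e2 e3 x y z : bg_hom e1.1 e1.2 x -> bg_hom e2.1 e2.2 y ->
  bg_hom e3.1 e3.2 z -> uniq [:: e1; e2; e3] -> x + y + z = 0 ->
  [/\ x = 0, y = 0 & z = 0].
Proof.
case: e1 e2 e3 => [p1 q1] [p2 q2] [p3 q3] /= hx hy hz.
rewrite !inE andbT negb_or => /andP[/andP[/negPf n12 /negPf n13] /negPf n23] s0.
have P e : bg_proj e x + bg_proj e y + bg_proj e z = 0 by rewrite -!linearD s0 linear0.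
split; [have := P (p1, q1)|have := P (p2, q2)|have := P (p3, q3)];
  rewrite (bg_projE _ hx) (bg_projE _ hy) (bg_projE _ hz) ?eqxx ?n12 ?n13 ?n23
  1?eq_sym ?n12 1?[(p3, q3) == _]eq_sym ?n13 1?[(p3, q3) == _]eq_sym ?n23 ?addr0 ?add0r //.
Qed.

End Projection.
Arguments bg_proj {k V}.

(** Each [phi e] is given on all of V but matters only in bidegree e; this avoids a separate type
    for every component. *)
Lemma graded_extension (k : fieldType) (V : bigraded k) (W : lmodType k)
    (phi : int * int -> {linear V -> W}) :
  {f : {linear V -> W} | forall p q x, bg_hom p q x -> f x = phi (p, q) x}.
Proof.
pose R x y := exists s : seq (int * int), [/\ uniq s,
  forall e, e \notin s -> bg_proj e x = 0 & y = \sum_(e <- s) phi e (bg_proj e x)].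
(* The sum does not depend on the list, as long as the list contains the support of x. *)
have Rext x s t : uniq s -> uniq t -> {subset s <= t} ->
    (forall e, e \notin s -> bg_proj e x = 0) ->
    \sum_(e <- t) phi e (bg_proj e x) = \sum_(e <- s) phi e (bg_proj e x).
  move=> us ut st h; apply: sum_support => // e es.
  by rewrite h // linear0.
have Rsum x y (s : seq (int * int)) : R x y -> exists2 t, uniq t & {subset s <= t} /\
    y = \sum_(e <- t) phi e (bg_proj e x).
  move=> [t [ut xt ->]]; exists (undup (t ++ s)); first exact: undup_uniq.
  split; first by move=> e es; rewrite mem_undup mem_cat es orbT.
  apply/esym/Rext => //; first exact: undup_uniq.
  by move=> e es; rewrite mem_undup mem_cat es.
have [f fP] : {f : {linear V -> W} | forall x, R x (f x)}.
  apply: linear_of_rel.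
  - move=> x; have [s [us [xs _]]] := bg_proj_sum x.
    by exists (\sum_(e <- s) phi e (bg_proj e x)), s.
  - move=> x y z [s [us xs ->]] /(@Rsum _ _ s) [t ut [st ->]].
    by apply/esym; apply: Rext.
  - move=> a x y x' y' [s [us xs ->]] [t [ut xt ->]].
    exists (undup (s ++ t)); split; first exact: undup_uniq.
      move=> e; rewrite mem_undup mem_cat negb_or => /andP[es et].
      by rewrite linearP xs // xt // scaler0 addr0.
    rewrite -(@Rext x s (undup (s ++ t))) ?undup_uniq //; last first.
      by move=> e es; rewrite mem_undup mem_cat es.
    rewrite -(@Rext x' t (undup (s ++ t))) ?undup_uniq //; last first.
      by move=> e es; rewrite mem_undup mem_cat es orbT.
    rewrite scaler_sumr -big_split /=; apply: eq_bigr => e _.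
    by rewrite !linearP.
exists f => p q x hx; have [s [us xs ->]] := fP x.
rewrite -(@Rext x s (undup (s ++ [:: (p, q)]))) ?undup_uniq //; last first.
  by move=> e es; rewrite mem_undup mem_cat es.
rewrite (@Rext x [:: (p, q)]) ?undup_uniq //; first by rewrite big_seq1 bg_proj_id.
  by move=> e es; rewrite mem_undup mem_cat es orbT.
by move=> e; rewrite inE (bg_projE _ hx) => /negPf ->.
Qed.

Definition has_bidegree (k : fieldType) (V W : bigraded k) (a b : int)
    (f : V -> W) : Prop :=
  forall p q x, bg_hom p q x -> bg_hom (p + a) (q + b) (f x).

Lemma bg_proj_deg (k : fieldType) (V W : bigraded k) a b (f : {linear V -> W}) :
  has_bidegree a b f -> forall p q x,
  bg_proj (p + a, q + b) (f x) = f (bg_proj (p, q) x).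
Proof.
move=> hf p q x; move: x; apply: bg_ind => [|x y hx hy|p' q' x h].
- by rewrite !linear0.
- by rewrite !linearD hx hy.
rewrite (bg_projE _ h) (bg_projE _ (hf _ _ _ h)) !xpair_eqE !(inj_eq (addIr _)).
by case: ifP => //; rewrite linear0.
Qed.

Lemma bg_proj_deg0 (k : fieldType) (V W : bigraded k) (f : {linear V -> W}) :
  (forall p q x, bg_hom p q x -> bg_hom p q (f x)) -> forall e x,
  bg_proj e (f x) = f (bg_proj e x).
Proof.
move=> hf [p q] x.
have := @bg_proj_deg _ _ _ 0 0 f _ p q x; rewrite !addr0; apply.
by move=> p' q' y; rewrite !addr0; apply: hf.
Qed.

Section Sign.
Variables (k : fieldType) (V : bigraded k).

(** The involution x -> (-1)^|x| x. With it, sign rules can be written for elements that are not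
    homogeneous. *)
Definition sgn : {linear V -> V} :=
  projT1 (graded_extension (fun e => koszul k (e.1 + e.2) \*: @idfun V)).

Lemma sgnE p q (x : V) : bg_hom p q x -> sgn x = koszul k (p + q) *: x.
Proof. by rewrite /sgn; case: graded_extension => f fP /fP ->. Qed.

Lemma sgn_hom p q (x : V) : bg_hom p q x -> bg_hom p q (sgn x).
Proof. by move=> h; rewrite (sgnE h); apply: bg_homZ. Qed.

Lemma sgnK : involutive sgn.
Proof.
apply: bg_ind => [|x y hx hy|p q x h]; rewrite ?linear0 ?linearD ?hx ?hy //.
by rewrite (sgnE h) linearZ (sgnE h) /= scalerA koszul_sqr scale1r.
Qed.

End Sign.
Arguments sgn {k V}.

Lemma sgn_comm (k : fieldType) (V W : bigraded k) a b (f : {linear V -> W}) :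
  has_bidegree a b f -> forall x, sgn (f x) = koszul k (a + b) *: f (sgn x).
Proof.
move=> hf; apply: bg_ind => [|x y hx hy|p q x h].
- by rewrite !linear0.
- by rewrite !linearD hx hy.
rewrite (sgnE h) (sgnE (hf _ _ _ h)) linearZ /= scalerA -koszulD.
by congr (koszul k _ *: _); rewrite addrACA addrC.
Qed.

Lemma sgn_comm0 (k : fieldType) (V W : bigraded k) (f : {linear V -> W}) :
  (forall p q x, bg_hom p q x -> bg_hom p q (f x)) ->
  forall x, sgn (f x) = f (sgn x).
Proof.
move=> hf x; rewrite (@sgn_comm _ _ _ 0 0) ?addr0 ?scale1r //.
by move=> p q y; rewrite !addr0; apply: hf.
Qed.

(** * Linear selections *)

Definition linear_rel (k : fieldType) (V W : lmodType k) (R : V -> W -> Prop) :=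
  R 0 0 /\ forall a x y x' y', R x y -> R x' y' -> R (a *: x + x') (a *: y + y').

(** Zorn's lemma gives a maximal graph of a partial linear map inside R; if x were outside its
    domain, adding the line through (x, y) with R x y would enlarge it. *)
Lemma linear_selection (k : fieldType) (V W : lmodType k) (R : V -> W -> Prop) :
  linear_rel R -> (forall x, exists y, R x y) ->
  {f : {linear V -> W} | forall x, R x (f x)}.
Proof.
move=> [R0 RP] ex; apply: cid.
pose P (G : set (V * W)) := [/\ G (0, 0),
  forall a x y, G x -> G y -> G (a *: x + y), forall x, G x -> R x.1 x.2
  & forall y, G (0, y) -> y = 0].
(* The empty chain also has to be bounded, and its union is the empty set; hence the conditions are
   imposed on G with (0, 0) added. *)
have [G [[G0 GP GR Gf] Gmax]] : exists G, P (G `|` [set (0, 0)])%classic /\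
    (forall B, (G `<` B)%classic -> ~ P (B `|` [set (0, 0)])%classic).
  apply: (@Zorn_bigcup _ (fun G => P (G `|` [set (0, 0)])%classic)) => F FP Ftot.
  have lift x : ((\bigcup_(X in F) X) `|` [set (0, 0)])%classic x ->
      x = (0, 0) \/ exists2 X, F X & X x.
    by case=> [[X FX Xx]|->]; [right; exists X|left].
  split.
  - by right.
  - move=> a x y /lift + /lift; case=> [->|[X FX Xx]].
      case=> [->|[Y FY Yy]]; first by right; rewrite scaler0 addr0.
      by left; exists Y => //; rewrite scaler0 add0r.
    case=> [->|[Y FY Yy]].
      have [_ XP _ _] := FP _ FX; rewrite /=.
      by case: (XP a x 0 (or_introl Xx) (or_intror erefl)) => h; [left; exists X|right].
    have [XY|YX] := Ftot _ _ FX FY.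
      have [_ YP _ _] := FP _ FY.
      by case: (YP a x y (or_introl (XY _ Xx)) (or_introl Yy)) => h; [left; exists Y|right].
    have [_ XP _ _] := FP _ FX.
    by case: (XP a x y (or_introl Xx) (or_introl (YX _ Yy))) => h; [left; exists X|right].
  - move=> x /lift[->//|[X FX Xx]]; have [_ _ h _] := FP _ FX.
    by apply: h; left.
  - move=> y /lift[[]//|[X FX Xx]]; have [_ _ _ h] := FP _ FX.
    by apply: h; left.
set H : set (V * W) := (G `|` [set (0, 0)])%classic in G0 GP GR Gf.
have HZ a x : H x -> H (a *: x).
  by move=> hx; rewrite -[_ *: _]addr0; apply: GP.
have HB x y : H x -> H y -> H (x - y).
  by move=> hx hy; rewrite addrC -scaleN1r; apply: GP.
have Htot x : exists y, H (x, y).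
  apply: contrapT => nx; have [y Rxy] := ex x.
  pose B : set (V * W) := fun z => exists2 h, H h & exists a, z = h + a *: (x, y).
  have HsB z : H z -> B z by move=> Hz; exists z => //; exists 0; rewrite scale0r addr0.
  have Bxy : B (x, y) by exists 0 => //; exists 1; rewrite scale1r add0r.
  apply: (Gmax B).
    split; first by move=> z Gz; apply: HsB; left.
    by move=> /(_ _ Bxy) Gxy; apply: nx; exists y; left.
  have -> : (B `|` [set (0, 0)] = B)%classic.
    by apply/seteqP; split => z; [case=> // ->; apply: HsB|left].
  split.
  - exact: HsB.
  - move=> a _ _ [z Hz [b ->]] [t Ht [c ->]]; exists (a *: z + t); first exact: GP.
    by exists (a * b + c); rewrite scalerDr addrACA scalerA -scalerDl.
  - move=> _ [z Hz [b ->]] /=; rewrite addrC [z.2 + _]addrC.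
    by apply: RP => //; apply: GR.
  (* If a is nonzero, the first coordinate of z is -a x, so a multiple of z already puts x into the
     domain. *)
  - move=> w [z Hz [a e]]; have [a0|a0] := eqVneq a 0.
      by apply: Gf; rewrite e a0 scale0r addr0.
    case: nx; exists (y - a^-1 *: w).
    have -> : (x, y - a^-1 *: w) = (- a^-1) *: z.
      have e1 : 0 = z.1 + a *: x by have := congr1 fst e.
      have e2 : w = z.2 + a *: y by have := congr1 snd e.
      rewrite [z]surjective_pairing; congr pair.
        move/esym/eqP: e1; rewrite addr_eq0 => /eqP -> /=.
        by rewrite scalerN scaleNr opprK scalerA mulVf // scale1r.
      by rewrite e2 /= scalerDr scalerA mulVf // scale1r opprD scaleNr addrC subrK.
    exact: HZ.
have [f fH] : {f : {linear V -> W} | forall x, H (x, f x)}.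
  apply: (@linear_of_rel _ _ _ (fun x y => H (x, y))) => //.
    move=> x y z hy hz; apply/eqP; rewrite -subr_eq0; apply/eqP; apply: Gf.
    have <- : (x, y) - (x, z) = (0, y - z) by rewrite -[in RHS](subrr x).
    exact: HB.
  by move=> a x y x' y' h h'; apply: (GP a _ _ h h').
by exists f => x; apply: (GR _ (fH x)).
Qed.

(** The selection is made in one bidegree at a time, so R itself does not have to be stable under
    the projections. *)
Lemma graded_selection (k : fieldType) (V W : bigraded k) (R : V -> W -> Prop) :
  linear_rel R ->
  (forall p q x, bg_hom p q x -> exists2 y, bg_hom p q y & R x y) ->
  exists f : {linear V -> W},
    (forall p q x, bg_hom p q x -> bg_hom p q (f x)) /\ (forall x, R x (f x)).
Proof.
move=> Rlin ex; have [R0 RP] := Rlin.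
have RD x y x' y' : R x y -> R x' y' -> R (x + x') (y + y').
  by move=> h h'; rewrite -[x]scale1r -[y]scale1r; apply: RP.
have sel e : {f : {linear V -> W} | forall x, bg_hom e.1 e.2 (f x) /\ R (bg_proj e x) (f x)}.
  apply: (@linear_selection _ _ _ (fun x y => bg_hom e.1 e.2 y /\ R (bg_proj e x) y)).
    split; first by split; [apply: bg_hom0|rewrite linear0].
    move=> a x y x' y' [hy r] [hy' r']; split; first exact: bg_homP.
    by rewrite linearP; apply: RP.
  move=> x; have [y] := @ex e.1 e.2 (bg_proj e x) (bg_proj_hom _ _).
  by exists y.
have [f fP] := graded_extension (fun e => projT1 (sel e)).
have fh p q x : bg_hom p q x -> bg_hom p q (f x) /\ R x (f x).
  move=> hx; rewrite (fP _ _ _ hx); case: (sel (p, q)) => g /= /(_ x).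
  by rewrite (bg_proj_id hx).
exists f; split; first by move=> p q x /fh[].
by apply: bg_ind => [|x y|p q x /fh[]//]; rewrite ?linear0 ?linearD //; apply: RD.
Qed.

Lemma linear_rel_sum (k : fieldType) (V W : lmodType k) (R : V -> W -> Prop)
    (I : Type) (r : seq I) (P : pred I) (F : I -> V) (G : I -> W) :
  linear_rel R -> (forall i, P i -> R (F i) (G i)) ->
  R (\sum_(i <- r | P i) F i) (\sum_(i <- r | P i) G i).
Proof.
move=> [R0 RP] h; elim/big_ind2: _ => // x y x' y' r1 r2.
by rewrite -[x]scale1r -[y]scale1r; apply: RP.
Qed.

Lemma pchar0_natf_neq0 (k : fieldType) : [pchar k] =i pred0 ->
  forall n, n.+1%:R != 0 :> k.
Proof. by move=> /pcharf0P ch n; rewrite ch. Qed.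

(* Averaging over the symmetric group makes the selection equivariant. *)
Lemma smodule_selection (k : fieldType) (E O : smodule k)
    (R : forall n, E n -> O n -> Prop) :
  [pchar k] =i pred0 ->
  (forall n, linear_rel (@R n)) ->
  (forall n (s : 'S_n) x y, R n x y -> R n (sm_act s x) (sm_act s y)) ->
  (forall n p q (x : E n), bg_hom p q x -> exists2 y, bg_hom p q y & R n x y) ->
  exists f : smod_hom E O, forall n (x : E n), R n x (f n x).
Proof.
move=> ch Rlin Ract ex.
have sel n : {f : {linear E n -> O n} |
    [/\ forall p q x, bg_hom p q x -> bg_hom p q (f x),
        forall (s : 'S_n) x, f (sm_act s x) = sm_act s (f x) & forall x, R n x (f x)]}.
  apply: cid; have [f [fh fR]] := graded_selection (Rlin n) (@ex n).
  pose c : k := (n`!%:R)^-1.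
  pose g (x : E n) : O n := c *: \sum_(s : 'S_n) sm_act s^-1%g (f (sm_act s x)).
  have lg : linear g.
    move=> a x y; rewrite /g scalerA mulrC -scalerA -scalerDr; congr (_ *: _).
    by rewrite scaler_sumr -big_split; apply: eq_bigr => s _; rewrite /= !linearP.
  exists (lin_of lg); split; rewrite ?/lin_of /=.
  - move=> p q x hx; apply: bg_homZ; apply: bg_hom_sum => s _.
    by apply: sm_act_deg; apply: fh; apply: sm_act_deg.
  - move=> s x; rewrite [RHS]linearZ /= linear_sum /g; congr (_ *: _).
    rewrite (reindex_inj (mulgI s^-1%g)) /=; apply: eq_bigr => t _.
    by rewrite -[sm_act (_ * t)%g _]sm_actM mulgA mulgV mul1g invMg invgK sm_actM.
  (* Writing x as the average of n! copies of itself allows the relation to be averaged term by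
     term. *)
  - move=> x; have {1}-> : x = c *: \sum_(s : 'S_n) x.
      rewrite sumr_const card_Sn -scaler_nat scalerA mulVf ?scale1r //.
      by rewrite -(prednK (fact_gt0 n)) pchar0_natf_neq0.
    have [R0 RP] := Rlin n; rewrite -[_ *: _]addr0 -[g x]addr0; apply: RP => //.
    apply: linear_rel_sum => // s _.
    by rewrite -{1}[x](sm_act1) -(mulgV s) sm_actM; apply: Ract.
pose h n := projT1 (sel n).
have hP n := projT2 (sel n).
exists (@SModHom _ E O h (fun n => let: And3 a _ _ := hP n in a)
  (fun n => let: And3 _ a _ := hP n in a)) => n x /=.
by have [_ _] := hP n; apply.
Qed.

(** * Suboperads and operads of functions *)

Record submod (k : fieldType) (V : lmodType k) := Submod {
  submod_set : set V;
  submod0 : submod_set 0;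
  submodP : forall a x y, submod_set x -> submod_set y -> submod_set (a *: x + y) }.

Section Subspace.
Variables (k : fieldType) (V : lmodType k) (S : submod V).

Definition submod_pred : pred V := fun x => `[< submod_set S x >].

Fact submod_pred_closed : GRing.subsemimod_closed submod_pred.
Proof.
split; first split.
- by apply/asboolP; apply: submod0.
- move=> x y /asboolP hx /asboolP hy; apply/asboolP.
  by rewrite -[x]scale1r; apply: submodP.
- move=> a x /asboolP hx; apply/asboolP; rewrite -[_ *: _]addr0.
  by apply: submodP => //; apply: submod0.
Qed.
HB.instance Definition _ := GRing.isSubmodClosed.Build k V submod_pred
  submod_pred_closed.

Record subspace := Subspace { subspace_val :> V; _ : subspace_val \in submod_pred }.
HB.instance Definition _ := [isSub for subspace_val].
HB.instance Definition _ := [Choice of subspace by <:].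
HB.instance Definition _ := [SubChoice_isSubLmodule of subspace by <:].

Lemma subspaceP (x : subspace) : submod_set S (val x).
Proof. by have /asboolP := valP x. Qed.

Definition to_subspace x (Sx : submod_set S x) : subspace := Subspace (introT (asboolP _) Sx).

Definition subspace_lin : {linear subspace -> V} := val.
End Subspace.

Section Family.
Variables (k : fieldType) (P : goperad k) (X : Type) (V : nat -> lmodType k).
Variable ev : forall n, X -> {linear V n -> P n}.

(* The structure which makes every [ev n t] an operad morphism.  It covers both
   suboperads (X a point) and operads of functions X -> P. *)
Record goperad_family := GoperadFamily {
  fam_inj : forall n (x y : V n), (forall t, ev n t x = ev n t y) -> x = y;
  fam_span : forall n (x : V n), exists s : seq (V n),
    (forall v, v \in s -> exists p q, forall t, bg_hom p q (ev n t v)) /\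
    x = \sum_(v <- s) v;
  fam_id : exists x, forall t, ev 1 t x = op_id P;
  fam_comp : forall m n r (e : r.+1 = (m + n)%N) (i : 'I_m) x y,
    exists z, forall t, ev r t z = op_comp e i (ev m t x) (ev n t y);
  fam_act : forall n (s : 'S_n) x, exists z, forall t, ev n t z = sm_act s (ev n t x) }.

Variable F : goperad_family.

Definition fam_hom n p q (x : V n) := forall t, bg_hom p q (ev n t x).

Fact fam_hom0 n p q : @fam_hom n p q 0.
Proof. by move=> t; rewrite linear0; apply: bg_hom0. Qed.

Fact fam_homP n p q a x y : @fam_hom n p q x -> @fam_hom n p q y ->
  @fam_hom n p q (a *: x + y).
Proof. by move=> hx hy t; rewrite linearP; apply: bg_homP. Qed.

Fact fam_direct n (s : seq (int * int)) (f : int * int -> V n) :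
  uniq s -> (forall e, fam_hom e.1 e.2 (f e)) ->
  \sum_(e <- s) f e = 0 -> forall e, e \in s -> f e = 0.
Proof.
move=> us hf f0 e es; apply: fam_inj => // t; rewrite linear0.
apply: (@bg_direct _ _ s (fun e => ev n t (f e))) => // [e'|]; first exact: hf.
by rewrite -linear_sum f0 linear0.
Qed.

Definition fam_bg n : bigraded k :=
  Bigraded (@fam_hom0 n) (@fam_homP n) (@fam_span F n) (@fam_direct n).

Definition fam_act_fun n (s : 'S_n) : {f : {linear V n -> V n} |
  forall x t, ev n t (f x) = sm_act s (ev n t x)}.
Proof.
apply: (@linear_of_rel _ _ _ (fun x y => forall t, ev n t y = sm_act s (ev n t x))).
- exact: fam_act.
- by move=> x y z hy hz; apply: fam_inj => // t; rewrite hy hz.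
- by move=> a x y x' y' h h' t; rewrite !linearP h h'.
Qed.

Definition fam_sm_act n (s : 'S_n) : {linear fam_bg n -> fam_bg n} :=
  projT1 (fam_act_fun s).

Fact fam_sm_actE n (s : 'S_n) x t : ev n t (fam_sm_act s x) = sm_act s (ev n t x).
Proof. by rewrite /fam_sm_act; case: fam_act_fun. Qed.

Fact fam_act_deg n (s : 'S_n) p q (x : fam_bg n) :
  bg_hom p q x -> bg_hom p q (fam_sm_act s x).
Proof. by move=> h t; rewrite fam_sm_actE; apply: sm_act_deg; apply: h. Qed.

Fact fam_act1 n (x : fam_bg n) : fam_sm_act 1%g x = x.
Proof. by apply: fam_inj => // t; rewrite fam_sm_actE sm_act1. Qed.

Fact fam_actM n (s t : 'S_n) (x : fam_bg n) :
  fam_sm_act (s * t)%g x = fam_sm_act t (fam_sm_act s x).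
Proof. by apply: fam_inj => // u; rewrite !fam_sm_actE sm_actM. Qed.

Definition fam_smod : smodule k := SModule fam_act_deg fam_act1 fam_actM.

Definition fam_op_id : fam_smod 1 := projT1 (cid (fam_id F)).

Fact fam_op_idE t : ev 1 t fam_op_id = op_id P.
Proof. by rewrite /fam_op_id; case: cid. Qed.

Definition fam_op_comp m n r (e : r.+1 = (m + n)%N) (i : 'I_m)
  (x : fam_smod m) (y : fam_smod n) : fam_smod r := projT1 (cid (fam_comp F e i x y)).

Fact fam_op_compE m n r (e : r.+1 = (m + n)%N) (i : 'I_m) x y t :
  ev r t (fam_op_comp e i x y) = op_comp e i (ev m t x) (ev n t y).
Proof. by rewrite /fam_op_comp; case: cid. Qed.

(** The evaluations are jointly injective, so every axiom holds because it holds in P at each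
    point. *)
Definition fam_goperad : goperad k.
Proof.
apply: (@GOperad k fam_smod fam_op_id fam_op_comp).
- by move=> t; rewrite fam_op_idE; apply: op_id_deg.
- by move=> m n r e i p q p' q' x y hx hy t; rewrite fam_op_compE; apply: op_comp_deg.
- move=> m n r e i y a x x'; apply: (fam_inj F) => t.
  by rewrite linearP !fam_op_compE linearP op_comp_linl.
- move=> m n r e i y a x x'; apply: (fam_inj F) => t.
  by rewrite linearP !fam_op_compE linearP op_comp_linr.
- by move=> n e i y; apply: (fam_inj F) => t; rewrite fam_op_compE fam_op_idE op_id_l.
- by move=> n e i y; apply: (fam_inj F) => t; rewrite fam_op_compE fam_op_idE op_id_r.
- move=> l m n r s t e1 e2 e3 e4 i j u x y z h; apply: (fam_inj F) => w.
  by rewrite !fam_op_compE; apply: op_comp_seq.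
- move=> l m n r s t e1 e2 e3 e4 i j u v p q p' q' x y z h h' h'' hy hz.
  apply: (fam_inj F) => w; rewrite linearZ /= !fam_op_compE.
  exact: (op_comp_par e1 e2 e3 e4 _ h h' h'' (hy w) (hz w)).
- move=> m n r e i s t rho x y h; apply: (fam_inj F) => w.
  rewrite [RHS]fam_sm_actE !fam_op_compE.
  by rewrite -(op_comp_act _ _ _ h) -!fam_sm_actE.
Defined.

Definition fam_ev (t : X) : goperad_hom fam_goperad P.
Proof.
apply: (@GOperadHom _ fam_goperad P (@SModHom _ fam_goperad P (fun n => ev n t) _ _)).
- by move=> n p q x; apply.
- by move=> n s x; apply: fam_sm_actE.
- by move=> h1 h2; apply: fam_op_idE.
- by move=> h1 h2 m n r e i x y; apply: fam_op_compE.
Defined.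

Lemma ev_act n (s : 'S_n) (x : fam_goperad n) t :
  ev n t (sm_act s x) = sm_act s (ev n t x).
Proof. exact: fam_sm_actE. Qed.

Lemma ev_id t : ev 1 t (op_id fam_goperad) = op_id P.
Proof. exact: fam_op_idE. Qed.

Lemma ev_comp m n r (e : r.+1 = (m + n)%N) (i : 'I_m) (x : fam_goperad m)
    (y : fam_goperad n) t :
  ev r t (op_comp e i x y) = op_comp e i (ev m t x) (ev n t y).
Proof. exact: fam_op_compE. Qed.

End Family.

Section FamilyDifferential.
Variables (k : fieldType) (P : bioperad k) (X : Type) (V : nat -> lmodType k).
Variable ev : forall n, X -> {linear V n -> P n}.
Variable F : goperad_family ev.
Hypothesis fam_d : forall n x, exists z, forall t, ev n t z = bo_d (ev n t x).
Hypothesis fam_db : forall n x, exists z, forall t, ev n t z = bo_db (ev n t x).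
Let O := fam_goperad F.

Definition fam_d_fun n : {f : {linear O n -> O n} |
  forall x t, ev n t (f x) = bo_d (ev n t x)}.
Proof.
apply: (@linear_of_rel _ _ _ (fun x y => forall t, ev n t y = bo_d (ev n t x))).
- exact: fam_d.
- by move=> x y z hy hz; apply: (fam_inj F) => // t; rewrite hy hz.
- by move=> a x y x' y' h h' t; rewrite !linearP h h'.
Qed.

Definition fam_db_fun n : {f : {linear O n -> O n} |
  forall x t, ev n t (f x) = bo_db (ev n t x)}.
Proof.
apply: (@linear_of_rel _ _ _ (fun x y => forall t, ev n t y = bo_db (ev n t x))).
- exact: fam_db.
- by move=> x y z hy hz; apply: (fam_inj F) => // t; rewrite hy hz.
- by move=> a x y x' y' h h' t; rewrite !linearP h h'.
Qed.

Definition fam_bo_d n : {linear O n -> O n} := projT1 (fam_d_fun n).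
Definition fam_bo_db n : {linear O n -> O n} := projT1 (fam_db_fun n).

Fact fam_bo_dE n (x : O n) t : ev n t (fam_bo_d n x) = bo_d (ev n t x).
Proof. by rewrite /fam_bo_d; case: fam_d_fun. Qed.
Fact fam_bo_dbE n (x : O n) t : ev n t (fam_bo_db n x) = bo_db (ev n t x).
Proof. by rewrite /fam_bo_db; case: fam_db_fun. Qed.

Fact fam_bicomplex n : bicomplex_axioms (fam_bo_d n) (fam_bo_db n).
Proof.
have [h1 h2 h3 h4 h5] := bo_bicomplex P n.
split.
- by move=> p q x hx t; rewrite fam_bo_dE; apply: h1.
- by move=> p q x hx t; rewrite fam_bo_dbE; apply: h2.
- by move=> x; apply: (fam_inj F) => t; rewrite !fam_bo_dE h3 linear0.
- by move=> x; apply: (fam_inj F) => t; rewrite !fam_bo_dbE h4 linear0.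
- move=> x; apply: (fam_inj F) => t.
  by rewrite linearD !(fam_bo_dE, fam_bo_dbE) h5 linear0.
Qed.

Fact fam_derivation (d : forall n, {linear P n -> P n}) (f : forall n, {linear O n -> O n}) :
  operad_derivation d -> (forall n (x : O n) t, ev n t (f n x) = d n (ev n t x)) ->
  operad_derivation f.
Proof.
move=> [h1 h2 h3] fE; split.
- move=> n s x; apply: (fam_inj F) => t; rewrite fE.
  by rewrite !ev_act fE h1.
- by apply: (fam_inj F) => t; rewrite fE ev_id h2 linear0.
- move=> m n r e i p q x y hx; apply: (fam_inj F) => t.
  rewrite fE linearD linearZ !ev_comp !fE.
  by apply: h3; apply: hx.
Qed.

Definition fam_bioperad : bioperad k :=
  BiOperad fam_bicomplex (fam_derivation (bo_d_der P) fam_bo_dE)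
    (fam_derivation (bo_db_der P) fam_bo_dbE).

Definition fam_bo_ev (t : X) : bioperad_hom fam_bioperad P :=
  @BiOperadHom _ fam_bioperad P (fam_ev F t) (fun n x => fam_bo_dE x t)
    (fun n x => fam_bo_dbE x t).

End FamilyDifferential.

(** * Bilinearity of composition, signs and the Leibniz rule *)

Section Composition.
Variables (k : fieldType) (P : goperad k) (m n r : nat) (e : r.+1 = (m + n)%N).
Variable i : 'I_m.
Implicit Types (x : P m) (y : P n).

Lemma op_compDl x x' y : op_comp e i (x + x') y = op_comp e i x y + op_comp e i x' y.
Proof. by have := op_comp_linl e i y 1 x x'; rewrite !scale1r. Qed.

Lemma op_compDr x y y' : op_comp e i x (y + y') = op_comp e i x y + op_comp e i x y'.
Proof. by have := op_comp_linr e i x 1 y y'; rewrite !scale1r. Qed.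

Lemma op_comp0l y : op_comp e i 0 y = 0.
Proof.
by apply: (addrI (op_comp e i 0 y)); rewrite -op_compDl !addr0.
Qed.

Lemma op_comp0r x : op_comp e i x 0 = 0.
Proof.
by apply: (addrI (op_comp e i x 0)); rewrite -op_compDr !addr0.
Qed.

Lemma op_compZl a x y : op_comp e i (a *: x) y = a *: op_comp e i x y.
Proof. by have := op_comp_linl e i y a x 0; rewrite !addr0 op_comp0l addr0. Qed.

Lemma op_compZr a x y : op_comp e i x (a *: y) = a *: op_comp e i x y.
Proof. by have := op_comp_linr e i x a y 0; rewrite !addr0 op_comp0r addr0. Qed.

Lemma op_compNl x y : op_comp e i (- x) y = - op_comp e i x y.
Proof. by rewrite -!scaleN1r op_compZl. Qed.

Lemma op_compNr x y : op_comp e i x (- y) = - op_comp e i x y.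
Proof. by rewrite -!scaleN1r op_compZr. Qed.

Lemma op_comp_suml I (s : seq I) (Q : pred I) (F : I -> P m) y :
  op_comp e i (\sum_(j <- s | Q j) F j) y = \sum_(j <- s | Q j) op_comp e i (F j) y.
Proof.
by apply: (big_morph (fun x => op_comp e i x y)) => [x x'|]; rewrite (op_comp0l, op_compDl).
Qed.

Lemma op_comp_sumr I (s : seq I) (Q : pred I) (F : I -> P n) x :
  op_comp e i x (\sum_(j <- s | Q j) F j) = \sum_(j <- s | Q j) op_comp e i x (F j).
Proof.
by apply: (big_morph (op_comp e i x)) => [y y'|]; rewrite (op_comp0r, op_compDr).
Qed.

Lemma sgn_comp x y : sgn (op_comp e i x y) = op_comp e i (sgn x) (sgn y).
Proof.
move: x; apply: bg_ind => [|x x' hx hx'|p q x hx].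
- by rewrite op_comp0l !linear0 op_comp0l.
- by rewrite op_compDl !linearD hx hx' op_compDl.
move: y; apply: bg_ind => [|y y' hy hy'|p' q' y hy].
- by rewrite op_comp0r !linear0 op_comp0r.
- by rewrite op_compDr !linearD hy hy' op_compDr.
rewrite (sgnE (op_comp_deg e i hx hy)) (sgnE hx) (sgnE hy).
by rewrite op_compZl op_compZr scalerA -koszulD addrACA.
Qed.

End Composition.

Lemma sgn_id (k : fieldType) (P : goperad k) : sgn (op_id P) = op_id P.
Proof. by rewrite (sgnE (op_id_deg P)) addr0 scale1r. Qed.

Lemma sgn_act (k : fieldType) (P : smodule k) n (s : 'S_n) (x : P n) :
  sgn (sm_act s x) = sm_act s (sgn x).
Proof. by rewrite sgn_comm0 // => p q y; apply: sm_act_deg. Qed.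

Lemma smh_sgn (k : fieldType) (P Q : smodule k) (f : smod_hom P Q) n (x : P n) :
  f n (sgn x) = sgn (f n x).
Proof. by rewrite sgn_comm0 // => p q y; apply: smh_deg. Qed.

Lemma smh_proj (k : fieldType) (P Q : smodule k) (f : smod_hom P Q) n e (x : P n) :
  f n (bg_proj e x) = bg_proj e (f n x).
Proof. by rewrite bg_proj_deg0 // => p q y; apply: smh_deg. Qed.

(** Both sides are linear in x once the sign is absorbed in [sgn], so homogeneous x suffice. *)
Lemma leibniz (k : fieldType) (P : goperad k) (d : forall n, {linear P n -> P n}) :
  operad_derivation d -> forall m n r (e : r.+1 = (m + n)%N) (i : 'I_m)
    (x : P m) (y : P n),
  d r (op_comp e i x y) = op_comp e i (d m x) y + op_comp e i (sgn x) (d n y).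
Proof.
move=> [_ _ h] m n r e i x y; move: x; apply: bg_ind => [|x x' hx hx'|p q x hx].
- by rewrite !(op_comp0l, linear0) addr0.
- by rewrite !(op_compDl, linearD) hx hx' addrACA.
by rewrite (h _ _ _ _ _ _ _ _ _ hx) (sgnE hx) op_compZl.
Qed.

Lemma derivation_of_leibniz (k : fieldType) (P : goperad k)
    (d : forall n, {linear P n -> P n}) :
  (forall n (s : 'S_n) (x : P n), d n (sm_act s x) = sm_act s (d n x)) ->
  d 1%N (op_id P) = 0 ->
  (forall m n r (e : r.+1 = (m + n)%N) (i : 'I_m) (x : P m) (y : P n),
    d r (op_comp e i x y) = op_comp e i (d m x) y + op_comp e i (sgn x) (d n y)) ->
  operad_derivation d.
Proof.
move=> h1 h2 h3; split => // m n r e i p q x y hx.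
by rewrite h3 (sgnE hx) op_compZl.
Qed.

Section HomComposition.
Variable k : fieldType.

Definition smod_hom_comp (M N O : smodule k) (g : smod_hom N O) (f : smod_hom M N) :
  smod_hom M O.
Proof.
apply: (@SModHom _ M O (fun n => g n \o f n)).
- by move=> n p q x h; apply: smh_deg; apply: smh_deg.
- by move=> n s x; rewrite /= !smh_act.
Defined.

Definition goperad_hom_comp (P Q O : goperad k) (g : goperad_hom Q O)
    (f : goperad_hom P Q) : goperad_hom P O.
Proof.
apply: (@GOperadHom _ P O (smod_hom_comp g f)).
- by rewrite /= !gh_id.
- by move=> m n r e i x y; rewrite /= !gh_comp.
Defined.

Definition goperad_hom_id (P : goperad k) : goperad_hom P P :=
  @GOperadHom _ P P (@SModHom _ P P (fun n => idfun) (fun n p q x h => h)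
    (fun n s x => erefl)) erefl (fun m n r e i x y => erefl).

Definition bioperad_hom_comp (P Q O : bioperad k) (g : bioperad_hom Q O)
    (f : bioperad_hom P Q) : bioperad_hom P O.
Proof.
apply: (@BiOperadHom _ P O (goperad_hom_comp g f)).
- by move=> n x; rewrite /= !bh_d.
- by move=> n x; rewrite /= !bh_db.
Defined.

Definition bioperad_hom_id (P : bioperad k) : bioperad_hom P P :=
  @BiOperadHom _ P P (goperad_hom_id P) (fun n x => erefl) (fun n x => erefl).

End HomComposition.

Record suboperad (k : fieldType) (P : goperad k) := Suboperad {
  so_sub :> forall n, submod (P n);
  so_graded : forall n e (x : P n), submod_set (so_sub n) x ->
    submod_set (so_sub n) (bg_proj e x);
  so_id : submod_set (so_sub 1) (op_id P);
  so_comp : forall m n r (e : r.+1 = (m + n)%N) (i : 'I_m) (x : P m) (y : P n),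
    submod_set (so_sub m) x -> submod_set (so_sub n) y ->
    submod_set (so_sub r) (op_comp e i x y);
  so_act : forall n (s : 'S_n) (x : P n), submod_set (so_sub n) x ->
    submod_set (so_sub n) (sm_act s x) }.

Section SubOperad.
Variables (k : fieldType) (P : goperad k) (S : suboperad P).

Definition so_ev n (t : unit) : {linear subspace (S n) -> P n} := subspace_lin (S n).

Fact so_family : goperad_family so_ev.
Proof.
split.
- by move=> n x y /(_ tt) h; apply: val_inj.
- move=> n x; have [s [us [xs xE]]] := bg_proj_sum (val x).
  pose f e := to_subspace (so_graded e (subspaceP x)).
  exists [seq f e | e <- s]; split.
    by move=> v /mapP[e es ->]; exists e.1, e.2; case; apply: bg_proj_hom.
  apply: val_inj; rewrite big_map.
  rewrite [RHS](raddf_sum (subspace_lin (S n))) /=.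
  by rewrite [LHS]xE; apply: eq_bigr.
- by exists (to_subspace (so_id S)).
- move=> m n r e i x y.
  by exists (to_subspace (so_comp e i (subspaceP x) (subspaceP y))).
- by move=> n s x; exists (to_subspace (so_act s (subspaceP x))).
Qed.

Definition so_goperad : goperad k := fam_goperad so_family.
Definition so_inc : goperad_hom so_goperad P := fam_ev so_family tt.

Lemma so_incP n (x : so_goperad n) : submod_set (S n) (so_inc n x).
Proof. exact: subspaceP. Qed.

Lemma so_inc_inj n : injective (so_inc n).
Proof. exact: val_inj. Qed.

Lemma so_inc_hom n p q (x : so_goperad n) : bg_hom p q (so_inc n x) -> bg_hom p q x.
Proof. by move=> h []; apply: h. Qed.

Fact so_corestrict_linear (M : smodule k) (f : smod_hom M P)
    (fS : forall n x, submod_set (S n) (f n x)) n :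
  linear (fun x => to_subspace (fS n x)).
Proof. by move=> a x y; apply: val_inj; rewrite /= linearP. Qed.

Definition so_corestrict_smod (M : smodule k) (f : smod_hom M P)
    (fS : forall n x, submod_set (S n) (f n x)) : smod_hom M so_goperad.
Proof.
apply: (@SModHom _ M so_goperad (fun n => lin_of (so_corestrict_linear fS (n:=n)))).
- by move=> n p q x h t; apply: smh_deg.
- move=> n s x; apply: so_inc_inj.
  have -> := smh_act (so_inc : smod_hom _ _) s (lin_of (so_corestrict_linear fS (n:=n)) x).
  exact: (smh_act f s x).
Defined.

Definition so_corestrict (O : goperad k) (f : goperad_hom O P)
    (fS : forall n x, submod_set (S n) (f n x)) : goperad_hom O so_goperad.
Proof.
apply: (@GOperadHom _ O so_goperad (so_corestrict_smod fS)).
- by apply: so_inc_inj; have -> := gh_id so_inc; exact: (gh_id f).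
- move=> m n r e i x y; apply: so_inc_inj.
  have -> := gh_comp so_inc e i (so_corestrict_smod fS m x) (so_corestrict_smod fS n y).
  exact: (gh_comp f e i x y).
Defined.

End SubOperad.

Section SubBioperad.
Variables (k : fieldType) (P : bioperad k) (S : suboperad P).
Hypothesis Sd : forall n (x : P n), submod_set (S n) x -> submod_set (S n) (bo_d x).
Hypothesis Sdb : forall n (x : P n), submod_set (S n) x -> submod_set (S n) (bo_db x).

Definition so_bioperad : bioperad k.
Proof.
apply: (@fam_bioperad k P unit (fun n => subspace (S n)) (so_ev S) (so_family S)).
- by move=> n x; exists (to_subspace (Sd (subspaceP x))).
- by move=> n x; exists (to_subspace (Sdb (subspaceP x))).
Defined.

Definition so_bo_inc : bioperad_hom so_bioperad P := fam_bo_ev _ _ _ tt.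

Definition so_bo_corestrict (O : bioperad k) (f : bioperad_hom O P)
    (fS : forall n x, submod_set (S n) (f n x)) : bioperad_hom O so_bioperad.
Proof.
apply: (@BiOperadHom _ O so_bioperad (so_corestrict fS)).
- move=> n x; apply: so_inc_inj.
  apply: etrans (esym (bh_d so_bo_inc (so_corestrict fS n x))).
  exact: (bh_d f x).
- move=> n x; apply: so_inc_inj.
  apply: etrans (esym (bh_db so_bo_inc (so_corestrict fS n x))).
  exact: (bh_db f x).
Defined.

End SubBioperad.

(** * Generation of free operads *)

Inductive generated (k : fieldType) (P : goperad k) (G : forall n, set (P n)) :
    forall n, P n -> Prop :=
| generated_id : generated G (op_id P)
| generated_gen n (x : P n) : G n x -> generated G x
| generated_comp m n r (e : r.+1 = (m + n)%N) (i : 'I_m) (x : P m) (y : P n) :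
    generated G x -> generated G y -> generated G (op_comp e i x y)
| generated_act n (s : 'S_n) (x : P n) : generated G x -> generated G (sm_act s x)
| generated_zero n : generated G (0 : P n)
| generated_lin n (a : k) (x y : P n) :
    generated G x -> generated G y -> generated G (a *: x + y).

Section Generation.
Variables (k : fieldType) (P : goperad k) (G : forall n, set (P n)).
Hypothesis G_proj : forall n e (x : P n), G x -> G (bg_proj e x).

Lemma generatedD n (x y : P n) : generated G x -> generated G y -> generated G (x + y).
Proof. by move=> hx hy; rewrite -[x]scale1r; apply: generated_lin. Qed.

Lemma generated_sum n I (s : seq I) (Q : pred I) (F : I -> P n) :
  (forall i, Q i -> generated G (F i)) -> generated G (\sum_(i <- s | Q i) F i).
Proof.
by move=> h; elim/big_ind: _ => //; [exact: generated_zero|exact: generatedD].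
Qed.

Lemma generated_proj n (x : P n) : generated G x -> forall e, generated G (bg_proj e x).
Proof.
elim=> {n x} [|n x hx|m n r e i x y _ IHx _ IHy|n s x _ IH|n|n a x y _ IHx _ IHy] d.
- rewrite (bg_projE _ (op_id_deg P)); case: ifP => _.
    exact: generated_id.
  exact: generated_zero.
- by apply: generated_gen; apply: G_proj.
- have [s [_ [_ ->]]] := bg_proj_sum x; have [t [_ [_ ->]]] := bg_proj_sum y.
  rewrite op_comp_suml linear_sum; apply: generated_sum => a _.
  rewrite op_comp_sumr linear_sum; apply: generated_sum => b _.
  have h := op_comp_deg e i (bg_proj_hom a x) (bg_proj_hom b y).
  rewrite (bg_projE _ h); case: ifP => _; last exact: generated_zero.
  exact: generated_comp.
- rewrite bg_proj_deg0; last by move=> p q y; apply: sm_act_deg.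
  exact: generated_act.
- by rewrite linear0; apply: generated_zero.
- by rewrite linearP; apply: generated_lin.
Qed.

Definition generated_submod n : submod (P n) :=
  @Submod _ _ (@generated k P G n) (generated_zero G n) (@generated_lin _ _ G n).

Definition generated_suboperad : suboperad P :=
  @Suboperad k P generated_submod (fun n e x h => generated_proj h e)
    (generated_id G) (@generated_comp _ _ G) (@generated_act _ _ G).

End Generation.

(** The universal property gives a map from T to the suboperad generated by M; followed by the
    inclusion it is the identity of T, by uniqueness. This makes induction on composites of
    generators available. *)
Lemma free_generated (k : fieldType) (M : smodule k) (T : goperad k)
    (inc : smod_hom M T) : is_free_operad inc ->
  forall n (x : T n), generated (fun n x => exists y, x = inc n y) x.
Proof.
move=> free n x; set G := (fun n x => _).
have Gp m e (y : T m) : G m y -> G m (bg_proj e y).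
  by move=> [z ->]; exists (bg_proj e z); rewrite smh_proj.
pose S := generated_suboperad Gp.
have incS m y : submod_set (S m) (inc m y) by apply: generated_gen; exists y.
have [g [gE _]] := free _ (so_corestrict_smod incS).
have [h [_ hU]] := free _ inc.
have := hU (goperad_hom_comp (so_inc S) g) _ n x.
rewrite -(hU (goperad_hom_id T) (fun _ _ => erefl) n x) /= => <-.
  exact: (so_incP (g n x)).
by move=> m y; rewrite /= gE.
Qed.

Lemma free_hom_eq (k : fieldType) (M : smodule k) (T O : goperad k)
    (inc : smod_hom M T) (f g : goperad_hom T O) : is_free_operad inc ->
  (forall n x, f n (inc n x) = g n (inc n x)) -> forall n x, f n x = g n x.
Proof.
move=> free fg n x; have [h [_ hU]] := free _ (smod_hom_comp g inc).
by rewrite (hU f) // (hU g).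
Qed.

(** Both f d and d' f are derivations along f, so they agree as soon as they agree on generators. *)
Lemma free_hom_comm (k : fieldType) (M : smodule k) (T O : goperad k)
    (inc : smod_hom M T) (f : goperad_hom T O)
    (d : forall n, {linear T n -> T n}) (d' : forall n, {linear O n -> O n}) :
  is_free_operad inc -> operad_derivation d -> operad_derivation d' ->
  (forall n x, f n (d n (inc n x)) = d' n (f n (inc n x))) ->
  forall n x, f n (d n x) = d' n (f n x).
Proof.
move=> free dd dd' h n x; have dL := leibniz dd; have dL' := leibniz dd'.
elim: (free_generated free x) => {n x} [|n x [y ->]|m n r e i x y _ IHx _ IHy|n s x _ IH|n|n a x y _ IHx _ IHy].
- by rewrite (od_id dd) linear0 gh_id (od_id dd').
- exact: h.
- by rewrite dL linearD !gh_comp dL' IHx IHy smh_sgn.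
- by rewrite (od_act dd) !smh_act (od_act dd') IH.
- by rewrite !linear0.
- by rewrite !linearP /= IHx IHy.
Qed.

(** * Elements of a sequential colimit *)

Section ColimitStages.
Variables (k : fieldType) (Q : nat -> bioperad k).
Variables (j : forall i, bioperad_hom (Q i) (Q i.+1)) (M : bioperad k).
Variable c : forall i, bioperad_hom (Q i) M.
Hypothesis colim : is_colimit j c.

Lemma colimit_later i l n (x : Q i n) : (i <= l)%N -> exists y, c l n y = c i n x.
Proof.
move=> /subnKC <-; elim: (l - i)%N => [|d [y hy]]; first by rewrite addn0; exists x.
by rewrite addnS; exists (j _ n y); rewrite colim.1.
Qed.

Definition stage_set n : set (M n) := fun x => exists i y, x = c i n y.

Lemma stage_set2 m n (x : M m) (y : M n) : stage_set x -> stage_set y ->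
  exists i x' y', x = c i m x' /\ y = c i n y'.
Proof.
move=> [i [x' ->]] [l [y' ->]].
have [x'' hx] := colimit_later x' (leq_maxl i l).
have [y'' hy] := colimit_later y' (leq_maxr i l).
by exists (maxn i l), x'', y''.
Qed.

Definition stage_submod n : submod (M n).
Proof.
apply: (@Submod _ _ (@stage_set n)); first by exists 0%N, 0; rewrite linear0.
move=> a x y hx hy; have [i [x' [y' [-> ->]]]] := stage_set2 hx hy.
by exists i, (a *: x' + y'); rewrite linearP.
Defined.

Definition stage_suboperad : suboperad M.
Proof.
apply: (@Suboperad k M stage_submod).
- by move=> n e _ [i [x ->]]; exists i, (bg_proj e x); rewrite smh_proj.
- by exists 0%N, (op_id _); rewrite gh_id.
- move=> m n r e i x y hx hy; have [l [x' [y' [-> ->]]]] := stage_set2 hx hy.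
  by exists l, (op_comp e i x' y'); rewrite gh_comp.
- by move=> n s _ [i [x ->]]; exists i, (sm_act s x); rewrite smh_act.
Defined.

(** The images of the stages form a suboperad stable under both differentials. The cocone factors
    through it, and by uniqueness the resulting map from M, followed by the inclusion, is the
    identity. *)
Lemma colimit_stage n (x : M n) : exists i y, x = c i n y.
Proof.
have Sd m (y : M m) : stage_set y -> stage_set (bo_d y).
  by move=> [i [z ->]]; exists i, (bo_d z); rewrite bh_d.
have Sdb m (y : M m) : stage_set y -> stage_set (bo_db y).
  by move=> [i [z ->]]; exists i, (bo_db z); rewrite bh_db.
have cS i m y : submod_set (stage_suboperad m) (c i m y) by exists i, y.
pose f i := @so_bo_corestrict k M stage_suboperad Sd Sdb _ _ (cS i).
have fj i m (y : Q i m) : f i.+1 m (j i m y) = f i m y.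
  by apply: (@so_inc_inj _ _ stage_suboperad); apply: colim.1.
have [g [gE _]] := colim.2 _ f fj.
have [h [_ hU]] := colim.2 _ c colim.1.
have := hU (bioperad_hom_comp (@so_bo_inc k M stage_suboperad Sd Sdb) g) _ n x.
rewrite -(hU (bioperad_hom_id M) (fun _ _ _ => erefl) n x) /= => <-.
  exact: (@so_incP _ _ stage_suboperad n (g n x)).
by move=> i m y; rewrite /= gE.
Qed.

End ColimitStages.

(** * Exterior extensions *)

Section Shift.
Variables (k : fieldType) (a b : int).

Section ShiftBigraded.
Variable V : bigraded k.

Definition shift_hom (p q : int) : set V := bg_hom (p - a) (q - b).

Fact shift_span (x : V) : exists s : seq V,
  (forall v, v \in s -> exists p q, shift_hom p q v) /\ x = \sum_(v <- s) v.
Proof.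
have [s [hs ->]] := bg_span x; exists s; split => // v /hs[p [q h]].
by exists (p + a), (q + b); rewrite /shift_hom !addrK.
Qed.

Fact shift_direct (s : seq (int * int)) (f : int * int -> V) :
  uniq s -> (forall e, shift_hom e.1 e.2 (f e)) ->
  \sum_(e <- s) f e = 0 -> forall e, e \in s -> f e = 0.
Proof.
move=> us hf f0 e es; pose u (d : int * int) := (d.1 + a, d.2 + b).
pose v (d : int * int) := (d.1 - a, d.2 - b).
have vK : cancel v u by move=> [d1 d2]; rewrite /u /v /= !subrK.
have uK : cancel u v by move=> [d1 d2]; rewrite /u /v /= !addrK.
rewrite -[e]vK; apply: (@bg_direct _ _ [seq v d | d <- s] (f \o u)).
- by rewrite map_inj_uniq //; apply: can_inj vK.
- by move=> d; have := hf (u d); rewrite /shift_hom !addrK.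
- by rewrite big_map -[RHS]f0; apply: eq_bigr => d _ /=; rewrite vK.
- exact: map_f.
Qed.

Definition shift_bg : bigraded k :=
  Bigraded (fun p q => bg_hom0 V (p - a) (q - b))
    (fun p q => @bg_homP k V (p - a) (q - b)) shift_span shift_direct.

End ShiftBigraded.

Definition shift_smod (P : smodule k) : smodule k :=
  @SModule k (fun n => shift_bg (P n)) (fun n s => @sm_act k P n s)
    (fun n s p q x => @sm_act_deg k P n s (p - a) (q - b) x)
    (@sm_act1 k P) (@sm_actM k P).

End Shift.

(* P tensored with the exterior algebra on a generator theta of bidegree (a, b)
   of odd total degree; the pair (x, y) stands for x + theta y. *)
Section Exterior.
Variables (k : fieldType) (a b : int).
Hypothesis odd_ab : koszul k (a + b) = -1.

Section ExteriorOperad.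
Variable P : goperad k.

Definition ext_smod : smodule k := smsum P (shift_smod a b P).

Definition mk n (x y : P n) : ext_smod n := (x, y).

Fact re_linear n : linear (fun x : ext_smod n => x.1 : P n). Proof. by []. Qed.
Fact im_linear n : linear (fun x : ext_smod n => x.2 : P n). Proof. by []. Qed.
Definition re n : {linear ext_smod n -> P n} := lin_of (@re_linear n).
Definition im n : {linear ext_smod n -> P n} := lin_of (@im_linear n).

Lemma re_mk n (x y : P n) : re n (mk x y) = x. Proof. by []. Qed.
Lemma im_mk n (x y : P n) : im n (mk x y) = y. Proof. by []. Qed.

Lemma mkP n c (x y x' y' : P n) :
  c *: mk x y + mk x' y' = mk (c *: x + x') (c *: y + y').
Proof. by []. Qed.

Lemma ext_eq n (x y : ext_smod n) : re n x = re n y -> im n x = im n y -> x = y.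
Proof. by case: x y => [x1 x2] [y1 y2]; rewrite /re /im /= => -> ->. Qed.

Lemma ext_homE n p q (x : ext_smod n) :
  bg_hom p q x = (bg_hom p q (re n x) /\ bg_hom (p - a) (q - b) (im n x)).
Proof. by []. Qed.

Lemma re_act n (s : 'S_n) (x : ext_smod n) : re n (sm_act s x) = sm_act s (re n x).
Proof. by []. Qed.
Lemma im_act n (s : 'S_n) (x : ext_smod n) : im n (sm_act s x) = sm_act s (im n x).
Proof. by []. Qed.

Lemma koszul_shift p q : koszul k ((p - a) + (q - b)) = - koszul k (p + q).
Proof. by rewrite addrACA -opprD koszulD koszulN odd_ab mulrN1. Qed.

Lemma koszul_shiftM p q c :
  koszul k ((p - a + (q - b)) * c) = koszul k ((p + q) * c) * koszul k c.
Proof.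
by rewrite addrACA -opprD mulrDl mulNr koszulD koszulN (koszul_odd odd_ab).
Qed.

Lemma re_sgn n (x : ext_smod n) : re n (sgn x) = sgn (re n x).
Proof.
move: x; apply: bg_ind => [|x y hx hy|p q x hx]; first by rewrite !linear0.
  by rewrite !linearD hx hy.
by rewrite (sgnE hx) linearZ; case: hx => hx _; rewrite (sgnE (hx : bg_hom p q (re n x))).
Qed.

Lemma im_sgn n (x : ext_smod n) : im n (sgn x) = - sgn (im n x).
Proof.
move: x; apply: bg_ind => [|x y hx hy|p q x hx]; first by rewrite !linear0 ?oppr0.
  by rewrite !linearD hx hy ?opprD.
rewrite (sgnE hx) linearZ /=; case: hx => _ hx.
by rewrite (sgnE (hx : bg_hom (p - a) (q - b) (im n x))) koszul_shift scaleNr opprK.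
Qed.

(** The product of x + theta y and x' + theta y': moving theta to the left past x costs the sign of
    x, and theta^2 = 0. *)
Definition ext_comp m n r (e : r.+1 = (m + n)%N) (i : 'I_m)
    (x : ext_smod m) (y : ext_smod n) : ext_smod r :=
  mk (op_comp e i (re m x) (re n y))
     (op_comp e i (im m x) (re n y) + op_comp e i (sgn (re m x)) (im n y)).

Section ExtComp.
Variables (m n r : nat) (e : r.+1 = (m + n)%N) (i : 'I_m).
Variables (x : ext_smod m) (y : ext_smod n).

Fact re_ext_comp : re r (ext_comp e i x y) = op_comp e i (re m x) (re n y).
Proof. by []. Qed.
Fact im_ext_comp : im r (ext_comp e i x y) =
  op_comp e i (im m x) (re n y) + op_comp e i (sgn (re m x)) (im n y).
Proof. by []. Qed.

End ExtComp.

Opaque re im.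

Definition ext_goperad : goperad k.
Proof.
apply: (@GOperad k ext_smod (mk (op_id P) 0) ext_comp).
- by rewrite ext_homE re_mk im_mk; split; [apply: op_id_deg|apply: bg_hom0].
- move=> m n r e i p q p' q' x y; rewrite !ext_homE => -[x1 x2] [y1 y2].
  rewrite re_ext_comp im_ext_comp; split; first exact: op_comp_deg.
  apply: bg_homD.
    by rewrite addrAC [q + q' - b]addrAC; apply: op_comp_deg.
  by rewrite -addrA -[q + q' - b]addrA; apply: op_comp_deg => //; apply: sgn_hom.
- move=> m n r e i y c x x'; apply: ext_eq; rewrite !linearP ?re_ext_comp ?im_ext_comp.
    by rewrite !linearP op_compDl op_compZl.
  by rewrite !linearP !(op_compDl, op_compZl) scalerDr addrACA.
- move=> m n r e i x c y y'; apply: ext_eq; rewrite !linearP ?re_ext_comp ?im_ext_comp.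
    by rewrite !linearP op_compDr op_compZr.
  by rewrite !linearP !(op_compDr, op_compZr) scalerDr addrACA.
- move=> n e i y; apply: ext_eq; first by rewrite re_ext_comp re_mk op_id_l.
  by rewrite im_ext_comp re_mk im_mk sgn_id op_comp0l add0r op_id_l.
- move=> m e i x; apply: ext_eq; first by rewrite re_ext_comp re_mk op_id_r.
  by rewrite im_ext_comp re_mk im_mk op_comp0r addr0 op_id_r.
- move=> l m n r s t e1 e2 e3 e4 i j u x y z h.
  have S := fun x y z => @op_comp_seq k P _ _ _ _ _ _ e1 e2 e3 e4 i j u x y z h.
  apply: ext_eq; rewrite ?re_ext_comp ?im_ext_comp ?re_ext_comp ?S //.
  by rewrite ?im_ext_comp op_compDl op_compDr !sgn_comp !S addrA.
- move=> l m n r s t e1 e2 e3 e4 i j u v p q p' q' x y z ij hu hv.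
  rewrite !ext_homE => -[hy1 hy2] [hz1 hz2].
  have S p q p' q' x y z := @op_comp_par k P _ _ _ _ _ _ e1 e2 e3 e4 i j u v p q p' q' x y z ij hu hv.
  apply: ext_eq; rewrite linearZ ?re_ext_comp ?im_ext_comp ?re_ext_comp.
    by rewrite (S _ _ _ _ _ _ _ hy1 hz1).
  rewrite ?im_ext_comp !op_compDl sgn_comp.
  rewrite (S _ _ _ _ _ _ _ hy1 hz1) (S _ _ _ _ _ _ _ hy2 hz1).
  rewrite sgn_comp (S _ _ _ _ _ _ _ (sgn_hom hy1 : bg_hom p q _) hz2) (sgnE hz1) (sgnE hy1).
  (* Lowering the degree of y or z by that of theta changes the Koszul sign by the degree of the
     other factor; this is the sign of moving theta past that factor. *)
  rewrite !op_compZr op_compZl /= scalerDr scalerDr !scalerA koszul_shiftM.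
  rewrite [(p + q) * (p' - a + _)]mulrC koszul_shiftM -mulrA koszul_sqr mulr1.
  by rewrite [(p' + q') * _]mulrC addrAC.
- move=> m n r e i s t rho x y h; apply: ext_eq.
    by rewrite re_act !re_ext_comp !re_act (op_comp_act _ _ _ h).
  rewrite im_act !im_ext_comp !re_act !im_act sgn_act !(op_comp_act _ _ _ h).
  by rewrite linearD.
Defined.

Lemma re_comp m n r (e : r.+1 = (m + n)%N) (i : 'I_m) (x : ext_goperad m)
    (y : ext_goperad n) : re r (op_comp e i x y) = op_comp e i (re m x) (re n y).
Proof. by []. Qed.

Lemma im_comp m n r (e : r.+1 = (m + n)%N) (i : 'I_m) (x : ext_goperad m)
    (y : ext_goperad n) : im r (op_comp e i x y) =
  op_comp e i (im m x) (re n y) + op_comp e i (sgn (re m x)) (im n y).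
Proof. by []. Qed.

Lemma re_id : re 1 (op_id ext_goperad) = op_id P. Proof. by []. Qed.
Lemma im_id : im 1 (op_id ext_goperad) = 0. Proof. by []. Qed.

Definition ext_re_hom : goperad_hom ext_goperad P :=
  @GOperadHom _ ext_goperad P (@SModHom _ ext_goperad P re
    (fun n p q x h => proj1 h) (fun n s x => erefl)) erefl
    (fun m n r e i x y => erefl).

Section ExtDerivation.
Variable d : forall n, {linear P n -> P n}.

Fact ext_d_linear n : linear (fun x : ext_goperad n => mk (d n (re n x)) (- d n (im n x))).
Proof.
by move=> c x y; rewrite mkP scalerN -opprD -!linearP.
Qed.

(** d (x + theta y) = d x - theta d y: the differential of P passes theta with a sign. *)
Definition ext_d n : {linear ext_goperad n -> ext_goperad n} := lin_of (@ext_d_linear n).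

Lemma re_ext_d n (x : ext_goperad n) : re n (ext_d n x) = d n (re n x).
Proof. by []. Qed.
Lemma im_ext_d n (x : ext_goperad n) : im n (ext_d n x) = - d n (im n x).
Proof. by []. Qed.

Lemma ext_d_deg c e n : has_bidegree c e (d n) -> has_bidegree c e (ext_d n).
Proof.
move=> hd p q x; rewrite !ext_homE => -[h1 h2]; rewrite re_ext_d im_ext_d; split.
  exact: hd.
by apply: bg_homN; rewrite addrAC [q + e - b]addrAC; apply: hd.
Qed.

Lemma ext_d_derivation c e : koszul k (c + e) = -1 -> (forall n, has_bidegree c e (d n)) ->
  operad_derivation d -> operad_derivation ext_d.
Proof.
move=> ce hd der; have L := leibniz der.
have dsgn n (x : P n) : d n (sgn x) = - sgn (d n x).
  by rewrite (sgn_comm (hd n)) ce scaleN1r opprK.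
apply: derivation_of_leibniz => [n s x||m n r e' i x y].
- by apply: ext_eq; rewrite ?(re_act, re_ext_d, im_act, im_ext_d) ?(od_act der) // linearN.
- apply: ext_eq; first by rewrite re_ext_d re_id (od_id der) linear0.
  by rewrite im_ext_d im_id !linear0 ?oppr0.
- apply: ext_eq.
    by rewrite linearD re_ext_d !re_comp re_sgn !re_ext_d L.
  rewrite linearD im_ext_d !im_comp re_sgn im_sgn !re_ext_d !im_ext_d linearD !L.
  rewrite dsgn sgnK !(op_compNl, op_compNr) !opprD opprK -!addrA; congr (_ + _).
  exact: addrCA.
Qed.

End ExtDerivation.

Fact ext_contract_linear n : linear (fun x : ext_goperad n => mk (im n x) 0).
Proof.
by move=> c x y; rewrite mkP scaler0 addr0 -!linearP.
Qed.

(** The derivation d/dtheta. It will be the differential of the cofree construction. *)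
Definition ext_contract n : {linear ext_goperad n -> ext_goperad n} :=
  lin_of (@ext_contract_linear n).

Lemma re_contract n (x : ext_goperad n) : re n (ext_contract n x) = im n x.
Proof. by []. Qed.
Lemma im_contract n (x : ext_goperad n) : im n (ext_contract n x) = 0.
Proof. by []. Qed.

Lemma ext_contract_derivation : operad_derivation ext_contract.
Proof.
apply: derivation_of_leibniz => [n s x||m n r e i x y]; apply: ext_eq.
- by rewrite re_act !re_contract im_act.
- by rewrite im_act !im_contract ?linear0.
- by rewrite re_contract im_id ?linear0.
- by rewrite im_contract ?linear0.
- by rewrite linearD !re_comp !re_contract re_sgn im_comp.
- rewrite linearD !im_comp re_sgn im_sgn !re_contract !im_contract.
  by rewrite op_comp0l op_comp0r addr0 add0r op_compNl addrN.
Qed.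

Section ExtShift.
Variable D : forall n, {linear P n -> P n}.

Fact ext_wedge_linear n : linear (fun x : ext_goperad n => mk 0 (D n (re n x))).
Proof.
by move=> c x y; rewrite mkP scaler0 addr0 -!linearP.
Qed.

(** The operator theta D, for a derivation D of degree 0. With D = d/dt and theta = dt it is the de
    Rham differential. *)
Definition ext_wedge n : {linear ext_goperad n -> ext_goperad n} :=
  lin_of (@ext_wedge_linear n).

Lemma re_wedge n (x : ext_goperad n) : re n (ext_wedge n x) = 0.
Proof. by []. Qed.
Lemma im_wedge n (x : ext_goperad n) : im n (ext_wedge n x) = D n (re n x).
Proof. by []. Qed.

Lemma ext_wedge_derivation :
  (forall n (s : 'S_n) x, D n (sm_act s x) = sm_act s (D n x)) ->
  D 1 (op_id P) = 0 ->
  (forall m n r (e : r.+1 = (m + n)%N) (i : 'I_m) x y,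
    D r (op_comp e i x y) = op_comp e i (D m x) y + op_comp e i x (D n y)) ->
  operad_derivation ext_wedge.
Proof.
move=> Dact Did Dcomp.
apply: derivation_of_leibniz => [n s x||m n r e i x y]; apply: ext_eq.
- by rewrite re_act !re_wedge ?linear0.
- by rewrite im_act !im_wedge re_act Dact.
- by rewrite re_wedge ?linear0.
- by rewrite im_wedge re_id Did ?linear0.
- by rewrite linearD !re_comp !re_wedge op_comp0l op_comp0r addr0.
- rewrite linearD !im_comp re_sgn sgnK !re_wedge !im_wedge re_comp Dcomp.
  by rewrite ?linear0 !op_comp0l ?op_comp0r ?add0r addr0.
Qed.

End ExtShift.

End ExteriorOperad.

Section Twist.
Variables (P : bioperad k) (u v : bool).
Let O := ext_goperad P.
Variable delta : forall n, {linear O n -> O n}.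
Hypothesis delta_u : u -> forall n, has_bidegree 1 0 (delta n).
Hypothesis delta_v : v -> forall n, has_bidegree 0 1 (delta n).
Hypothesis delta_der : operad_derivation delta.
Hypothesis delta2 : forall n x, delta n (delta n x) = 0.
Hypothesis delta_d : forall n x,
  ext_d (@bo_d k P) n (delta n x) = - delta n (ext_d (@bo_d k P) n x).
Hypothesis delta_db : forall n x,
  ext_d (@bo_db k P) n (delta n x) = - delta n (ext_d (@bo_db k P) n x).

(** The booleans tell which differentials of P receive the extra term [delta], so that one
    construction serves both directions. It is used for the de Rham differential on forms and for
    the contraction on the cofree operad. *)
Definition twist_fun (w : bool) (d : forall n, {linear P n -> P n}) n (x : O n) : O n :=
  ext_d d n x + (if w then delta n x else 0).

Fact twist_linear w d n : linear (@twist_fun w d n).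
Proof.
move=> c x y; rewrite /twist_fun; case: w; last by rewrite !addr0 linearP.
by rewrite !linearP /= scalerDr addrACA.
Qed.

Definition twist w d n : {linear O n -> O n} := lin_of (@twist_linear w d n).

Lemma twistE w d n x : twist w d n x = ext_d d n x + (if w then delta n x else 0).
Proof. by []. Qed.

Fact twist_derivation w (d : forall n, {linear P n -> P n}) :
  operad_derivation (ext_d d) -> operad_derivation (twist w d).
Proof.
move=> der; have L := leibniz der; have L' := leibniz delta_der.
apply: derivation_of_leibniz => [n s x||m n r e i x y]; rewrite !twistE.
- by rewrite (od_act der) linearD; case: w; rewrite ?linear0 // (od_act delta_der).
- by rewrite (od_id der) add0r; case: w => //; apply: (od_id delta_der).
- rewrite L; case: w; last by rewrite !addr0.
  by rewrite L' op_compDl op_compDr addrACA.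
Qed.

Fact twist_bicomplex n :
  bicomplex_axioms (twist u (@bo_d k P) n) (twist v (@bo_db k P) n).
Proof.
have [h1 h2 h3 h4 h5] := bo_bicomplex P n.
have deg (w : bool) a' b' (d : forall n, {linear P n -> P n}) :
    has_bidegree a' b' (d n) -> (w -> has_bidegree a' b' (delta n)) ->
    has_bidegree a' b' (twist w d n).
  move=> hd hw p q x hx; rewrite twistE; apply: bg_homD; first exact: ext_d_deg.
  by case: w hw => [hw|_]; [apply: hw|apply: bg_hom0].
split.
- move=> p q x hx; rewrite -[q]addr0.
  apply: (deg u 1 0) => //; last by move=> hu; apply: delta_u.
  by move=> p' q' y hy; rewrite addr0; apply: h1.
- move=> p q x hx; rewrite -[p]addr0.
  apply: (deg v 0 1) => //; last by move=> hv; apply: delta_v.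
  by move=> p' q' y hy; rewrite addr0; apply: h2.
- move=> x; rewrite !twistE linearD.
  have -> : ext_d (@bo_d k P) n (ext_d (@bo_d k P) n x) = 0.
    by apply: ext_eq; rewrite ?re_ext_d ?im_ext_d ?linearN ?h3 ?opprK ?linear0.
  case: u; last by rewrite linear0 !addr0.
  by rewrite delta_d linearD delta2 addr0 add0r addNr.
- move=> x; rewrite !twistE linearD.
  have -> : ext_d (@bo_db k P) n (ext_d (@bo_db k P) n x) = 0.
    by apply: ext_eq; rewrite ?re_ext_d ?im_ext_d ?linearN ?h4 ?opprK ?linear0.
  case: v; last by rewrite linear0 !addr0.
  by rewrite delta_db linearD delta2 addr0 add0r addNr.
- move=> x; rewrite !twistE !(linearD (ext_d _ n)) addrACA.
  rewrite [X in X + _]addrACA.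
  have -> : ext_d (@bo_d k P) n (ext_d (@bo_db k P) n x) +
      ext_d (@bo_db k P) n (ext_d (@bo_d k P) n x) = 0.
    by apply: ext_eq; rewrite linearD ?re_ext_d ?im_ext_d ?linearN ?opprK ?h5 ?linear0.
  rewrite add0r addrACA.
  case: u v => [] []; rewrite ?linear0 ?addr0 ?add0r ?linearD ?delta_d ?delta_db
    ?delta2 ?addr0 ?addNr ?addrN //.
  by rewrite addrA addrK addNr.
Qed.

Definition twist_bioperad : bioperad k.
Proof.
apply: (@BiOperad k O (twist u (@bo_d k P)) (twist v (@bo_db k P))).
- exact: twist_bicomplex.
- apply: twist_derivation; apply: (@ext_d_derivation _ _ 1 0) => //; last exact: bo_d_der.
  by move=> n p q x; rewrite addr0; apply: bc_d_deg (bo_bicomplex P n) _ _ _.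
- apply: twist_derivation; apply: (@ext_d_derivation _ _ 0 1) => //; last exact: bo_db_der.
  by move=> n p q x; rewrite addr0; apply: bc_db_deg (bo_bicomplex P n) _ _ _.
Defined.

Lemma twist_dE n (x : twist_bioperad n) :
  bo_d x = ext_d (@bo_d k P) n x + (if u then delta n x else 0).
Proof. by []. Qed.

Lemma twist_dbE n (x : twist_bioperad n) :
  bo_db x = ext_d (@bo_db k P) n x + (if v then delta n x else 0).
Proof. by []. Qed.

End Twist.

End Exterior.

Opaque re im mk.

(** * Polynomial functions *)

Section Polynomial.
Variable k : fieldType.
Hypothesis char0 : [pchar k] =i pred0.

Lemma natr_inj0 (m n : nat) : m%:R = n%:R :> k -> m = n.
Proof.
have /pcharf0P h := char0.
wlog le : m n / (m <= n)%N.
  by move=> w; case/orP: (leq_total m n) => le e; [|apply/esym]; apply: w.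
move=> e; apply/eqP; rewrite eqn_leq le -subn_eq0 -h natrB // e subrr eqxx //.
Qed.

(* A polynomial function over an infinite field has unique coefficients; this
   is the inversion of the Vandermonde matrix at 0, ..., N-1. *)
Lemma polyfun_coef0 (V : lmodType k) N (c : nat -> V) :
  (forall t : k, \sum_(i < N) t ^+ i *: c i = 0) -> forall i, (i < N)%N -> c i = 0.
Proof.
move=> h i iN; pose a : 'rV[k]_N := \row_j (j : nat)%:R.
pose M := Vandermonde N a.
have Mu : M \in unitmx.
  rewrite unitmxE unitfE det_Vandermonde; apply/prodf_neq0 => j _; apply/prodf_neq0 => l jl.
  rewrite !mxE subr_eq0; apply/eqP => /natr_inj0 e; by rewrite e ltnn in jl.
have -> : c i = \sum_(j < N) invmx M j (Ordinal iN) *: \sum_(l < N) M l j *: c l.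
  transitivity (\sum_(l < N) (M *m invmx M) l (Ordinal iN) *: c l).
    rewrite mulmxV // (bigD1 (Ordinal iN)) //= mxE eqxx scale1r big1 ?addr0 //.
    by move=> l /negPf li; rewrite mxE li scale0r.
  under [RHS]eq_bigr => j _ do rewrite scaler_sumr.
  rewrite [RHS]exchange_big /=; apply: eq_bigr => l _; rewrite mxE scaler_suml.
  by apply: eq_bigr => j _; rewrite scalerA mulrC.
rewrite big1 // => j _; have -> : \sum_(l < N) M l j *: c l = 0; last exact: scaler0.
by rewrite -[RHS](h (j : nat)%:R); apply: eq_bigr => l _; rewrite !mxE.
Qed.

Section PolynomialFunctions.
Variable V : lmodType k.

(** Polynomials are taken as functions on k, so that evaluation at points makes them an operad of
    functions; in characteristic zero k is infinite and coefficients are still determined. *)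
Definition polyfun (f : k -> V) : Prop :=
  exists N (c : nat -> V), forall t, f t = \sum_(i < N) t ^+ i *: c i.

Lemma polyfun_pad N M (c : nat -> V) (t : k) : (N <= M)%N ->
  \sum_(i < M) t ^+ i *: (if (i < N)%N then c i else 0) = \sum_(i < N) t ^+ i *: c i.
Proof.
move=> NM; rewrite (big_ord_widen M (fun i => t ^+ i *: c i) NM).
rewrite [RHS]big_mkcond; apply: eq_bigr => i _.
by case: ifP => // _; rewrite scaler0.
Qed.

Fact polyfun0 : polyfun (fun=> 0).
Proof. by exists 0%N, (fun=> 0) => t; rewrite big_ord0. Qed.

Fact polyfunP a f g : polyfun f -> polyfun g -> polyfun (a *: f + g).
Proof.
move=> [N [c fE]] [M [d gE]].
exists (maxn N M), (fun i => a *: (if (i < N)%N then c i else 0) +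
  (if (i < M)%N then d i else 0)) => t.
under [RHS]eq_bigr => i _ do rewrite scalerDr scalerA mulrC -scalerA.
rewrite big_split -scaler_sumr /= !polyfun_pad ?leq_maxl ?leq_maxr //.
by rewrite -fE -gE.
Qed.

Definition pol_submod : submod (k -> V) := Submod polyfun0 polyfunP.
Definition pol := subspace pol_submod.
HB.instance Definition _ := GRing.Lmodule.on pol.

Fact pev_linear t : linear (fun f : pol => val f t).
Proof. by []. Qed.
Definition pev t : {linear pol -> V} := lin_of (pev_linear t).

Lemma pol_eq (f g : pol) : (forall t, pev t f = pev t g) -> f = g.
Proof. by move=> h; apply: val_inj; apply/funext => t; apply: h. Qed.

Fact pmono_polyfun i (c : V) : polyfun (fun t => t ^+ i *: c).
Proof.
exists i.+1, (fun j => if j == i then c else 0) => t.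
rewrite big_ord_recr /= eqxx big1 ?add0r // => j _.
by rewrite ltn_eqF // scaler0.
Qed.

Fact pmono_linear i : linear (fun c : V => to_subspace (pmono_polyfun i c : submod_set pol_submod _) : pol).
Proof.
by move=> a x y; apply: pol_eq => t; rewrite linearP /= scalerDr !scalerA mulrC.
Qed.

Definition pmono i : {linear V -> pol} := lin_of (pmono_linear i).

Lemma pev_mono t i c : pev t (pmono i c) = t ^+ i *: c.
Proof. by []. Qed.

Lemma valE_pev (f : pol) t : val f t = pev t f.
Proof. by []. Qed.

Opaque pev pmono.

Lemma pol_expand (f : pol) : exists N (c : nat -> V), f = \sum_(i < N) pmono i (c i).
Proof.
have [N [c fE]] := subspaceP f; exists N, c; apply: pol_eq => t.
by rewrite linear_sum -valE_pev fE; apply: eq_bigr => i _; rewrite pev_mono.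
Qed.

Lemma pol_ind (Q : pol -> Prop) : Q 0 -> (forall f g, Q f -> Q g -> Q (f + g)) ->
  (forall i c, Q (pmono i c)) -> forall f, Q f.
Proof.
by move=> Q0 QD Qm f; have [N [c ->]] := pol_expand f; elim/big_ind: _.
Qed.

(** Well defined because the coefficients of a polynomial function are unique. Derivation and
    integration are the two instances. *)
Lemma pol_operator (w : nat -> k) (e : nat -> nat) :
  {T : {linear pol -> pol} | forall i c, T (pmono i c) = w i *: pmono (e i) c}.
Proof.
pose R (f g : pol) := exists N (c : nat -> V), f = \sum_(i < N) pmono i (c i) /\
  g = \sum_(i < N) w i *: pmono (e i) (c i).
have pad (F : nat -> {linear V -> pol}) N M (c : nat -> V) : (N <= M)%N ->
    \sum_(i < M) F i (if (i < N)%N then c i else 0) = \sum_(i < N) F i (c i).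
  move=> NM; rewrite (big_ord_widen M (fun i => F i (c i)) NM).
  rewrite [RHS]big_mkcond; apply: eq_bigr => i _.
  by case: ifP => // _; rewrite linear0.
have padw N M (c : nat -> V) : (N <= M)%N ->
    \sum_(i < M) w i *: pmono (e i) (if (i < N)%N then c i else 0)
      = \sum_(i < N) w i *: pmono (e i) (c i).
  exact: (pad (fun i => w i \*: pmono (e i))).
have Rlin a f g f' g' : R f g -> R f' g' -> R (a *: f + f') (a *: g + g').
  move=> [N [c [-> ->]]] [M [d [-> ->]]].
  exists (maxn N M), (fun i => a *: (if (i < N)%N then c i else 0) +
    (if (i < M)%N then d i else 0)).
  rewrite -(pad pmono N (maxn N M) c) ?leq_maxl // -(pad pmono M (maxn N M) d) ?leq_maxr //.
  rewrite -(padw N (maxn N M) c) ?leq_maxl // -(padw M (maxn N M) d) ?leq_maxr //.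
  rewrite !scaler_sumr -!big_split /=; split; apply: eq_bigr => i _; rewrite [pmono _ (_ + _)]linearP //.
  by rewrite scalerDr !scalerA mulrC.
have R0 g : R 0 g -> g = 0.
  move=> [N [c [f0 ->]]]; apply: big1 => i _.
  rewrite (@polyfun_coef0 _ N c) ?linear0 ?scaler0 // => t.
  have := congr1 (pev t) f0; rewrite linear0 linear_sum => e0; rewrite [RHS]e0.
  by apply: eq_bigr => l _; rewrite pev_mono.
have [T TR] : {T : {linear pol -> pol} | forall f, R f (T f)}.
  apply: linear_of_rel => //.
    move=> f; have [N [c ->]] := pol_expand f.
    by exists (\sum_(i < N) w i *: pmono (e i) (c i)), N, c.
  move=> f g h hg hh; apply/eqP; rewrite -subr_eq0; apply/eqP/R0.
  have := Rlin (-1) _ _ _ _ hh hg.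
  by rewrite !scaleN1r addNr addrC.
exists T => i c; apply/eqP; rewrite -subr_eq0; apply/eqP/R0.
have Rm : R (pmono i c) (w i *: pmono (e i) c).
  exists i.+1, (fun j => if j == i then c else 0).
  split; rewrite big_ord_recr /= eqxx big1 ?add0r // => j _;
    by rewrite ltn_eqF // linear0 ?scaler0.
have := Rlin (-1) _ _ _ _ Rm (TR (pmono i c)).
by rewrite !scaleN1r addNr addrC.
Qed.

(** At i = 0 the exponent [predn 0] is 0, which is harmless since the weight is 0. *)
Definition pderiv : {linear pol -> pol} := projT1 (pol_operator (fun i => i%:R) predn).
Definition pint : {linear pol -> pol} :=
  projT1 (pol_operator (fun i => i.+1%:R^-1) S).

Lemma pderiv_mono i c : pderiv (pmono i c) = i%:R *: pmono i.-1 c.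
Proof. by rewrite /pderiv; case: pol_operator. Qed.

Lemma pint_mono i c : pint (pmono i c) = i.+1%:R^-1 *: pmono i.+1 c.
Proof. by rewrite /pint; case: pol_operator. Qed.

Lemma pintK f : pderiv (pint f) = f.
Proof.
move: f; apply: pol_ind => [|f g hf hg|i c]; rewrite ?linear0 ?linearD ?hf ?hg //.
rewrite pint_mono linearZ /= pderiv_mono scalerA mulVf ?scale1r //.
exact: pchar0_natf_neq0.
Qed.

Lemma pderivK f : pint (pderiv f) = f - pmono 0 (pev 0 f).
Proof.
move: f; apply: pol_ind => [|f g hf hg|[|i] c].
- by rewrite !linear0 ?oppr0 ?addr0.
- by rewrite !linearD hf hg ?opprD addrACA.
- by rewrite pderiv_mono scale0r linear0 pev_mono expr0 scale1r subrr.
rewrite pderiv_mono linearZ /= pint_mono scalerA mulfV ?scale1r ?pchar0_natf_neq0 //.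
by rewrite pev_mono expr0n /= scale0r linear0 subr0.
Qed.

Lemma pev0_int f : pev 0 (pint f) = 0.
Proof.
move: f; apply: pol_ind => [|f g hf hg|i c]; rewrite ?linear0 ?linearD ?hf ?hg ?addr0 //.
by rewrite pint_mono linearZ /= pev_mono expr0n /= scale0r scaler0.
Qed.

End PolynomialFunctions.
Arguments pev {V}.
Arguments pmono {V}.
Arguments pderiv {V}.
Arguments pint {V}.
Opaque pev pmono.

Section PolynomialMap.
Variables (V W : lmodType k) (phi : {linear V -> W}).

Fact pmap_ex (f : pol V) : exists g : pol W, forall t, pev t g = phi (pev t f).
Proof.
move: f; apply: pol_ind => [|f g [f' hf] [g' hg]|i c].
- by exists 0 => t; rewrite !linear0.
- by exists (f' + g') => t; rewrite !linearD hf hg.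
by exists (pmono i (phi c)) => t; rewrite !pev_mono linearZ.
Qed.

Fact pmap_sig : {g : {linear pol V -> pol W} | forall f t, pev t (g f) = phi (pev t f)}.
Proof.
apply: (@linear_of_rel _ _ _ (fun f g => forall t, pev t g = phi (pev t f))).
- exact: pmap_ex.
- by move=> f g h hg hh; apply: pol_eq => t; rewrite hg hh.
- by move=> a f g f' g' h h' t; rewrite !linearP h h'.
Qed.

Definition pmap_pol : {linear pol V -> pol W} := projT1 pmap_sig.

Lemma pev_map t f : pev t (pmap_pol f) = phi (pev t f).
Proof. by rewrite /pmap_pol; case: pmap_sig. Qed.

Lemma pmap_mono i c : pmap_pol (pmono i c) = pmono i (phi c).
Proof. by apply: pol_eq => t; rewrite pev_map !pev_mono linearZ. Qed.

Lemma pderiv_map f : pderiv (pmap_pol f) = pmap_pol (pderiv f).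
Proof.
move: f; apply: pol_ind => [|f g hf hg|i c]; rewrite ?linear0 ?linearD ?hf ?hg //.
by rewrite pmap_mono !pderiv_mono linearZ /= pmap_mono.
Qed.

Lemma pint_map f : pint (pmap_pol f) = pmap_pol (pint f).
Proof.
move: f; apply: pol_ind => [|f g hf hg|i c]; rewrite ?linear0 ?linearD ?hf ?hg //.
by rewrite pmap_mono !pint_mono linearZ /= pmap_mono.
Qed.

End PolynomialMap.

Section PolynomialProduct.
Variables (U V W : lmodType k) (B : U -> V -> W).
Hypothesis Bl : forall y, linear (B^~ y).
Hypothesis Br : forall x, linear (B x).

(** The derivative of the product is computed in the same induction on monomials that constructs it;
    together they give composition in P[t] and the Leibniz rule for d/dt. *)
Lemma pol_product (f : pol U) (g : pol V) : exists h : pol W,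
  (forall t, pev t h = B (pev t f) (pev t g)) /\
  (forall t, pev t (pderiv h) =
     B (pev t (pderiv f)) (pev t g) + B (pev t f) (pev t (pderiv g))).
Proof.
have BDl x x' y : B (x + x') y = B x y + B x' y.
  exact: (linearD (lin_of (Bl y))).
have B0l y : B 0 y = 0 by exact: (linear0 (lin_of (Bl y))).
have BZl a x y : B (a *: x) y = a *: B x y by exact: (linearZ_LR (lin_of (Bl y))).
have BDr x y y' : B x (y + y') = B x y + B x y' by exact: (linearD (lin_of (Br x))).
have B0r x : B x 0 = 0 by exact: (linear0 (lin_of (Br x))).
have BZr a x y : B x (a *: y) = a *: B x y by exact: (linearZ_LR (lin_of (Br x))).
move: f; apply: pol_ind => [|f f' [h [h1 h2]] [h' [h1' h2']]|i c].
- by exists 0; split=> t; rewrite !linear0 !B0l ?addr0.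
- by exists (h + h'); split=> t; rewrite !linearD !BDl ?h1 ?h1' // h2 h2' addrACA.
move: g; apply: pol_ind => [|f f' [h [h1 h2]] [h' [h1' h2']]|j d].
- by exists 0; split=> t; rewrite !linear0 !B0r ?addr0.
- by exists (h + h'); split=> t; rewrite !linearD !BDr ?h1 ?h1' // h2 h2' addrACA.
exists (pmono (i + j) (B c d)); split=> t.
  by rewrite !pev_mono BZl BZr scalerA exprD.
rewrite !pderiv_mono !linearZ /= !pev_mono !BZl !BZr !scalerA -scalerDl; congr (_ *: _).
case: i j => [|i] [|j]; rewrite ?addn0 ?add0n ?mul0r ?mul1r ?mulr1 //= ?mul0r ?addr0 ?add0r ?mulr0 ?mul0r ?addr0 //.
rewrite natrD mulrDl -mulrA -exprD; congr (_ + _).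
by rewrite [t ^+ i.+1 * _]mulrC -mulrA -exprD addSnnS.
Qed.

End PolynomialProduct.
End Polynomial.
Arguments pev {k V}.
Arguments pmono {k V}.
Arguments pderiv {k} char0 {V}.
Arguments pint {k} char0 {V}.

Opaque pev pmono.

(** * The operad P[t] of polynomial functions with values in P *)

Section PolynomialOperad.
Variable k : fieldType.
Hypothesis char0 : [pchar k] =i pred0.
Variable P : bioperad k.

Definition pol_ev n (t : k) : {linear pol (P n) -> P n} := pev t.

Fact pol_family : goperad_family pol_ev.
Proof.
split.
- by move=> n x y h; apply: pol_eq.
- move=> n; apply: pol_ind => [|f g [s [hs ->]] [r [hr ->]]|i c].
  + by exists [::]; split => //; rewrite big_nil.
  + exists (s ++ r); rewrite big_cat; split => // v.
    by rewrite mem_cat => /orP[/hs|/hr].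
  + have [s [hs ->]] := bg_span c; exists [seq pmono i v | v <- s]; split.
      move=> v /mapP[w /hs[p [q hw]] ->]; exists p, q => t.
      by rewrite /pol_ev pev_mono; apply: bg_homZ.
    by rewrite big_map linear_sum.
- by exists (pmono 0 (op_id P)) => t; rewrite /pol_ev pev_mono expr0 scale1r.
- move=> m n r e i x y.
  have [h [hE _]] := @pol_product k char0 _ _ _ (op_comp e i)
    (op_comp_linl e i) (op_comp_linr e i) x y.
  by exists h.
- by move=> n s x; exists (pmap_pol (sm_act s) x) => t; rewrite /pol_ev pev_map.
Qed.

Definition pol_bioperad : bioperad k.
Proof.
apply: (@fam_bioperad k P k (fun n => pol (P n)) pol_ev pol_family).
- by move=> n x; exists (pmap_pol bo_d x) => t; rewrite /pol_ev pev_map.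
- by move=> n x; exists (pmap_pol bo_db x) => t; rewrite /pol_ev pev_map.
Defined.

Let O := pol_bioperad.

Definition pol_deriv n : {linear O n -> O n} := @pderiv k char0 (P n).
Definition pol_int n : {linear O n -> O n} := @pint k char0 (P n).
Definition pol_const n : {linear P n -> O n} := @pmono k (P n) 0.
Definition pol_eval (t : k) : bioperad_hom O P := fam_bo_ev _ _ _ t.

Lemma pol_evalE t n (x : O n) : pol_eval t n x = pev t x.
Proof. by []. Qed.

Lemma pol_eval_eq n (x y : O n) : (forall t, pol_eval t n x = pol_eval t n y) -> x = y.
Proof. by move=> h; apply: pol_eq. Qed.

Lemma pol_homI n p q (x : O n) : (forall t, bg_hom p q (pol_eval t n x)) -> bg_hom p q x.
Proof. by []. Qed.

(** Derivation commutes with linear maps on coefficients. The hypothesis is pointwise because the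
    action and the differentials of P[t] are characterised by their values only. *)
Lemma pol_deriv_map n m (phi : {linear P n -> P m}) (x : O n) (y : O m) :
  (forall t, pol_eval t m y = phi (pol_eval t n x)) ->
  forall t, pol_eval t m (pol_deriv m y) = phi (pol_eval t n (pol_deriv n x)).
Proof.
move=> h t; have -> : y = pmap_pol phi x.
  by apply: pol_eq => u; rewrite pev_map; apply: h.
by rewrite /pol_deriv pderiv_map; apply: pev_map.
Qed.

Lemma pol_int_map n m (phi : {linear P n -> P m}) (x : O n) (y : O m) :
  (forall t, pol_eval t m y = phi (pol_eval t n x)) ->
  forall t, pol_eval t m (pol_int m y) = phi (pol_eval t n (pol_int n x)).
Proof.
move=> h t; have -> : y = pmap_pol phi x.
  by apply: pol_eq => u; rewrite pev_map; apply: h.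
by rewrite /pol_int pint_map; apply: pev_map.
Qed.

Lemma pol_deriv_act n (s : 'S_n) (x : O n) :
  pol_deriv n (sm_act s x) = sm_act s (pol_deriv n x).
Proof.
apply: pol_eval_eq => t; rewrite smh_act; apply: (pol_deriv_map (phi := sm_act s)) => u.
exact: smh_act.
Qed.

Lemma pol_deriv_d n (x : O n) : pol_deriv n (bo_d x) = bo_d (pol_deriv n x).
Proof.
apply: pol_eval_eq => t; rewrite bh_d; apply: (pol_deriv_map (phi := bo_d)) => u.
exact: bh_d.
Qed.

Lemma pol_deriv_db n (x : O n) : pol_deriv n (bo_db x) = bo_db (pol_deriv n x).
Proof.
apply: pol_eval_eq => t; rewrite bh_db; apply: (pol_deriv_map (phi := bo_db)) => u.
exact: bh_db.
Qed.

Lemma pol_int_d n (x : O n) : pol_int n (bo_d x) = bo_d (pol_int n x).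
Proof.
apply: pol_eval_eq => t; rewrite bh_d; apply: (pol_int_map (phi := bo_d)) => u.
exact: bh_d.
Qed.

Lemma pol_int_db n (x : O n) : pol_int n (bo_db x) = bo_db (pol_int n x).
Proof.
apply: pol_eval_eq => t; rewrite bh_db; apply: (pol_int_map (phi := bo_db)) => u.
exact: bh_db.
Qed.

Lemma pol_deriv_const n (x : P n) : pol_deriv n (pol_const n x) = 0.
Proof. by rewrite /pol_deriv /pol_const pderiv_mono scale0r. Qed.

Lemma pol_eval_const t n (x : P n) : pol_eval t n (pol_const n x) = x.
Proof. by rewrite pol_evalE /pol_const pev_mono expr0 scale1r. Qed.

Lemma pol_deriv_id : pol_deriv 1 (op_id O) = 0.
Proof.
have -> : op_id O = pol_const 1 (op_id P).
  by apply: pol_eval_eq => t; rewrite gh_id pol_eval_const.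
exact: pol_deriv_const.
Qed.

Lemma pol_deriv_comp m n r (e : r.+1 = (m + n)%N) (i : 'I_m) (x : O m) (y : O n) :
  pol_deriv r (op_comp e i x y) =
  op_comp e i (pol_deriv m x) y + op_comp e i x (pol_deriv n y).
Proof.
apply: pol_eval_eq => t; rewrite linearD !gh_comp.
have [h [hE hD]] := @pol_product k char0 _ _ _ (op_comp e i)
    (op_comp_linl e i) (op_comp_linr e i) x y.
have -> : op_comp e i x y = h.
  by apply: pol_eval_eq => u; rewrite gh_comp; apply: esym (hE u).
exact: hD.
Qed.

Lemma pol_intK n (x : O n) : pol_deriv n (pol_int n x) = x.
Proof. exact: pintK. Qed.

Lemma pol_derivK n (x : O n) :
  pol_int n (pol_deriv n x) = x - pol_const n (pol_eval 0 n x).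
Proof. exact: pderivK. Qed.

Lemma pol_eval0_int n (x : O n) : pol_eval 0 n (pol_int n x) = 0.
Proof. exact: pev0_int. Qed.

Lemma pol_hom_deriv n p q (x : O n) : bg_hom p q x -> bg_hom p q (pol_deriv n x).
Proof.
move=> hx; apply: pol_homI => t; have /pol_deriv_map h : forall t, pol_eval t n x =
    bg_proj (p, q) (pol_eval t n x) by move=> u; rewrite bg_proj_id //; apply: (hx u).
by rewrite (h t); apply: (bg_proj_hom (p, q)).
Qed.

Lemma pol_hom_const n p q (x : P n) : bg_hom p q x -> bg_hom p q (pol_const n x).
Proof. by move=> hx; apply: pol_homI => t; rewrite pol_eval_const. Qed.

End PolynomialOperad.

(** * The path object *)

(** A differential indexed by its direction, so that the constructions in the directions (1, 0) and
    (0, 1) are treated together. *)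
Definition diff (k : fieldType) (dir : bool) (P : bioperad k) n : {linear P n -> P n} :=
  if dir then @bo_d k P n else @bo_db k P n.
Arguments diff {k} dir {P n}.

Lemma bh_diff (k : fieldType) dir (P Q : bioperad k) (f : bioperad_hom P Q) n (x : P n) :
  f n (diff dir x) = diff dir (f n x).
Proof. by case: dir; rewrite (bh_d, bh_db). Qed.

Lemma diffE (k : fieldType) dir (P : bioperad k) n (x : P n) :
  diff dir x = if dir then bo_d x else bo_db x.
Proof. by case: dir. Qed.

Lemma ext_diffE (k : fieldType) a b (o : koszul k (a + b) = -1) dir (P : bioperad k) n
    (x : ext_goperad o P n) :
  ext_d o (@diff k dir P) n x =
  if dir then ext_d o (@bo_d k P) n x else ext_d o (@bo_db k P) n x.
Proof. by case: dir. Qed.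

Lemma eq_or_negb (c d : bool) : c = d \/ c = ~~ d.
Proof. by case: c d => [] []; [left|right|right|left]. Qed.

(** The shape of the differentials of a twist along [c] and [~~ c]: the one in direction c receives
    the extra term w, and by [if_other] the opposite one does not. *)
Lemma if_main (V : zmodType) (c : bool) (x y w : V) :
  (if c then x + (if c then w else 0) else y + (if ~~ c then w else 0)) =
  (if c then x else y) + w.
Proof. by case: c. Qed.

Lemma if_other (V : zmodType) (c : bool) (x y w : V) :
  (if ~~ c then x + (if c then w else 0) else y + (if ~~ c then w else 0)) =
  (if ~~ c then x else y).
Proof. by case: c; rewrite addr0. Qed.

(* P tensored with the forms k[t] + k[t] dt, where dt has bidegree (1, 0) if
   [dir] and (0, 1) otherwise. *)
Section Forms.
Variable k : fieldType.
Hypothesis char0 : [pchar k] =i pred0.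
Variables (dir : bool) (P : bioperad k).

Let a : int := if dir then 1 else 0.
Let b : int := if dir then 0 else 1.

Fact forms_odd : koszul k (a + b) = -1.
Proof. by rewrite /a /b; case: dir. Qed.

Let O := pol_bioperad char0 P.
Let X := ext_goperad forms_odd O.
Let wedge n : {linear X n -> X n} := ext_wedge forms_odd (pol_deriv char0 P) n.

Fact wedge_deg n : has_bidegree a b (wedge n).
Proof.
move=> p q x; rewrite !ext_homE => -[hx _]; rewrite re_wedge im_wedge !addrK; split.
  exact: bg_hom0.
exact: pol_hom_deriv.
Qed.

Fact wedge_deg_d : dir -> forall n, has_bidegree 1 0 (wedge n).
Proof. by move=> h n; have := wedge_deg (n := n); rewrite /a /b h. Qed.

Fact wedge_deg_db : ~~ dir -> forall n, has_bidegree 0 1 (wedge n).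
Proof. by move=> /negPf h n; have := wedge_deg (n := n); rewrite /a /b h. Qed.

Fact wedge_derivation : operad_derivation wedge.
Proof.
apply: ext_wedge_derivation.
- exact: pol_deriv_act.
- exact: pol_deriv_id.
- exact: pol_deriv_comp.
Qed.

Fact wedge2 n x : wedge n (wedge n x) = 0.
Proof.
by apply: ext_eq; rewrite ?re_wedge ?im_wedge ?re_wedge ?linear0.
Qed.

Fact wedge_d n x : ext_d forms_odd (@bo_d k O) n (wedge n x) =
  - wedge n (ext_d forms_odd (@bo_d k O) n x).
Proof.
apply: ext_eq; rewrite linearN ?re_ext_d ?im_ext_d ?re_wedge ?im_wedge.
  by rewrite linear0 oppr0.
by rewrite re_ext_d pol_deriv_d.
Qed.

Fact wedge_db n x : ext_d forms_odd (@bo_db k O) n (wedge n x) =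
  - wedge n (ext_d forms_odd (@bo_db k O) n x).
Proof.
apply: ext_eq; rewrite linearN ?re_ext_d ?im_ext_d ?re_wedge ?im_wedge.
  by rewrite linear0 oppr0.
by rewrite re_ext_d pol_deriv_db.
Qed.

Definition forms : bioperad k :=
  twist_bioperad wedge_deg_d wedge_deg_db wedge_derivation wedge2 wedge_d wedge_db.

Definition fre n : {linear forms n -> O n} := @re k a b O n.
Definition fim n : {linear forms n -> O n} := @im k a b O n.
Definition fmk n (x y : O n) : forms n := @mk k a b O n x y.

Lemma fre_mk n (x y : O n) : fre n (fmk x y) = x. Proof. exact: re_mk. Qed.
Lemma fim_mk n (x y : O n) : fim n (fmk x y) = y. Proof. exact: im_mk. Qed.

Lemma forms_eq n (x y : forms n) : fre n x = fre n y -> fim n x = fim n y -> x = y.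
Proof. exact: ext_eq. Qed.

Lemma fmkP n c (x y x' y' : O n) :
  c *: fmk x y + fmk x' y' = fmk (c *: x + x') (c *: y + y').
Proof. exact: mkP. Qed.

Lemma forms_homE n p q (x : forms n) :
  bg_hom p q x = (bg_hom p q (fre n x) /\ bg_hom (p - a) (q - b) (fim n x)).
Proof. exact: ext_homE. Qed.

Lemma fre_act n (s : 'S_n) (x : forms n) : fre n (sm_act s x) = sm_act s (fre n x).
Proof. exact: re_act. Qed.
Lemma fim_act n (s : 'S_n) (x : forms n) : fim n (sm_act s x) = sm_act s (fim n x).
Proof. exact: im_act. Qed.
Lemma fre_id : fre 1 (op_id forms) = op_id O. Proof. exact: re_id. Qed.
Lemma fim_id : fim 1 (op_id forms) = 0. Proof. exact: im_id. Qed.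

Lemma fre_comp m n r (e : r.+1 = (m + n)%N) (i : 'I_m) (x : forms m) (y : forms n) :
  fre r (op_comp e i x y) = op_comp e i (fre m x) (fre n y).
Proof. exact: re_comp. Qed.

Lemma fim_comp m n r (e : r.+1 = (m + n)%N) (i : 'I_m) (x : forms m) (y : forms n) :
  fim r (op_comp e i x y) =
  op_comp e i (fim m x) (fre n y) + op_comp e i (sgn (fre m x)) (fim n y).
Proof. exact: im_comp. Qed.

Lemma diff_main n (x : forms n) :
  diff dir x = fmk (diff dir (fre n x)) (pol_deriv char0 P n (fre n x) - diff dir (fim n x)).
Proof.
have E : diff dir x = ext_d forms_odd (@diff k dir O) n x + wedge n x.
  by rewrite diffE ext_diffE (twist_dE x) (twist_dbE x); apply: if_main.
apply: ext_eq.
  rewrite E linearD re_ext_d re_wedge addr0; exact: esym (fre_mk _ _).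
rewrite E linearD im_ext_d im_wedge addrC; exact: esym (fim_mk _ _).
Qed.

Lemma diff_other n (x : forms n) :
  diff (~~ dir) x = fmk (diff (~~ dir) (fre n x)) (- diff (~~ dir) (fim n x)).
Proof.
have E : diff (~~ dir) x = ext_d forms_odd (@diff k (~~ dir) O) n x.
  by rewrite diffE ext_diffE (twist_dE x) (twist_dbE x); apply: if_other.
apply: ext_eq.
  by rewrite E re_ext_d.
by rewrite E im_ext_d.
Qed.

Lemma fre_diff c n (x : forms n) : fre n (diff c x) = diff c (fre n x).
Proof.
by have [->|->] := eq_or_negb c dir;
  rewrite (diff_main, diff_other) fre_mk.
Qed.

Definition forms_re : bioperad_hom forms O.
Proof.
apply: (@BiOperadHom _ forms O (ext_re_hom forms_odd O)).
- by move=> n x; apply: (fre_diff true).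
- by move=> n x; apply: (fre_diff false).
Defined.

Definition forms_eval (t : k) : bioperad_hom forms P :=
  bioperad_hom_comp (pol_eval char0 P t) forms_re.

Lemma forms_evalE t n (x : forms n) : forms_eval t n x = pol_eval char0 P t n (fre n x).
Proof. by []. Qed.

Fact forms_const_linear n : linear (fun x : P n => fmk (pol_const char0 P n x) 0).
Proof. by move=> c x y; rewrite fmkP linearP scaler0 addr0. Qed.

Definition forms_const_lin n : {linear P n -> forms n} := lin_of (@forms_const_linear n).

Fact fre_const n x : fre n (forms_const_lin n x) = pol_const char0 P n x.
Proof. exact: fre_mk. Qed.
Fact fim_const n x : fim n (forms_const_lin n x) = 0.
Proof. exact: fim_mk. Qed.

Definition forms_const_smod : smod_hom P forms.
Proof.
apply: (@SModHom _ P forms forms_const_lin).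
- move=> n p q x hx; rewrite forms_homE fre_const fim_const; split; last exact: bg_hom0.
  exact: pol_hom_const.
- move=> n s x; apply: forms_eq.
    rewrite fre_act !fre_const; apply: (@pol_eval_eq _ char0 P) => t.
    by rewrite smh_act !pol_eval_const.
  by rewrite fim_act !fim_const linear0.
Defined.

Definition forms_const_op : goperad_hom P forms.
Proof.
apply: (@GOperadHom _ P forms forms_const_smod).
- apply: forms_eq; last by rewrite fim_const fim_id.
  rewrite fre_const fre_id; apply: (@pol_eval_eq _ char0 P) => t.
  by rewrite gh_id !pol_eval_const.
- move=> m n r e i x y; apply: forms_eq.
    rewrite fre_comp !fre_const; apply: (@pol_eval_eq _ char0 P) => t.
    by rewrite gh_comp !pol_eval_const.
  by rewrite fim_comp !fim_const op_comp0l op_comp0r addr0.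
Defined.

Fact forms_const_diff c n x : forms_const_lin n (diff c x) = diff c (forms_const_lin n x).
Proof.
apply: forms_eq.
  rewrite fre_diff !fre_const; apply: (@pol_eval_eq _ char0 P) => t.
  by rewrite bh_diff !pol_eval_const.
rewrite fim_const.
by have [->|->] := eq_or_negb c dir;
  rewrite (diff_main, diff_other) fim_mk !(fre_const, fim_const) ?pol_deriv_const linear0 ?subr0 ?oppr0.
Qed.

Definition forms_const : bioperad_hom P forms.
Proof.
apply: (@BiOperadHom _ P forms forms_const_op).
- exact: (forms_const_diff true).
- exact: (forms_const_diff false).
Defined.

Lemma forms_constE n x : forms_const n x = fmk (pol_const char0 P n x) 0.
Proof. by []. Qed.

Lemma forms_eval_const t n (x : P n) : forms_eval t n (forms_const n x) = x.
Proof. by rewrite forms_evalE forms_constE fre_mk pol_eval_const. Qed.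

(* Integration from 0, a contraction onto the constants. *)
Fact forms_int_linear n : linear (fun x : forms n => fmk (pol_int char0 P n (fim n x)) 0).
Proof. by move=> c x y; rewrite fmkP !linearP scaler0 addr0. Qed.

Definition forms_int n : {linear forms n -> forms n} := lin_of (@forms_int_linear n).

Lemma forms_intE n x : forms_int n x = fmk (pol_int char0 P n (fim n x)) 0.
Proof. by []. Qed.

Lemma forms_int_main n (x : forms n) :
  diff dir (forms_int n x) + forms_int n (diff dir x) = x - forms_const n (forms_eval 0 n x).
Proof.
rewrite forms_constE !diff_main !forms_intE forms_evalE.
rewrite !fre_mk !fim_mk [diff dir 0]linear0 subr0 pol_intK [pol_int _ _ _ (_ - _)]linearB.
rewrite /= pol_derivK.
have -> c : pol_int char0 P n (diff c (fim n x)) = diff c (pol_int char0 P n (fim n x)).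
  by rewrite !diffE; case: c; rewrite (pol_int_d, pol_int_db).
rewrite -[X in X + _]scale1r fmkP !scale1r addr0 addrCA addrN addr0.
apply: forms_eq.
  by rewrite fre_mk [RHS]linearB fre_mk.
by rewrite fim_mk [RHS]linearB /= fim_mk subr0.
Qed.

(** The homotopy for one differential anticommutes with the other one; this lets the two
    integrations be composed. *)
Lemma forms_int_other n (x : forms n) :
  diff (~~ dir) (forms_int n x) + forms_int n (diff (~~ dir) x) = 0.
Proof.
rewrite !diff_other !forms_intE !fre_mk !fim_mk [diff _ 0]linear0 [pol_int _ _ _ (- _)]linearN.
have -> c : pol_int char0 P n (diff c (fim n x)) = diff c (pol_int char0 P n (fim n x)).
  by rewrite !diffE; case: c; rewrite (pol_int_d, pol_int_db).
by rewrite -[X in X + _]scale1r fmkP !scale1r addrN oppr0 addr0.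
Qed.

Lemma forms_eval0_int n x : forms_eval 0 n (forms_int n x) = 0.
Proof. by rewrite forms_evalE forms_intE fre_mk; apply: pol_eval0_int. Qed.


End Forms.

Opaque pol_eval pol_const pol_deriv pol_int.
Opaque forms fre fim fmk forms_int forms_const forms_eval.

(** * The suboperad of P (x) k[s, ds] (x) k[t, dt] and its two contractions *)

Section PathObject.
Variable k : fieldType.
Hypothesis char0 : [pchar k] =i pred0.
Variable P : bioperad k.

Let L1 := forms char0 true P.
Let L2 := forms char0 false L1.
Let ev0 : bioperad_hom L1 P := forms_eval char0 true P 0.
Let cst : bioperad_hom P L1 := forms_const char0 true P.
Let f0 n : {linear L2 n -> pol_bioperad char0 L1 n} := fre char0 false L1 n.
Let f1 n : {linear L2 n -> pol_bioperad char0 L1 n} := fim char0 false L1 n.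
Let ev s : bioperad_hom (pol_bioperad char0 L1) L1 := pol_eval char0 L1 s.

(* k + I (x) I', where I and I' are the augmentation ideals at 0 of the forms
   in the directions (1, 0) and (0, 1): the part I (x) I' is a sum of squares. *)
Definition path_fiber n (c : P n) (w : L2 n) : Prop :=
  [/\ ev 0 n (f0 n w) = cst n c,
      forall s, ev0 n (ev s n (f0 n w)) = c &
      forall s, ev0 n (ev s n (f1 n w)) = 0].

Lemma path_fiberP n a (c c' : P n) w w' : path_fiber c w -> path_fiber c' w' ->
  path_fiber (a *: c + c') (a *: w + w').
Proof.
move=> [h1 h2 h3] [h1' h2' h3']; split=> [|s|s]; rewrite !linearP.
- by rewrite h1 h1'.
- by rewrite h2 h2'.
- by rewrite h3 h3' scaler0 addr0.
Qed.

Lemma path_fiber0 n : path_fiber (0 : P n) (0 : L2 n).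
Proof. by split=> [|s|s]; rewrite !linear0. Qed.

Definition path_submod n : submod (L2 n).
Proof.
apply: (@Submod _ _ (fun w => exists c, path_fiber c w)).
- by exists 0; apply: path_fiber0.
- by move=> a w w' [c h] [c' h']; exists (a *: c + c'); apply: path_fiberP.
Defined.

Fact f0_id : f0 1 (op_id L2) = op_id _. Proof. exact: fre_id. Qed.
Fact f1_id : f1 1 (op_id L2) = 0. Proof. exact: fim_id. Qed.
Fact f0_comp m n r (e : r.+1 = (m + n)%N) (i : 'I_m) (x : L2 m) (y : L2 n) :
  f0 r (op_comp e i x y) = op_comp e i (f0 m x) (f0 n y).
Proof. exact: fre_comp. Qed.
Fact f1_comp m n r (e : r.+1 = (m + n)%N) (i : 'I_m) (x : L2 m) (y : L2 n) :
  f1 r (op_comp e i x y) =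
  op_comp e i (f1 m x) (f0 n y) + op_comp e i (sgn (f0 m x)) (f1 n y).
Proof. exact: fim_comp. Qed.
Fact f0_act n (s : 'S_n) (x : L2 n) : f0 n (sm_act s x) = sm_act s (f0 n x).
Proof. exact: fre_act. Qed.
Fact f1_act n (s : 'S_n) (x : L2 n) : f1 n (sm_act s x) = sm_act s (f1 n x).
Proof. exact: fim_act. Qed.

Fact ev0_cst n x : ev0 n (cst n x) = x.
Proof. exact: forms_eval_const. Qed.

Fact ev0_deriv n (c : P n) f : (forall s, ev0 n (ev s n f) = c) ->
  forall s, ev0 n (ev s n (pol_deriv char0 L1 n f)) = 0.
Proof.
(* [pol_deriv_map] concerns maps of the coefficient operad [L1] to itself, so [ev0] is followed by
   [cst], which it splits. *)
move=> h s; have E : ev s n (pol_deriv char0 L1 n (pol_const char0 L1 n (cst n c))) =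
    cst n (ev0 n (ev s n (pol_deriv char0 L1 n f))).
  apply: (@pol_deriv_map k char0 L1 n n (cst n \o ev0 n)) => t.
  by rewrite pol_eval_const; congr (cst n _); apply: esym (h t).
move: E; rewrite pol_deriv_const linear0 => /(congr1 (ev0 n)).
by rewrite linear0 ev0_cst => <-.
Qed.

Fact ev0_int n f : (forall s, ev0 n (ev s n f) = 0) ->
  forall s, ev0 n (ev s n (pol_int char0 L1 n f)) = 0.
Proof.
move=> h s; have E : ev s n (pol_int char0 L1 n 0) =
    cst n (ev0 n (ev s n (pol_int char0 L1 n f))).
  apply: (@pol_int_map k char0 L1 n n (cst n \o ev0 n)) => t.
  by rewrite linear0 -[RHS]/(cst n (ev0 n (ev t n f))) h linear0.
move: E; rewrite !linear0 => /(congr1 (ev0 n)).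
by rewrite linear0 ev0_cst => <-.
Qed.

Lemma path_fiber_diff d n (c : P n) w : path_fiber c w -> path_fiber (diff d c) (diff d w).
Proof.
move=> [h1 h2 h3]; split=> [|s|s].
- by rewrite /f0 fre_diff !bh_diff; congr (diff d _).
- by rewrite /f0 fre_diff !bh_diff; congr (diff d _).
case: d.
  rewrite (@diff_other k char0 false L1 n w) /f1 fim_mk [ev _ _ _]linearN [ev0 _ _]linearN.
  by rewrite !bh_diff; have -> := h3 s; rewrite linear0 oppr0.
rewrite (@diff_main k char0 false L1 n w) /f1 fim_mk [ev _ _ _]linearB [ev0 _ _]linearB.
by rewrite !bh_diff; have -> := h3 s; rewrite linear0 subr0 (ev0_deriv h2).
Qed.

Lemma path_proj n e (w : L2 n) c : path_fiber c w -> path_fiber (bg_proj e c) (bg_proj e w).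
Proof.
have E0 : f0 n (bg_proj e w) = bg_proj e (f0 n w).
  by rewrite bg_proj_deg0 // => p q x; rewrite forms_homE => -[].
have [d E1] : exists d, f1 n (bg_proj e w) = bg_proj d (f1 n w).
  case: e {E0} => p q; exists (p + - 0, q + - 1).
  rewrite (@bg_proj_deg _ _ _ _ _ (f1 n)) // => p' q' x.
  by rewrite forms_homE => -[].
move=> [h1 h2 h3]; split=> [|s|s].
- by rewrite E0 !smh_proj h1.
- by rewrite E0 !smh_proj h2.
- by rewrite E1 !smh_proj h3 linear0.
Qed.

Definition path_suboperad : suboperad L2.
Proof.
apply: (@Suboperad k L2 path_submod).
- by move=> n e w [c h]; exists (bg_proj e c); apply: path_proj.
- exists (op_id P); split=> [|s|s].
  + by rewrite f0_id !gh_id.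
  + by rewrite f0_id !gh_id.
  + by rewrite f1_id !linear0.
- move=> m n r e i x y [c [h1 h2 h3]] [c' [h1' h2' h3']].
  exists (op_comp e i c c'); split=> [|s|s].
  + by rewrite f0_comp !gh_comp h1 h1'.
  + by rewrite f0_comp !gh_comp h2 h2'.
  + rewrite f1_comp (linearD (ev s r)) (linearD (ev0 r)) !gh_comp h3 h3'.
    by rewrite op_comp0l op_comp0r addr0.
- move=> n s x [c [h1 h2 h3]]; exists (sm_act s c).
  split=> [|t|t].
  + by rewrite f0_act !smh_act h1.
  + by rewrite f0_act !smh_act h2.
  + by rewrite f1_act !smh_act h3 linear0.
Defined.

Fact path_sub_diff d n (w : L2 n) : submod_set (path_suboperad n) w ->
  submod_set (path_suboperad n) (diff d w).
Proof. by move=> [c h]; exists (diff d c); apply: path_fiber_diff. Qed.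

Definition path_op : bioperad k :=
  so_bioperad (fun n => @path_sub_diff true n) (fun n => @path_sub_diff false n).

Let inc : bioperad_hom path_op L2 := so_bo_inc _ _.

(** Evaluation at the diagonal point (t, t). At t = 0 it gives the constant part c of an element; t
    = 1 is the other end point. *)
Definition path_eval (t : k) : bioperad_hom path_op P :=
  bioperad_hom_comp (bioperad_hom_comp (forms_eval char0 true P t)
    (forms_eval char0 false L1 t)) inc.

Lemma path_evalE t n w :
  path_eval t n w = forms_eval char0 true P t n (ev t n (f0 n (inc n w))).
Proof. by []. Qed.

Fact path_const_sub n (x : P n) : submod_set (path_suboperad n)
  (bioperad_hom_comp (forms_const char0 false L1) cst n x).
Proof.
have E0 : f0 n (forms_const char0 false L1 n (cst n x)) = pol_const char0 L1 n (cst n x).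
  by rewrite forms_constE; apply: fre_mk.
have E1 : f1 n (forms_const char0 false L1 n (cst n x)) = 0.
  by rewrite forms_constE; apply: fim_mk.
exists x; split=> [|s|s]; rewrite -[bioperad_hom_comp _ _ _ _]/(forms_const char0 false L1 n (cst n x)).
- by rewrite E0 pol_eval_const.
- by rewrite E0 pol_eval_const ev0_cst.
- by rewrite E1 !linear0.
Qed.

Definition path_const : bioperad_hom P path_op := so_bo_corestrict _ _ path_const_sub.

Lemma path_eval_const t n x : path_eval t n (path_const n x) = x.
Proof.
rewrite path_evalE.
have -> : inc n (path_const n x) = forms_const char0 false L1 n (cst n x) by [].
by rewrite forms_constE /f0 fre_mk pol_eval_const forms_eval_const.
Qed.

Lemma path_fiberE n (w : path_op n) : path_fiber (path_eval 0 n w) (inc n w).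
Proof.
have [c hc] := @so_incP _ _ path_suboperad n w.
suff -> : path_eval 0 n w = c by [].
by have [_ h _] := hc; rewrite path_evalE; apply: (h 0).
Qed.

Lemma path_lift n (w : L2 n) : path_fiber 0 w -> exists w' : path_op n,
  inc n w' = w /\ path_eval 0 n w' = 0.
Proof.
move=> h; have Sw : submod_set (path_suboperad n) w by exists 0.
exists (to_subspace Sw : subspace (path_suboperad n)); split => //.
by have [_ h' _] := h; rewrite path_evalE; apply: (h' 0).
Qed.

Lemma inc_inj n : injective (inc n).
Proof. exact: (@so_inc_inj _ _ path_suboperad). Qed.

Lemma path_eval1_surj n p q (x : P n) : bg_hom p q x ->
  exists w : path_op n, [/\ bg_hom p q w, path_eval 0 n w = 0 & path_eval 1 n w = x].
Proof.
(* The lift is s t x: the function s t vanishes on both axes, so it is in I (x) I', and it is 1 at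
   (1, 1). *)
move=> hx; pose z : L1 n := @fmk k char0 true P n (pmono 1 x : pol_bioperad char0 P n) 0.
pose w : L2 n := @fmk k char0 false L1 n (pmono 1 z : pol_bioperad char0 L1 n) 0.
have zE t : forms_eval char0 true P t n z = t *: x.
  by rewrite forms_evalE fre_mk pol_evalE pev_mono expr1.
have wE t : ev t n (f0 n w) = t *: z.
  by rewrite /f0 fre_mk [ev _ _ _]pol_evalE pev_mono expr1.
have [|w' [w'E w'0]] := @path_lift n w.
  split=> [|s|s].
  - by rewrite wE scale0r linear0.
  - by rewrite wE linearZ /= [ev0 _ _]zE scale0r scaler0.
  - by rewrite /f1 fim_mk !linear0.
exists w'; split=> //; last by rewrite path_evalE w'E wE linearZ /= zE !scale1r.
apply: (@so_inc_hom _ _ path_suboperad); rewrite -[so_inc _ _ _]/(inc n w') w'E.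
rewrite forms_homE fre_mk fim_mk; split; last exact: bg_hom0.
apply: pol_homI => t; rewrite pol_evalE pev_mono; apply: bg_homZ.
rewrite forms_homE fre_mk fim_mk; split; last exact: bg_hom0.
by apply: pol_homI => u; rewrite pol_evalE pev_mono; apply: bg_homZ.
Qed.

Let hout n : {linear L2 n -> L2 n} := forms_int char0 false L1 n.

Fact f0_hout n w : f0 n (hout n w) = pol_int char0 L1 n (f1 n w).
Proof. by rewrite /hout forms_intE; apply: fre_mk. Qed.
Fact f1_hout n w : f1 n (hout n w) = 0.
Proof. by rewrite /hout forms_intE; apply: fim_mk. Qed.

Lemma hout_fiber n w : path_fiber (0 : P n) w -> path_fiber 0 (hout n w).
Proof.
move=> [h1 h2 h3]; split=> [|s|s].
- by rewrite f0_hout linear0; apply: pol_eval0_int.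
- by rewrite f0_hout; apply: ev0_int.
- by rewrite f1_hout !linear0.
Qed.

Lemma hout_main n w : path_fiber (0 : P n) w ->
  diff false (hout n w) + hout n (diff false w) = w.
Proof.
move=> [h1 _ _]; have := @forms_int_main k char0 false L1 n w.
have -> : forms_eval char0 false L1 0 n w = 0 by rewrite forms_evalE [LHS]h1 linear0.
by rewrite [X in w - X]linear0 subr0.
Qed.

Let hin n : {linear L1 n -> L1 n} := forms_int char0 true P n.
Let hin_map n : {linear pol_bioperad char0 L1 n -> pol_bioperad char0 L1 n} :=
  pmap_pol (hin n).

Fact hinn_linear n : linear (fun w : L2 n =>
  @fmk k char0 false L1 n (hin_map n (f0 n w)) (- hin_map n (f1 n w)) : L2 n).
Proof. by move=> a x y; rewrite fmkP scalerN -opprD -!linearP. Qed.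

(** Integration in the inner variable, applied to the coefficients of 1 and dt; being of odd degree,
    it passes dt with a sign. *)
Let hinn n : {linear L2 n -> L2 n} := lin_of (@hinn_linear n).

Fact f0_hinn n w : f0 n (hinn n w) = hin_map n (f0 n w).
Proof. exact: fre_mk. Qed.
Fact f1_hinn n w : f1 n (hinn n w) = - hin_map n (f1 n w).
Proof. exact: fim_mk. Qed.

Fact ev_hin_map s n f : ev s n (hin_map n f) = hin n (ev s n f).
Proof. exact: pev_map. Qed.

Fact ev_diff d s n x : ev s n (diff d x) = diff d (ev s n x).
Proof. exact: bh_diff. Qed.
Fact f0_diff d n w : f0 n (diff d w) = diff d (f0 n w).
Proof. exact: fre_diff. Qed.
Fact f1_diff_true n w : f1 n (diff true w) = - diff true (f1 n w).
Proof. by rewrite (@diff_other k char0 false L1 n w); apply: fim_mk. Qed.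
Fact f1_diff_false n w :
  f1 n (diff false w) = pol_deriv char0 L1 n (f0 n w) - diff false (f1 n w).
Proof. by rewrite (@diff_main k char0 false L1 n w); apply: fim_mk. Qed.

Fact ev0_hin n x : ev0 n (hin n x) = 0.
Proof. exact: forms_eval0_int. Qed.

Lemma hinn_fiber n w : path_fiber (0 : P n) w -> path_fiber 0 (hinn n w).
Proof.
move=> [h1 h2 h3]; split=> [|s|s].
- by rewrite f0_hinn ev_hin_map h1 !linear0.
- by rewrite f0_hinn ev_hin_map ev0_hin.
- by rewrite f1_hinn (linearN (ev s n)) (linearN (ev0 n)) ev_hin_map ev0_hin oppr0.
Qed.

Lemma L2_eq n (w w' : L2 n) : (forall s, ev s n (f0 n w) = ev s n (f0 n w')) ->
  (forall s, ev s n (f1 n w) = ev s n (f1 n w')) -> w = w'.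
Proof.
by move=> h0 h1; apply: forms_eq; apply: (@pol_eval_eq _ char0 L1) => s.
Qed.

Lemma hinn_main n w : path_fiber (0 : P n) w ->
  diff true (hinn n w) + hinn n (diff true w) = w.
Proof.
move=> [_ h2 h3].
have M f : (forall s, ev0 n (ev s n f) = 0) -> forall s,
    diff true (hin n (ev s n f)) + hin n (diff true (ev s n f)) = ev s n f.
  move=> h s; have := @forms_int_main k char0 true P n (ev s n f).
  have -> : forms_eval char0 true P 0 n (ev s n f) = 0 by apply: h.
  by rewrite [X in _ - X]linear0 subr0.
apply: L2_eq => s.
  rewrite (linearD (f0 n)) f0_diff !f0_hinn f0_diff (linearD (ev s n)) ev_diff.
  by rewrite !ev_hin_map ev_diff M.
rewrite (linearD (f1 n)) f1_diff_true !f1_hinn f1_diff_true (linearN (diff true)).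
rewrite (linearN (hin_map n)) !opprK (linearD (ev s n)) ev_diff.
by rewrite !ev_hin_map ev_diff M.
Qed.

Lemma hinn_other n w : diff false (hinn n w) + hinn n (diff false w) = 0.
Proof.
have M x : diff false (hin n x) + hin n (diff false x) = 0.
  exact: (@forms_int_other k char0 true P n x).
apply: L2_eq => s.
  rewrite (linearD (f0 n)) f0_diff !f0_hinn f0_diff (linearD (ev s n)) ev_diff.
  by rewrite !ev_hin_map ev_diff M !linear0.
rewrite (linearD (f1 n)) f1_diff_false !f1_hinn f1_diff_false f0_hinn.
rewrite (linearN (diff false)) opprK !(linearD (ev s n)) (linearN (ev s n)).
rewrite ev_hin_map (linearB (ev s n)) (linearB (hin n)) !ev_diff ev_hin_map.
have -> : ev s n (pol_deriv char0 L1 n (hin_map n (f0 n w))) =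
    hin n (ev s n (pol_deriv char0 L1 n (f0 n w))).
  by apply: pol_deriv_map => t; apply: ev_hin_map.
by rewrite opprB addrC addrA subrK addrC M !linear0.
Qed.

(** Write h = [hinn] and h' = [hout]. As w is del-closed, w = del h w; h anticommutes with delbar,
    so h w is delbar-closed and equals delbar h' h w. *)
Lemma fiber_BC_acyclic n w : path_fiber (0 : P n) w -> diff true w = 0 ->
  diff false w = 0 -> exists2 z, path_fiber (0 : P n) z & w = diff true (diff false z).
Proof.
move=> wK w1 w2; exists (hout n (hinn n w)); first exact: hout_fiber (hinn_fiber wK).
have e1 : diff true (hinn n w) = w by rewrite -{2}(hinn_main wK) w1 linear0 addr0.
have e2 : diff false (hinn n w) = 0.
  by have := hinn_other w; rewrite w2 linear0 addr0.
by have := hout_main (hinn_fiber wK); rewrite e2 linear0 addr0 => ->.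
Qed.

(** With h and h' the inner and outer integrations, w = del h w + h del w, and h del w is
    delbar-closed, hence equal to delbar h' h del w. *)
Lemma fiber_A_acyclic n w : path_fiber (0 : P n) w -> diff true (diff false w) = 0 ->
  exists z z', [/\ path_fiber (0 : P n) z, path_fiber (0 : P n) z' &
    w = diff true z + diff false z'].
Proof.
move=> wK w1; have wK1 : path_fiber (0 : P n) (diff true w).
  by rewrite -(linear0 (diff true : {linear P n -> P n})); apply: path_fiber_diff.
have zK := hinn_fiber wK1.
exists (hinn n w), (hout n (hinn n (diff true w))); split.
- exact: hinn_fiber.
- exact: hout_fiber.
have e2 : diff false (hinn n (diff true w)) = 0.
  have := hinn_other (diff true w); have -> : diff false (diff true w) = 0.
    have [_ _ _ _ h] := bo_bicomplex L2 n.
    by have := h w; rewrite [bo_d _]w1 add0r.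
  by rewrite linear0 addr0.
by have := hout_main zK; rewrite e2 linear0 addr0 => ->; rewrite hinn_main.
Qed.

End PathObject.

Lemma path_object (k : fieldType) (P : bioperad k) : [pchar k] =i pred0 ->
  exists (PI : bioperad k) (e0 e1 : bioperad_hom PI P) (c : bioperad_hom P PI),
  [/\ (forall n x, e0 n (c n x) = x) /\ (forall n x, e1 n (c n x) = x),
     forall n w, e0 n w = 0 -> bo_d w = 0 -> bo_db w = 0 ->
       exists2 z, e0 n z = 0 & w = bo_d (bo_db z),
     forall n w, e0 n w = 0 -> bo_d (bo_db w) = 0 ->
       exists z z', [/\ e0 n z = 0, e0 n z' = 0 & w = bo_d z + bo_db z'] &
     forall n p q x, bg_hom p q x ->
       exists w, [/\ bg_hom p q w, e0 n w = 0 & e1 n w = x]].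
Proof.
move=> ch; exists (path_op ch P), (path_eval ch P 0), (path_eval ch P 1), (path_const ch P).
pose inc := so_bo_inc (fun n => @path_sub_diff k ch P true n) (fun n => @path_sub_diff k ch P false n).
split.
- by split=> n x; apply: path_eval_const.
- move=> n w w0 w1 w2; have wK := path_fiberE w; rewrite w0 in wK.
  have [||z /path_lift[z' [z'E z'0]] wE] := fiber_BC_acyclic wK.
  + by have := congr1 (inc n) w1; rewrite bh_d linear0.
  + by have := congr1 (inc n) w2; rewrite bh_db linear0.
  exists z' => //; apply: inc_inj.
  by rewrite wE -z'E -[RHS]/(inc n _) bh_d bh_db.
- move=> n w w0 w1; have wK := path_fiberE w; rewrite w0 in wK.
  have [|z [z' [/path_lift[y [yE y0]] /path_lift[y' [y'E y'0]] wE]]] := fiber_A_acyclic wK.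
  + by have := congr1 (inc n) w1; rewrite bh_d bh_db linear0.
  exists y, y'; split=> //; apply: inc_inj.
  by rewrite wE -yE -y'E -[RHS]/(inc n _) linearD bh_d bh_db.
- by move=> n p q x; apply: path_eval1_surj.
Qed.

(** * Maps of operads out of a colimit *)

Section Cofree.
Variables (k : fieldType) (dir : bool) (P : bioperad k).
Hypothesis diff0 : forall n (x : P n), diff dir x = 0.

Let a : int := if dir then -1 else 0.
Let b : int := if dir then 0 else -1.

Fact cofree_odd : koszul k (a + b) = -1.
Proof. by rewrite /a /b; case: dir; rewrite ?addr0 ?add0r koszulN. Qed.

Let X := ext_goperad cofree_odd P.
Let contract n : {linear X n -> X n} := ext_contract cofree_odd P n.

Fact contract_deg n : has_bidegree (- a) (- b) (contract n).
Proof.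
move=> p q x; rewrite !ext_homE => -[_ hx]; rewrite re_contract im_contract; split=> //.
exact: bg_hom0.
Qed.

Fact contract_deg_d : dir -> forall n, has_bidegree 1 0 (contract n).
Proof. by move=> h n; have := contract_deg (n := n); rewrite /a /b h. Qed.

Fact contract_deg_db : ~~ dir -> forall n, has_bidegree 0 1 (contract n).
Proof. by move=> /negPf h n; have := contract_deg (n := n); rewrite /a /b h. Qed.

Fact contract2 n x : contract n (contract n x) = 0.
Proof.
by apply: ext_eq; rewrite ?re_contract ?im_contract ?im_contract ?linear0.
Qed.

Fact contract_diff d n x : ext_d cofree_odd (@diff k d P) n (contract n x) =
  - contract n (ext_d cofree_odd (@diff k d P) n x).
Proof.
apply: ext_eq; rewrite linearN ?re_ext_d ?im_ext_d ?re_contract ?im_contract.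
  by rewrite im_ext_d opprK.
by rewrite linear0.
Qed.

(** P (x) k[theta] with theta of bidegree (-1, 0) or (0, -1), d/dtheta being added to the
    differential in direction [dir]. If that differential is zero on P, a map phi from Q to P
    ignoring it corresponds to a map compatible with it, namely x -> phi x + theta phi (d x). *)
Definition cofree : bioperad k :=
  twist_bioperad contract_deg_d contract_deg_db (ext_contract_derivation _ _)
    contract2 (contract_diff true) (contract_diff false).

Let cre n : {linear cofree n -> P n} := @re k a b P n.
Let cim n : {linear cofree n -> P n} := @im k a b P n.

Definition cofree_re : goperad_hom cofree P := ext_re_hom cofree_odd P.

Lemma cofree_main n (x : cofree n) : diff dir x = contract n x.
Proof.
rewrite diffE; have -> : (if dir then bo_d x else bo_db x) =
    ext_d cofree_odd (@diff k dir P) n x + contract n x.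
  by rewrite ext_diffE (twist_dE x) (twist_dbE x); apply: if_main.
have -> : ext_d cofree_odd (@diff k dir P) n x = 0; last by rewrite add0r.
by apply: ext_eq; rewrite ?re_ext_d ?im_ext_d !diff0 ?linear0 ?oppr0.
Qed.

Lemma cofree_other n (x : cofree n) :
  diff (~~ dir) x = ext_d cofree_odd (@diff k (~~ dir) P) n x.
Proof. by rewrite diffE ext_diffE (twist_dE x) (twist_dbE x); apply: if_other. Qed.

Lemma cofree_re_other n (x : cofree n) :
  cofree_re n (diff (~~ dir) x) = diff (~~ dir) (cofree_re n x).
Proof. by rewrite cofree_other; apply: re_ext_d. Qed.

Lemma cofree_eq n (x y : cofree n) : cofree_re n x = cofree_re n y ->
  cofree_re n (diff dir x) = cofree_re n (diff dir y) -> x = y.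
Proof. by rewrite !cofree_main => h1 h2; apply: ext_eq. Qed.

Lemma cofree_other0 : (forall n (x : P n), diff (~~ dir) x = 0) ->
  forall n (x : cofree n), diff (~~ dir) x = 0.
Proof.
move=> h n x; rewrite cofree_other.
by apply: ext_eq; rewrite ?re_ext_d ?im_ext_d !h ?linear0 ?oppr0.
Qed.

Section CofreeLift.
Variables (Q : bioperad k) (phi : goperad_hom Q P).

Fact cofree_lift_linear n : linear (fun x : Q n => mk a b (phi n x) (phi n (diff dir x)) : cofree n).
Proof. by move=> c x y; rewrite mkP -!linearP. Qed.

Definition cofree_lift_lin n : {linear Q n -> cofree n} := lin_of (@cofree_lift_linear n).

Fact re_lift n x : cre n (cofree_lift_lin n x) = phi n x. Proof. exact: re_mk. Qed.
Fact im_lift n x : cim n (cofree_lift_lin n x) = phi n (diff dir x).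
Proof. exact: im_mk. Qed.

Fact diff_derivation d : operad_derivation (@diff k d Q).
Proof. by case: d; [apply: bo_d_der|apply: bo_db_der]. Qed.

Fact cofree_lift_deg n p q (x : Q n) : bg_hom p q x ->
  bg_hom p q (cofree_lift_lin n x).
Proof.
move=> hx; rewrite ext_homE -/(cre n _) -/(cim n _) re_lift im_lift.
split; first exact: smh_deg.
apply: smh_deg; rewrite /a /b diffE; have [h1 h2 _ _ _] := bo_bicomplex Q n.
by case: dir; rewrite ?opprK subr0; [apply: h1|apply: h2].
Qed.

Fact cofree_lift_act n (s : 'S_n) (x : Q n) :
  cofree_lift_lin n (sm_act s x) = sm_act s (cofree_lift_lin n x).
Proof.
apply: ext_eq; rewrite ?re_act ?im_act -?/(cre n _) -?/(cim n _).
  by rewrite !re_lift smh_act.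
by rewrite !im_lift (od_act (diff_derivation dir)) smh_act.
Qed.

Definition cofree_lift_smod : smod_hom Q cofree :=
  @SModHom _ Q cofree cofree_lift_lin cofree_lift_deg cofree_lift_act.

Definition cofree_lift : goperad_hom Q cofree.
Proof.
apply: (@GOperadHom _ Q cofree cofree_lift_smod).
- apply: ext_eq; rewrite -?/(cre _ _) -?/(cim _ _).
    by rewrite [LHS]re_lift gh_id; apply: esym (re_id _ _).
  rewrite [LHS]im_lift (od_id (diff_derivation dir)) linear0.
  exact: esym (im_id cofree_odd P).
- move=> m n r e i x y; apply: ext_eq; rewrite ?re_comp ?im_comp -?/(cre _ _) -?/(cim _ _).
    by rewrite !re_lift gh_comp.
  by rewrite !im_lift !re_lift (leibniz (diff_derivation dir)) linearD !gh_comp smh_sgn.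
Defined.

Lemma cofree_liftE n x : cofree_re n (cofree_lift n x) = phi n x.
Proof. exact: re_lift. Qed.

Lemma cofree_lift_main n x : cofree_lift n (diff dir x) = diff dir (cofree_lift n x).
Proof.
rewrite cofree_main; apply: ext_eq; rewrite ?re_contract ?im_contract -?/(cre _ _) -?/(cim _ _).
  by rewrite [LHS]re_lift [RHS]im_lift.
rewrite [LHS]im_lift; have [_ _ h1 h2 _] := bo_bicomplex Q n.
have -> : diff dir (diff dir x) = 0 by rewrite !diffE; case: dir.
by rewrite linear0.
Qed.

(** An element is determined by its real part and that of its differential in direction [dir]. For
    the second, the two differentials are exchanged by anticommutation on both sides. *)
Lemma cofree_lift_other : (forall n x, phi n (diff (~~ dir) x) = diff (~~ dir) (phi n x)) ->
  forall n x, cofree_lift n (diff (~~ dir) x) = diff (~~ dir) (cofree_lift n x).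
Proof.
move=> h n x; apply: cofree_eq; first by rewrite cofree_re_other !cofree_liftE.
have [_ _ _ _ h5] := bo_bicomplex cofree n; have [_ _ _ _ h5'] := bo_bicomplex Q n.
have anti (R : bioperad k) (y : R n) : diff dir (diff (~~ dir) y) = - diff (~~ dir) (diff dir y).
  have [_ _ _ _ hR] := bo_bicomplex R n.
  by apply/eqP; rewrite -addr_eq0 !diffE; case: dir => /=; rewrite ?hR // addrC hR.
rewrite -cofree_lift_main !anti !linearN /= cofree_liftE cofree_re_other.
by rewrite -cofree_lift_main cofree_liftE h.
Qed.

End CofreeLift.
End Cofree.

Section TrivialDifferential.
Variables (k : fieldType) (O : goperad k).

Fact trivial_bicomplex n : bicomplex_axioms (\0 : O n -> O n) (\0 : O n -> O n).
Proof.
by split=> *; rewrite /= ?addr0 //; apply: bg_hom0.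
Qed.

Fact trivial_derivation :
  operad_derivation (fun n => \0 : {linear O n -> O n}).
Proof.
split=> [n s x||m n r e i p q x y hx] /=; rewrite ?linear0 //.
by rewrite op_comp0l op_comp0r scaler0 addr0.
Qed.

Definition trivial_bioperad : bioperad k :=
  @BiOperad k O (fun n => \0) (fun n => \0) trivial_bicomplex trivial_derivation
    trivial_derivation.
End TrivialDifferential.

(* The forgetful functor from operads in bicomplexes to operads in bigraded
   spaces has a right adjoint, so it preserves colimits. *)
Lemma colimit_goperad_hom (k : fieldType) (Q : nat -> bioperad k)
    (j : forall i, bioperad_hom (Q i) (Q i.+1)) (M : bioperad k)
    (c : forall i, bioperad_hom (Q i) M) (O : goperad k)
    (f : forall i, goperad_hom (Q i) O) :
  is_colimit j c -> (forall i n x, f i.+1 n (j i n x) = f i n x) ->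
  exists g : goperad_hom M O, forall i n x, g n (c i n x) = f i n x.
Proof.
move=> [_ colim] fj; pose O0 := trivial_bioperad O.
have z0 d n (x : O0 n) : diff d x = 0 by case: d.
(* The differentials are adjoined one after the other: delbar is still zero on O1, so the
   construction applies again. *)
pose O1 := @cofree k true O0.
have z1 n (x : O1 n) : diff false x = 0 by apply: (@cofree_other0 k true O0); apply: z0.
pose O2 := @cofree k false O1.
pose g1 i : goperad_hom (Q i) O1 := @cofree_lift k true O0 (Q i) (f i).
pose g2 i : goperad_hom (Q i) O2 := @cofree_lift k false O1 (Q i) (g1 i).
have g1d i n x : g1 i n (diff true x) = diff true (g1 i n x).
  by apply: (@cofree_lift_main k true O0); apply: z0.
have g2d d i n x : g2 i n (diff d x) = diff d (g2 i n x).
  case: d; last exact: (@cofree_lift_main k false O1).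
  by apply: (@cofree_lift_other k false O1) => // m y; apply: g1d.
pose h i : bioperad_hom (Q i) O2 := @BiOperadHom _ _ _ (g2 i) (g2d true i) (g2d false i).
have g1E i n x : cofree_re true O0 n (g1 i n x) = f i n x by apply: cofree_liftE.
have g2E i n x : cofree_re false O1 n (g2 i n x) = g1 i n x by apply: cofree_liftE.
have g1j i n x : g1 i.+1 n (j i n x) = g1 i n x.
  apply: (@cofree_eq k true O0) => //; first by rewrite !g1E.
  by rewrite -!g1d !g1E -bh_diff.
have [|g [gE _]] := colim O2 h.
  move=> i n x; apply: (@cofree_eq k false O1) => //; first by rewrite !g2E.
  by rewrite -!g2d !g2E -bh_diff.
exists (goperad_hom_comp (goperad_hom_comp (cofree_re true O0) (cofree_re false O1)) g).
move=> i n x; rewrite -(g1E i n x) -(g2E i n x) -[g2 i n x]/(h i n x) -gE.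
by [].
Qed.

(** * Weak equivalences *)

Local Open Scope classical_set_scope.

Lemma submodD (k : fieldType) (V : lmodType k) (S : submod V) x y :
  submod_set S x -> submod_set S y -> submod_set S (x + y).
Proof. by move=> hx hy; rewrite -[x]scale1r; apply: submodP. Qed.

Lemma submodN (k : fieldType) (V : lmodType k) (S : submod V) x :
  submod_set S x -> submod_set S (- x).
Proof.
by move=> hx; rewrite -scaleN1r -[_ *: _]addr0; apply: submodP => //; apply: submod0.
Qed.

Section Subquotient.
Variables (k : fieldType) (V W : lmodType k) (f : {linear V -> W}).
Variables (Z B : submod V) (Z' B' : submod W).
Hypothesis fB : forall x, submod_set B x -> submod_set B' (f x).

Lemma induced_coset x :
  induced f (submod_set B') (vcoset (submod_set B) x) = vcoset (submod_set B') (f x).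
Proof.
apply/seteqP; split=> y /=.
  move=> [x' hx' hy]; rewrite /vcoset /=.
  have -> : y - f x = (y - f x') + f (x' - x) by rewrite linearB addrA subrK.
  by apply: submodD => //; apply: fB.
by move=> hy; exists x => //; rewrite /vcoset /= subrr; apply: submod0.
Qed.

Let Hf := set_bij (subquotient (submod_set Z) (submod_set B))
  (subquotient (submod_set Z') (submod_set B')) (induced f (submod_set B')).

Lemma subquotient_inj x : Hf -> submod_set Z x -> submod_set B' (f x) ->
  submod_set B x.
Proof.
move=> [_ inj _] Zx Bx.
have /(congr1 (fun S => S x)) : vcoset (submod_set B) x = vcoset (submod_set B) 0.
  apply: inj; rewrite ?inE.
  - by exists x.
  - by exists 0 => //; apply: submod0.
  rewrite !induced_coset; apply/seteqP; split=> y; rewrite /vcoset /= linear0 subr0 => h.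
    by rewrite -[y](subrK (f x)); apply: submodD.
  by apply: submodD => //; apply: submodN.
by rewrite /vcoset /= subrr subr0 => <-; apply: submod0.
Qed.

Lemma subquotient_surj y : Hf -> submod_set Z' y ->
  exists2 x, submod_set Z x & submod_set B' (y - f x).
Proof.
move=> [_ _ surj] Zy.
have [|S [x Zx <-]] := surj (vcoset (submod_set B') y); first by exists y.
rewrite induced_coset => /(congr1 (fun S => S y)); rewrite /vcoset /= subrr => h.
by exists x => //; rewrite h; apply: submod0.
Qed.

End Subquotient.

Section CycleSubmodules.
Variables (k : fieldType) (A : bicomplex k).

Definition BC_cycles_submod : submod A.
Proof.
apply: (@Submod _ _ (BC_cycles A)); first by split; rewrite linear0.
by move=> a x y [h1 h2] [h3 h4]; split; rewrite linearP ?h1 ?h2 ?h3 ?h4 scaler0 addr0.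
Defined.

Definition BC_boundaries_submod : submod A.
Proof.
apply: (@Submod _ _ (BC_boundaries A)); first by exists 0; rewrite !linear0.
by move=> a x y [x' ->] [y' ->]; exists (a *: x' + y'); rewrite !linearP.
Defined.

Definition A_cycles_submod : submod A.
Proof.
apply: (@Submod _ _ (A_cycles A)); first by rewrite /A_cycles /= !linear0.
by move=> a x y h1 h2; rewrite /A_cycles /= !linearP /= h1 h2 scaler0 addr0.
Defined.

Definition A_boundaries_submod : submod A.
Proof.
apply: (@Submod _ _ (A_boundaries A)); first by exists 0, 0; rewrite !linear0 addr0.
move=> a x y [u [v ->]] [u' [v' ->]]; exists (a *: u + u'), (a *: v + v').
by rewrite !linearP /= scalerDr addrACA.
Defined.

End CycleSubmodules.

(* The parts of the isomorphisms on H_BC and H_A that are needed. *)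
Record weq_elements (k : fieldType) (P Q : bioperad k) (f : bioperad_hom P Q) : Prop := {
  weq_BC_inj : forall n (x : P n), bo_d x = 0 -> bo_db x = 0 ->
    (exists y, f n x = bo_d (bo_db y)) -> exists y, x = bo_d (bo_db y);
  weq_A_inj : forall n (x : P n), bo_d (bo_db x) = 0 ->
    (exists y z, f n x = bo_d y + bo_db z) -> exists y z, x = bo_d y + bo_db z;
  weq_A_surj : forall n (y : Q n), bo_d (bo_db y) = 0 ->
    exists x, bo_d (bo_db x) = 0 /\ exists u v, y = f n x + bo_d u + bo_db v }.

Lemma operad_weqE (k : fieldType) (P Q : bioperad k) (f : bioperad_hom P Q) :
  operad_weq f -> weq_elements f.
Proof.
move=> w; split.
- move=> n x x1 x2 hx; have [h _] := w n.
  apply: (@subquotient_inj _ _ _ (f n) (BC_cycles_submod (bo_arity P n))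
    (BC_boundaries_submod (bo_arity P n)) (BC_cycles_submod (bo_arity Q n))
    (BC_boundaries_submod (bo_arity Q n)) _ x h) => //.
  by move=> _ [z ->]; exists (f n z); rewrite /= bh_d bh_db.
- move=> n x x1 hx; have [_ h] := w n.
  apply: (@subquotient_inj _ _ _ (f n) (A_cycles_submod (bo_arity P n))
    (A_boundaries_submod (bo_arity P n)) (A_cycles_submod (bo_arity Q n))
    (A_boundaries_submod (bo_arity Q n)) _ x h) => //.
  by move=> _ [z [z' ->]]; exists (f n z), (f n z'); rewrite linearD /= bh_d bh_db.
- move=> n y hy; have [_ h] := w n.
  have [||x hx [u [v E]]] := @subquotient_surj _ _ _ (f n) (A_cycles_submod (bo_arity P n))
    (A_boundaries_submod (bo_arity P n)) (A_cycles_submod (bo_arity Q n))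
    (A_boundaries_submod (bo_arity Q n)) _ y h.
  + by move=> _ [z [z' ->]]; exists (f n z), (f n z'); rewrite linearD /= bh_d bh_db.
  + exact: hy.
  by exists x; split=> //; exists u, v; rewrite -addrA -[bo_d _ + _]E addrC subrK.
Qed.

(** * Sums of bicomplexes, and simultaneous equations for del and delbar *)

Section BicomplexSum.
Variables (k : fieldType) (A B : bigraded k).
Variables (d db : {linear A -> A}) (d' db' : {linear B -> B}).

Fact pair_linear (f : {linear A -> A}) (g : {linear B -> B}) :
  linear (fun x : bgsum A B => ((f x.1, g x.2) : bgsum A B)).
Proof. by move=> a x y; congr pair; apply: linearP. Qed.

Definition pair_lin f g : {linear bgsum A B -> bgsum A B} := lin_of (pair_linear f g).

Lemma bicomplex_sum : bicomplex_axioms d db -> bicomplex_axioms d' db' ->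
  bicomplex_axioms (pair_lin d d') (pair_lin db db').
Proof.
move=> [h1 h2 h3 h4 h5] [h1' h2' h3' h4' h5']; split.
- by move=> p q x [hx hy]; split; [apply: h1|apply: h1'].
- by move=> p q x [hx hy]; split; [apply: h2|apply: h2'].
- by move=> x; congr pair; [apply: h3|apply: h3'].
- by move=> x; congr pair; [apply: h4|apply: h4'].
- by move=> x; congr pair; [apply: h5|apply: h5'].
Qed.

Lemma bgsum_proj e (x : bgsum A B) : bg_proj e x = (bg_proj e x.1, bg_proj e x.2).
Proof.
move: x; apply: bg_ind => [|x y hx hy|p q x hx].
- by rewrite linear0 /= !linear0.
- by rewrite linearD hx hy /= !linearD.
rewrite (bg_projE _ hx); case: hx => h1 h2; rewrite (bg_projE _ h1) (bg_projE _ h2).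
by case: x {h1 h2} => ? ?; case: ifP.
Qed.

End BicomplexSum.

(** H_BC = 0 on K is used three times: for db u = d db w, then for u + d w = d db w', which makes d
    (db w' - w) = u, and then to correct the db of this solution by some d w2, which does not change
    its d. Projecting to bidegree (p, q) keeps both equations. K is a subspace because the kernel to
    which this applies is not built as a bicomplex of its own. *)
Lemma BC_acyclic_solve (k : fieldType) (A : bigraded k) (d db : {linear A -> A})
    (K : submod A) p q (u v : A) :
  bicomplex_axioms d db ->
  (forall x, submod_set K x -> submod_set K (d x)) ->
  (forall x, submod_set K x -> submod_set K (db x)) ->
  (forall e x, submod_set K x -> submod_set K (bg_proj e x)) ->
  (forall x, submod_set K x -> d x = 0 -> db x = 0 ->
     exists2 z, submod_set K z & x = d (db z)) ->
  submod_set K u -> submod_set K v ->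
  bg_hom (p + 1) q u -> bg_hom p (q + 1) v ->
  d u = 0 -> db v = 0 -> d v + db u = 0 ->
  exists z, [/\ submod_set K z, bg_hom p q z, d z = u & db z = v].
Proof.
move=> ax Kd Kdb Kp acyc Ku Kv hu hv du dbv duv.
have [d_deg db_deg dd dbdb ddb] := ax.
have anti x : db (d x) = - d (db x) by apply/eqP; rewrite -addr_eq0 addrC ddb.
have [||w Kw hw] := acyc (db u) (Kdb _ Ku).
- by apply/eqP; rewrite -oppr_eq0 -anti du linear0.
- exact: dbdb.
have [|||w' Kw' hw'] := acyc (u + d w).
- by apply: submodD => //; apply: Kd.
- by rewrite linearD du dd addr0.
- by rewrite linearD hw anti addrN.
pose z0 := db w' - w.
have Kz0 : submod_set K z0 by apply: submodD; [apply: Kdb|apply: submodN].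
have dz0 : d z0 = u by rewrite linearB -hw' addrK.
have [|||w2 Kw2 hw2] := acyc (v - db z0).
- by apply: submodD => //; apply: submodN; apply: Kdb.
- rewrite linearB -[d (db z0)]opprK -anti dz0 opprK; exact: duv.
- by rewrite linearB dbv dbdb subr0.
pose z := z0 - d w2.
have Kz : submod_set K z by apply: submodD => //; apply: submodN; apply: Kd.
have dz : d z = u by rewrite linearB dd subr0.
have dbz : db z = v by rewrite linearB anti opprK -hw2 addrC subrK.
exists (bg_proj (p, q) z); split.
- exact: Kp.
- exact: (bg_proj_hom (p, q)).
- rewrite -(@bg_proj_deg _ _ _ 1 0 d) ?dz ?addr0 ?bg_proj_id //.
  by move=> p' q' x; rewrite addr0; apply: d_deg.
- rewrite -(@bg_proj_deg _ _ _ 0 1 db) ?dbz ?addr0 ?bg_proj_id //.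
  by move=> p' q' x; rewrite addr0; apply: db_deg.
Qed.

(** * Lifting *)

Section SmodHoms.
Variable k : fieldType.

Lemma linear_inverse (V W : lmodType k) (f : {linear V -> W}) : bijective f ->
  {g : {linear W -> V} | cancel f g /\ cancel g f}.
Proof.
move=> bij; apply: cid; case: bij => g fK gK.
have lg : linear g.
  by move=> a x y; apply: (can_inj fK); rewrite linearP !gK.
by exists (lin_of lg).
Qed.

Lemma smod_inverse (M N : smodule k) (f : smod_hom M N) :
  (forall n, bijective (f n)) ->
  exists g : smod_hom N M, (forall n, cancel (f n) (g n)) /\ (forall n, cancel (g n) (f n)).
Proof.
move=> bij; pose g n := projT1 (linear_inverse (bij n)).
have fK n : cancel (f n) (g n) by rewrite /g; case: linear_inverse => ? [].
have gK n : cancel (g n) (f n) by rewrite /g; case: linear_inverse => ? [].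
have gh n p q x : bg_hom p q x -> bg_hom p q (g n x).
  move=> hx; have <- : bg_proj (p, q) (g n x) = g n x.
    by apply: (can_inj (fK n)); rewrite smh_proj gK bg_proj_id.
  exact: (bg_proj_hom (p, q)).
have ga n (s : 'S_n) x : g n (sm_act s x) = sm_act s (g n x).
  by apply: (can_inj (fK n)); rewrite smh_act !gK.
by exists (@SModHom _ N M g gh ga).
Qed.

Lemma smod_sum_hom (M E O : smodule k) (f : smod_hom M O) (g : smod_hom E O) :
  exists h : smod_hom (smsum M E) O, forall n x, h n x = f n x.1 + g n x.2.
Proof.
have lh n : linear (fun x : smsum M E n => f n x.1 + g n x.2).
  by move=> a x y; rewrite /= !linearP /= scalerDr addrACA.
have hh n p q (x : smsum M E n) : bg_hom p q x -> bg_hom p q (lin_of (@lh n) x).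
  by move=> [h1 h2]; apply: bg_homD; apply: smh_deg.
have ha n (s : 'S_n) (x : smsum M E n) :
    lin_of (@lh n) (sm_act s x) = sm_act s (lin_of (@lh n) x).
  by rewrite /= !smh_act linearD.
by exists (@SModHom _ (smsum M E) O (fun n => lin_of (@lh n)) hh ha).
Qed.

Definition smod_fst (M N : smodule k) : smod_hom (smsum M N) M :=
  @SModHom k (smsum M N) M (fun n => @fst (M n) (N n)) (fun n p q x h => proj1 h)
    (fun n s x => erefl).

Definition smod_snd (M N : smodule k) : smod_hom (smsum M N) N :=
  @SModHom k (smsum M N) N (fun n => @snd (M n) (N n)) (fun n p q x h => proj2 h)
    (fun n s x => erefl).

End SmodHoms.

(** * Maps out of a principal extension *)

Section ExtensionHom.
Variables (k : fieldType) (Q R : quasi_free k) (j : bioperad_hom Q R) (E : smodule k).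
Variable theta : smod_hom (smsum (qf_gen Q) E) (qf_gen R).
Hypothesis theta_bij : forall m, bijective (theta m).
Hypothesis theta_j : forall m (x : qf_gen Q m), qf_inc m (theta m (x, 0)) = j m (qf_inc m x).
Let cell n (x : E n) : R n := qf_inc n (theta n (0, x)).

Lemma cell_linear n : linear (@cell n).
Proof.
move=> a x y; rewrite /cell -!linearP; congr (qf_inc n (theta n _)).
by congr pair; rewrite /= scaler0 addr0.
Qed.

Lemma cell0 n : @cell n 0 = 0.
Proof. exact: (linear0 (lin_of (@cell_linear n))). Qed.

Lemma cell_act n (s : 'S_n) x : cell (sm_act s x) = sm_act s (cell x).
Proof.
rewrite /cell -!smh_act; congr (qf_inc n (theta n _)).
by congr pair; rewrite /= linear0.
Qed.

Lemma cell_deg n p q x : bg_hom p q x -> bg_hom p q (@cell n x).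
Proof. by move=> h; apply: smh_deg; apply: smh_deg; split => //; apply: bg_hom0. Qed.

Lemma extension_gen n (y : qf_gen R n) : exists x e, qf_inc n y = j n (qf_inc n x) + cell e.
Proof.
have [g _ gK] := theta_bij n; exists (g y).1, (g y).2.
rewrite -theta_j -!linearD -[in LHS](gK y); congr (qf_inc n (theta n _)).
by case: (g y) => a b; congr pair; rewrite /= ?addr0 ?add0r.
Qed.

(** Freeness provides the map without differentials, and by [free_hom_comm] compatibility is needed
    on generators only. The differentials of a cell lie in Q, where the map is already f. *)
Lemma extension_hom (O : bioperad k) (f : bioperad_hom Q O) (phi : smod_hom E O) :
  (forall n x, exists a b, [/\ bo_d (cell x) = j n a, bo_db (cell x) = j n b,
     bo_d (phi n x) = f n a & bo_db (phi n x) = f n b]) ->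
  exists g : bioperad_hom R O, (forall n x, g n (j n x) = f n x) /\
    (forall n x, g n (cell x) = phi n x).
Proof.
move=> h; have [th [thK thK']] := smod_inverse theta_bij.
have [psi psiE] := smod_sum_hom (smod_hom_comp f qf_inc) phi.
have [g [gE _]] := qf_free (smod_hom_comp psi th).
have gj n x : g n (j n x) = f n x.
  apply: (@free_hom_eq _ _ _ _ _ (goperad_hom_comp g j) f (@qf_free k Q)) => m y.
  by rewrite /= -theta_j gE /= thK psiE /= linear0 addr0.
have gc n x : g n (cell x) = phi n x.
  by rewrite /cell gE /= thK psiE /= !linear0 add0r.
have gd n x : g n (bo_d x) = bo_d (g n x).
  apply: (free_hom_comm (@qf_free k R) (bo_d_der R) (bo_d_der O)) => m y.
  have [x' [e ->]] := extension_gen y; have [a [b [h1 h2 h3 h4]]] := h m e.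
  by rewrite !linearD h1 -bh_d !gj gc h3 bh_d.
have gdb n x : g n (bo_db x) = bo_db (g n x).
  apply: (free_hom_comm (@qf_free k R) (bo_db_der R) (bo_db_der O)) => m y.
  have [x' [e ->]] := extension_gen y; have [a [b [h1 h2 h3 h4]]] := h m e.
  by rewrite !linearD h2 -bh_db !gj gc h4 bh_db.
by exists (@BiOperadHom _ R O g gd gdb).
Qed.

Lemma extension_hom_eq (O : goperad k) (f g : goperad_hom R O) :
  (forall n x, f n (j n x) = g n (j n x)) -> (forall n x, f n (cell x) = g n (cell x)) ->
  forall n x, f n x = g n x.
Proof.
move=> h1 h2; apply: (free_hom_eq (@qf_free k R)) => n y.
by have [x [e ->]] := extension_gen y; rewrite !linearD h1 h2.
Qed.

End ExtensionHom.

(** * Extension of the lift over one principal extension *)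

Section Lifting.
Variable k : fieldType.
Hypothesis char0 : [pchar k] =i pred0.
Variables (P N : bioperad k) (alpha' : bioperad_hom N P).
Hypothesis weq' : weq_elements alpha'.
Variables (PI : bioperad k) (e0 e1 : bioperad_hom PI P) (cst : bioperad_hom P PI).
Hypothesis e0_cst : forall n x, e0 n (cst n x) = x.
Hypothesis e1_cst : forall n x, e1 n (cst n x) = x.
Hypothesis PI_BC : forall n w, e0 n w = 0 -> bo_d w = 0 -> bo_db w = 0 ->
  exists2 z, e0 n z = 0 & w = bo_d (bo_db z).
Hypothesis PI_surj : forall n p q x, bg_hom p q x ->
  exists w, [/\ bg_hom p q w, e0 n w = 0 & e1 n w = x].

Lemma PI_surj' n x : exists2 w, e0 n w = 0 & e1 n w = x.
Proof.
move: x; apply: bg_ind => [|x y [w h1 h2] [w' h1' h2']|p q x /PI_surj[w [_ h1 h2]]].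
- by exists 0; rewrite linear0.
- by exists (w + w'); rewrite linearD ?h1 ?h1' ?addr0 // h2 h2'.
- by exists w.
Qed.

(* The kernel of the map from N x_P PI to P given by the end point 1. *)
Definition fiber_set n (x : bgsum (N n) (PI n)) : Prop :=
  e0 n x.2 = alpha' n x.1 /\ e1 n x.2 = 0.

Definition fiber_submod n : submod (bgsum (N n) (PI n)).
Proof.
apply: (@Submod _ _ (@fiber_set n)); first by split; rewrite !linear0.
move=> a x y [h1 h2] [h3 h4]; split.
  by rewrite /= !linearP h1 h3.
by rewrite /= !linearP h2 h4 scaler0 addr0.
Defined.

(** H_BC of the kernel vanishes. Injectivity of alpha' on H_BC provides y'; then w' can be found
    with the right end point 0 but possibly a wrong end point 1, and surjectivity of alpha' on H_A
    removes the defect. *)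
Lemma fiber_acyclic n (y : N n) (w : PI n) : e0 n w = alpha' n y -> e1 n w = 0 ->
  bo_d y = 0 -> bo_db y = 0 -> bo_d w = 0 -> bo_db w = 0 ->
  exists y' w', [/\ e0 n w' = alpha' n y', e1 n w' = 0,
    y = bo_d (bo_db y') & w = bo_d (bo_db w')].
Proof.
move=> hw0 hw1 dy dby dw dbw.
have [_ _ dd dbdb ddb] := bo_bicomplex PI n.
have anti (x : PI n) : bo_d (bo_db x) = - bo_db (bo_d x).
  by apply/eqP; rewrite -addr_eq0; apply/eqP; apply: ddb.
have [||| t t0 tE] := @PI_BC n (w - cst n (e0 n w)).
- by rewrite linearB e0_cst subrr.
- by rewrite linearB -!bh_d dw !linear0 ?oppr0 addr0.
- by rewrite linearB -!bh_db dbw !linear0 ?oppr0 addr0.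
(* At the end point 1 the equation for t reads -alpha' y = del delbar (e1 t), since w vanishes
   there. *)
have [y' yE] : exists y', y = bo_d (bo_db y').
  apply: (weq_BC_inj weq' dy dby); exists (- e1 n t).
  have /(congr1 (e1 n)) := tE; rewrite linearB hw1 e1_cst sub0r !(bh_d, bh_db) hw0.
  by move/(congr1 -%R); rewrite opprK => ->; rewrite !linearN.
have [l l0 l1] := PI_surj' (alpha' n y').
(* A path from alpha' y' to 0. Subtracting its del delbar reduces to the case where w vanishes at
   both ends. *)
pose kp := cst n (alpha' n y') - l.
have kp0 : e0 n kp = alpha' n y' by rewrite linearB e0_cst l0 subr0.
have kp1 : e1 n kp = 0 by rewrite linearB e1_cst l1 subrr.
pose w3 := w - bo_d (bo_db kp).
have w30 : e0 n w3 = 0 by rewrite linearB hw0 yE !(bh_d, bh_db) kp0 subrr.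
have w31 : e1 n w3 = 0 by rewrite linearB hw1 !(bh_d, bh_db) kp1 !linear0 ?oppr0 addr0.
have [||t3 t30 t3E] := PI_BC w30.
- by rewrite linearB dw dd subr0.
- by rewrite linearB dbw anti linearN dbdb oppr0 subr0.
(* t3 vanishes at 0 but not necessarily at 1. As del delbar (e1 t3) = 0, this end value is alpha' z
   up to del a + delbar b; all three terms lift to paths killed by del delbar, and y' becomes y' -
   z. *)
have [|z [zz [a [b abE]]]] := @weq_A_surj _ _ _ _ weq' n (e1 n t3).
  by rewrite -bh_db -bh_d -t3E.
have [A A0 A1] := PI_surj' a; have [B B0 B1] := PI_surj' b.
exists (y' - z), (kp + (t3 - cst n (alpha' n z) - bo_d A - bo_db B)); split.
- rewrite (linearD (e0 n)) kp0 !(linearB (e0 n)) (linearB (alpha' n)) t30 e0_cst.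
  by rewrite bh_d bh_db A0 B0 !linear0 ?oppr0 !addr0 add0r.
- rewrite (linearD (e1 n)) kp1 !(linearB (e1 n)) e1_cst bh_d bh_db A1 B1 add0r.
  by rewrite -!addrA -!opprD abE !addrA subrr.
- by rewrite !linearB zz subr0.
- have c0 : bo_d (bo_db (cst n (alpha' n z))) = 0 by rewrite -!bh_db -!bh_d zz !linear0.
  have A2 : bo_d (bo_db (bo_d A)) = 0 by rewrite anti dd linear0 ?oppr0.
  have B2 : bo_d (bo_db (bo_db B)) = 0 by rewrite dbdb linear0.
  rewrite (linearD bo_db) (linearD bo_d) !(linearB bo_db (_ - _)) (linearB bo_db t3).
  rewrite !(linearB bo_d (_ - _)) (linearB bo_d (bo_db t3)) c0 A2 B2 !subr0 -t3E.
  by rewrite addrC subrK.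
Qed.

Lemma lift_stage (Q R : quasi_free k) (j : bioperad_hom Q R)
    (f : bioperad_hom Q N) (H : bioperad_hom Q PI) (pi : bioperad_hom R P) :
  is_principal_extension j ->
  (forall n x, e0 n (H n x) = alpha' n (f n x)) ->
  (forall n x, e1 n (H n x) = pi n (j n x)) ->
  exists (f' : bioperad_hom R N) (H' : bioperad_hom R PI),
  [/\ forall n x, f' n (j n x) = f n x, forall n x, H' n (j n x) = H n x,
     forall n x, e0 n (H' n x) = alpha' n (f' n x) &
     forall n x, e1 n (H' n x) = pi n x].
Proof.
move=> [n [E [d [theta [n2 Econ bij tj cells]]]]] hH0 hH1.
pose cell m (x : E m) : R m := qf_inc m (theta m (0, x)).
(* The admissible values of a cell in N and in PI. They form a linear relation stable under the
   symmetric groups, as [smodule_selection] requires; a and b are quantified because the attaching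
   map exists in arity n only. *)
pose Rel m (x : E m) (z : smsum N PI m) := exists a b : Q m,
  [/\ bo_d (cell m x) = j m a, bo_db (cell m x) = j m b &
    [/\ bo_d (z.1 : N m) = f m a, bo_db (z.1 : N m) = f m b,
      bo_d (z.2 : PI m) = H m a & bo_db (z.2 : PI m) = H m b] /\
    (e0 m z.2 = alpha' m z.1 /\ e1 m z.2 = pi m (cell m x))].
have cl m := @cell_linear _ _ _ _ theta m.
have Rel0 m : Rel m 0 0.
  by exists 0, 0; rewrite /cell (cell0 theta) /= !linear0.
have [phi phiR] : exists phi : smod_hom E (smsum N PI), forall m x, Rel m x (phi m x).
  apply: smodule_selection => //.
  - move=> m; split=> // a x z x' z' [u [v [h1 h2 [[h3 h4 h5 h6] [h7 h8]]]]].
    move=> [u' [v' [h1' h2' [[h3' h4' h5' h6'] [h7' h8']]]]].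
    exists (a *: u + u'), (a *: v + v'); rewrite /cell [qf_inc _ _]cl /= !linearP.
    by rewrite h1 h2 h3 h4 h5 h6 h7 h8 h1' h2' h3' h4' h5' h6' h7' h8'.
  - move=> m s x z [u [v [h1 h2 [[h3 h4 h5 h6] [h7 h8]]]]].
    exists (sm_act s u), (sm_act s v); rewrite /cell [qf_inc _ _](cell_act theta) /= !smh_act.
    rewrite !(od_act (bo_d_der _)) !(od_act (bo_db_der _)).
    by rewrite h1 h2 h3 h4 h5 h6 h7 h8.
  move=> m p q x hx; have [mn|mn] := eqVneq m n; last first.
    by exists 0; [apply: bg_hom0|rewrite (Econ m x) //; apply/eqP].
  subst m; pose a := at_10 d x; pose b := at_01 d x.
  have ha : bg_hom (p + 1) q a by apply: at_10_deg.
  have hb : bg_hom p (q + 1) b by apply: at_01_deg.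
  have [Qd Qdb _ _ _] := bo_bicomplex Q n.
  have [da dbb dba] : [/\ bo_d a = 0, bo_db b = 0 & bo_d b + bo_db a = 0].
    have := at_ker d x; rewrite at_sum -/a -/b !linearD /=.
    have h1 := Qd _ _ _ ha; have h2 := Qdb _ _ _ hb.
    have h3 := Qd _ _ _ hb; have h4 := Qdb _ _ _ ha.
    (* The equation del (a + b) + delbar (a + b) = 0 has components of three different bidegrees,
       each of which vanishes. *)
    move=> E0; apply: (@bg_hom3_eq0 _ _ (p + 1 + 1, q) (p, q + 1 + 1) (p + 1, q + 1)) => //.
    + exact: bg_homD h3 h4.
    + have n1 r : (r + 1 == r :> int) = false by rewrite -subr_eq0 addrC addKr.
      have nn2 r : (r + 1 + 1 == r :> int) = false by rewrite -subr_eq0 addrC -addrA addKr.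
      by rewrite /= !inE !xpair_eqE n1 nn2 [p == p + 1]eq_sym n1.
    + rewrite -[RHS]E0 -!addrA; congr (_ + _); rewrite addrCA; congr (_ + _).
      exact: addrC.
  have cx : bg_hom p q (cell n x) by apply: cell_deg.
  (* w0 has the prescribed value at the end point 1, so only a correction in the kernel is sought; u
     and v are what its two differentials have to be. *)
  have [w0 [w0h w00 w01]] := PI_surj (smh_deg pi cx).
  have [c1 c2] : bo_d (cell n x) = j n a /\ bo_db (cell n x) = j n b := cells x.
  have [_ _ Pdd Pdbdb Pddb] := bo_bicomplex PI n.
  pose B := bgsum (N n) (PI n).
  pose u : B := (f n a, H n a - bo_d w0); pose v : B := (f n b, H n b - bo_db w0).
  have ax := bicomplex_sum (bo_bicomplex N n) (bo_bicomplex PI n).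
  have [|||||||||||z [[Kz0 Kz1] hz dz dbz]] :=
      @BC_acyclic_solve k B _ _ (fiber_submod n) p q u v ax.
  - by move=> y [h1 h2]; split; rewrite /= bh_d ?h1 ?h2 ?bh_d ?linear0.
  - by move=> y [h1 h2]; split; rewrite /= bh_db ?h1 ?h2 ?bh_db ?linear0.
  - move=> e y [h1 h2].
    rewrite bgsum_proj.
    by split; rewrite /= !smh_proj ?h1 ?h2 ?linear0.
  - move=> [y w] [h1 h2] [e1' e2'] [e3' e4'].
    have [y' [w' [k1 k2 E1 E2]]] := @fiber_acyclic n y w h1 h2 e1' e3' e2' e4'.
    by exists ((y', w') : B); [|rewrite E1 E2].
  - split; rewrite /= linearB bh_d ?w00 ?w01 ?hH0 ?hH1 ?linear0 ?oppr0 ?addr0 //.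
    by rewrite -c1 -bh_d subrr.
  - split; rewrite /= linearB bh_db ?w00 ?w01 ?hH0 ?hH1 ?linear0 ?oppr0 ?addr0 //.
    by rewrite -c2 -bh_db subrr.
  - split; first exact: smh_deg.
    by apply: bg_homD; [apply: smh_deg|apply: bg_homN; apply: bc_d_deg (bo_bicomplex PI n) _ _ _ w0h].
  - split; first exact: smh_deg.
    by apply: bg_homD; [apply: smh_deg|apply: bg_homN; apply: bc_db_deg (bo_bicomplex PI n) _ _ _ w0h].
  - by congr pair; rewrite /= ?linearB -?bh_d da ?Pdd ?linear0 ?oppr0 ?addr0.
  - by congr pair; rewrite /= ?linearB -?bh_db dbb ?Pdbdb ?linear0 ?oppr0 ?addr0.
  - congr pair; first by rewrite /= -bh_d -bh_db -linearD dba linear0.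
    rewrite /= (linearB bo_d) (linearB bo_db) addrACA -bh_d -bh_db -linearD dba.
    by rewrite -opprD Pddb linear0 ?oppr0 addr0.
  exists ((z.1, z.2 + w0) : B).
    by case: hz => h1 h2; split => //; apply: bg_homD.
  have dz1 := congr1 fst dz; have dz2 := congr1 snd dz.
  have dbz1 := congr1 fst dbz; have dbz2 := congr1 snd dbz.
  exists a, b; split=> //; split.
    by split; rewrite /= ?linearD ?[bo_d z.2]dz2 ?[bo_db z.2]dbz2 ?subrK.
  by rewrite /= !linearD Kz0 Kz1 w00 w01 addr0 add0r.
have [f' [f'j f'c]] := @extension_hom k Q R j E theta bij tj N f
  (smod_hom_comp (smod_fst N PI) phi)
  (fun m x => let: ex_intro u (ex_intro v (And3 h1 h2 (conj (And4 h3 h4 h5 h6) h))) := phiR m x in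
     ex_intro _ u (ex_intro _ v (And4 h1 h2 h3 h4))).
have [H' [H'j H'c]] := @extension_hom k Q R j E theta bij tj PI H
  (smod_hom_comp (smod_snd N PI) phi)
  (fun m x => let: ex_intro u (ex_intro v (And3 h1 h2 (conj (And4 h3 h4 h5 h6) h))) := phiR m x in
     ex_intro _ u (ex_intro _ v (And4 h1 h2 h5 h6))).
exists f', H'; split=> //.
- apply: (extension_hom_eq (f := goperad_hom_comp e0 H') (g := goperad_hom_comp alpha' f') bij tj).
    by move=> m x; rewrite /= H'j f'j hH0.
  by move=> m x; rewrite /= H'c f'c /=; have [u [v [_ _ [_ []]]]] := phiR m x.
- apply: (extension_hom_eq (f := goperad_hom_comp e1 H') (g := pi) bij tj).
    by move=> m x; rewrite /= H'j hH1.
  by move=> m x; rewrite /= H'c /=; have [u [v [_ _ [_ []]]]] := phiR m x.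
Qed.

End Lifting.

Section UnitStage.
Variables (k : fieldType) (Q : quasi_free k).
Hypothesis unitQ : is_unit_operad Q.

(** Generators of arity 1 are excluded and Q is zero in the other arities. Being free, Q therefore
    has exactly one map to any operad. *)
Lemma unit_gen0 n (y : qf_gen Q n) : qf_inc n y = 0.
Proof.
have [h _ _] := unitQ; have [n1|/eqP n1] := eqVneq n 1%N; last exact: h.
by subst n; rewrite (qf_gen1 y) linear0.
Qed.

Lemma unit_hom_eq (O : goperad k) (f g : goperad_hom Q O) : forall n x, f n x = g n x.
Proof. by apply: (free_hom_eq (@qf_free k Q)) => n y; rewrite unit_gen0 !linear0. Qed.

Lemma unit_hom (O : bioperad k) : exists f : bioperad_hom Q O, True.
Proof.
have z_deg n p q (x : qf_gen Q n) : bg_hom p q x -> bg_hom p q ((\0 : {linear qf_gen Q n -> O n}) x).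
  by move=> _; apply: bg_hom0.
have z_act n (s : 'S_n) (x : qf_gen Q n) : (\0 : {linear qf_gen Q n -> O n}) (sm_act s x) =
    sm_act s ((\0 : {linear qf_gen Q n -> O n}) x) by rewrite /= linear0.
have [g _] := qf_free (@SModHom k (qf_gen Q) O (fun n => \0) z_deg z_act).
have gd n x : g n (bo_d x) = bo_d (g n x).
  apply: (free_hom_comm (@qf_free k Q) (bo_d_der Q) (bo_d_der O)) => m y.
  by rewrite unit_gen0 !linear0.
have gdb n x : g n (bo_db x) = bo_db (g n x).
  apply: (free_hom_comm (@qf_free k Q) (bo_db_der Q) (bo_db_der O)) => m y.
  by rewrite unit_gen0 !linear0.
by exists (@BiOperadHom _ Q O g gd gdb).
Qed.

End UnitStage.

(** * The comparison map between two minimal models *)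

Section LiftPresentation.
Variable k : fieldType.
Hypothesis char0 : [pchar k] =i pred0.
Variables (P M N : bioperad k) (alpha : bioperad_hom M P) (alpha' : bioperad_hom N P).
Variable C : cofibrant_presentation M.
Hypothesis weq : weq_elements alpha.
Hypothesis weq' : weq_elements alpha'.

Lemma lift_presentation (PI : bioperad k) (e0 e1 : bioperad_hom PI P)
    (cst : bioperad_hom P PI) :
  (forall n x, e0 n (cst n x) = x) -> (forall n x, e1 n (cst n x) = x) ->
  (forall n w, e0 n w = 0 -> bo_d w = 0 -> bo_db w = 0 ->
     exists2 z, e0 n z = 0 & w = bo_d (bo_db z)) ->
  (forall n p q x, bg_hom p q x ->
     exists w, [/\ bg_hom p q w, e0 n w = 0 & e1 n w = x]) ->
  exists (f : bioperad_hom M N) (H : bioperad_hom M PI),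
    (forall n x, e0 n (H n x) = alpha' n (f n x)) /\
    (forall n x, e1 n (H n x) = alpha n x).
Proof.
move=> e0c e1c PI_BC PI_surj.
pose Q := cp_op C; pose j := cp_map C; pose c := cp_cocone C.
have colim := cp_colimit C.
pose good i (fH : bioperad_hom (Q i) N * bioperad_hom (Q i) PI) :=
  (forall n x, e0 n (fH.2 n x) = alpha' n (fH.1 n x)) /\
  (forall n x, e1 n (fH.2 n x) = alpha n (c i n x)).
pose stage i := {fH | good i fH}.
have s0 : stage 0%N.
  apply: cid; have [f _] := unit_hom (cp_start C) N; have [H _] := unit_hom (cp_start C) PI.
  exists (f, H); split=> n x.
    exact: (unit_hom_eq (cp_start C) (goperad_hom_comp e0 H) (goperad_hom_comp alpha' f)).
  exact: (unit_hom_eq (cp_start C) (goperad_hom_comp e1 H)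
    (goperad_hom_comp alpha (c 0%N))).
have step i (s : stage i) : {s' : stage i.+1 |
    (forall n x, (sval s').1 n (j i n x) = (sval s).1 n x) /\
    (forall n x, (sval s').2 n (j i n x) = (sval s).2 n x)}.
  apply: cid; case: s => [[f H] [/= h0 h1]].
  have [|f' [H' [k1 k2 k3 k4]]] := @lift_stage k char0 P N alpha' weq' PI e0 e1 cst e0c e1c
    PI_BC PI_surj (Q i) (Q i.+1) (j i) f H (bioperad_hom_comp alpha (c i.+1)) (cp_ext C i) h0.
    by move=> n x; rewrite h1 /= colim.1.
  by exists (exist _ (f', H') (conj k3 k4)).
(* Dependent choice: each stage carries its two maps with their end point conditions, and extends
   the preceding one. *)
pose fix sq i : stage i := if i is i'.+1 then projT1 (step i' (sq i')) else s0.
have sqE i := projT2 (step i (sq i)).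
have [f [fE _]] := colim.2 _ (fun i => (sval (sq i)).1) (fun i => (sqE i).1).
have [H [HE _]] := colim.2 _ (fun i => (sval (sq i)).2) (fun i => (sqE i).2).
exists f, H; split=> n x; have [i [y ->]] := colimit_stage colim x.
  by rewrite HE fE; apply: (svalP (sq i)).1.
by rewrite HE; apply: (svalP (sq i)).2.
Qed.

(** Two out of three. The difference of H x and the constant path at e0 (H x) vanishes at 0, so it
    is a boundary by acyclicity; evaluated at 1, it compares alpha x with alpha' (f x). *)
Lemma minimal_model_map : exists f : bioperad_hom M N, weq_elements f.
Proof.
have [PI [e0 [e1 [cst [[e0c e1c] PI_BC PI_A PI_surj]]]]] := path_object P char0.
have [f [H [h0 h1]]] := lift_presentation e0c e1c PI_BC PI_surj.
have BC n (x : M n) : bo_d x = 0 -> bo_db x = 0 ->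
    exists t, alpha n x = alpha' n (f n x) + bo_d (bo_db t).
  move=> dx dbx; have [||| z _ zE] := @PI_BC n (H n x - cst n (e0 n (H n x))).
  - by rewrite linearB e0c subrr.
  - by rewrite linearB -!bh_d dx !linear0 ?oppr0 ?addr0.
  - by rewrite linearB -!bh_db dbx !linear0 ?oppr0 ?addr0.
  exists (e1 n z); rewrite -bh_db -bh_d -zE linearB e1c h0 h1.
  by rewrite addrC subrK.
have A n (x : M n) : bo_d (bo_db x) = 0 ->
    exists t t', alpha n x = alpha' n (f n x) + (bo_d t + bo_db t').
  move=> dx; have [||z [z' [_ _ zE]]] := @PI_A n (H n x - cst n (e0 n (H n x))).
  - by rewrite linearB e0c subrr.
  - by rewrite !linearB -!(bh_db, bh_d) dx !linear0 ?oppr0 ?addr0.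
  exists (e1 n z), (e1 n z'); rewrite -bh_db -bh_d -linearD -zE linearB e1c h0 h1.
  by rewrite addrC subrK.
exists f; split.
- move=> n x dx dbx [y fy]; apply: (weq_BC_inj weq dx dbx).
  have [t ->] := BC n x dx dbx; exists (alpha' n y + t).
  by rewrite fy !linearD bh_d bh_db.
- move=> n x dx [y [z fy]]; apply: (weq_A_inj weq dx).
  have [t [t' ->]] := A n x dx; exists (alpha' n y + t), (alpha' n z + t').
  by rewrite fy !linearD bh_d bh_db addrACA.
(* Surjectivity of alpha on H_A gives x with alpha' (b - f x) a boundary, and injectivity of alpha'
   on H_A makes b - f x one. *)
- move=> n b db; have [|x [dx [u [v E]]]] := weq_A_surj weq (y := alpha' n b).
    by rewrite -bh_db -bh_d db linear0.
  exists x; split=> //; have [t [t' At]] := A n x dx.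
  have [||y [z yz]] := weq_A_inj weq' (x := b - f n x).
  + by rewrite !linearB db -bh_db -bh_d dx linear0 subrr.
  + exists (t + u), (t' + v); rewrite linearB E At !linearD /= -addrA -(addrA (alpha' n (f n x))).
    by rewrite addrC -addrA addKr addrC -addrA addrACA.
  by exists y, z; rewrite -addrA -yz addrC subrK.
Qed.

End LiftPresentation.

(** * Minimal operads *)

(** As n + 1 = m + m', the two bounds say that both factors have arity at least 2. Unlike the
    weight, this does not refer to generators and suits an induction on the arity. *)
Inductive decomposable (k : fieldType) (P : goperad k) n : P n -> Prop :=
| dec_comp m m' (e : n.+1 = (m + m')%N) (i : 'I_m) (x : P m) (y : P m') :
    (m < n)%N -> (m' < n)%N -> decomposable (op_comp e i x y)
| dec_act (s : 'S_n) (x : P n) : decomposable x -> decomposable (sm_act s x)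
| dec_zero : decomposable (0 : P n)
| dec_lin (a : k) (x y : P n) :
    decomposable x -> decomposable y -> decomposable (a *: x + y).

Section Weight.
Variables (k : fieldType) (P : goperad k) (G : forall n, set (P n)).
Hypothesis G_low : forall n (x : P n), G x -> (n <= 1)%N -> x = 0.

Definition is_scalar n : P n -> Prop :=
  match n return P n -> Prop with
  | 1 => fun x => exists a, x = a *: op_id P
  | _ => fun x => x = 0
  end.

Lemma is_scalar0 n : is_scalar (0 : P n).
Proof. by case: n => [|[|n]] //; exists 0; rewrite scale0r. Qed.

Lemma is_scalarP n a (x y : P n) : is_scalar x -> is_scalar y -> is_scalar (a *: x + y).
Proof.
case: n x y => [|[|n]] x y /=; try by move=> -> ->; rewrite scaler0 addr0.
by move=> [c ->] [d ->]; exists (a * c + d); rewrite scalerA scalerDl.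
Qed.

(** Composing with a multiple of the identity is rescaling. [Q] ranges over all arities since r = n
    is only a provable equality. *)
Lemma scalar_comp_l m n r (e : r.+1 = (m + n)%N) (i : 'I_m) (x : P m) (y : P n)
    (Q : forall n, P n -> Prop) : is_scalar x ->
  (forall n, Q n 0) -> (forall a, Q n (a *: y)) -> Q r (op_comp e i x y).
Proof.
move=> sx Q0 Qy; case: m e i x sx => [|[|m]] e i x /=; try by move=> ->; rewrite op_comp0l.
move=> [a ->]; have er : r = n by move: (e); rewrite add1n => -[].
by subst r; rewrite op_compZl op_id_l.
Qed.

Lemma scalar_comp_r m n r (e : r.+1 = (m + n)%N) (i : 'I_m) (x : P m) (y : P n)
    (Q : forall n, P n -> Prop) : is_scalar y ->
  (forall n, Q n 0) -> (forall a, Q m (a *: x)) -> Q r (op_comp e i x y).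
Proof.
move=> sy Q0 Qx; case: n e y sy => [|[|n]] e y /=; try by move=> ->; rewrite op_comp0r.
move=> [a ->]; have er : r = m by move: (e); rewrite addn1 => -[].
by subst r; rewrite op_compZr op_id_r.
Qed.

Lemma decZ n a (x : P n) : decomposable x -> decomposable (a *: x).
Proof. by move=> h; rewrite -[_ *: _]addr0; apply: dec_lin => //; apply: dec_zero. Qed.

Lemma weight_cases w n (x : P n) : weight G w x ->
  [/\ w = 0%N -> is_scalar x, (0 < w)%N -> (n <= 1)%N -> x = 0 &
      (2 <= w)%N -> decomposable x].
Proof.
elim=> {w n x} [|n x Gx|w w' m n r e i x y hx [x0 x1 x2] hy [y0 y1 y2]
  |w n s x hx [x0 x1 x2]|w n|w n a x y hx [x0 x1 x2] hy [y0 y1 y2]].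
- by split=> // _; exists 1; rewrite scale1r.
- by split=> // _; apply: G_low.
- case: (posnP w) => [w0|w0].
    rewrite w0 add0n; split=> h.
    + apply: (@scalar_comp_l _ _ _ e i x y (is_scalar)); [exact: x0| exact: is_scalar0|] => a.
      rewrite -[_ *: _]addr0; apply: is_scalarP; [exact: y0|exact: is_scalar0].
    + apply: (@scalar_comp_l _ _ _ e i x y (fun n x => (n <= 1)%N -> x = 0)) => //; first exact: x0.
      by move=> a n1; rewrite y1 // scaler0.
    + apply: (@scalar_comp_l _ _ _ e i x y (@decomposable k P)); [exact: x0|exact: dec_zero|] => a.
      by apply: decZ; apply: y2.
  case: (posnP w') => [w'0|w'0].
    rewrite w'0 addn0; split=> h.
    + by rewrite h in w0.
    + apply: (@scalar_comp_r _ _ _ e i x y (fun n x => (n <= 1)%N -> x = 0)) => //; first exact: y0.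
      by move=> a n1; rewrite x1 // scaler0.
    + apply: (@scalar_comp_r _ _ _ e i x y (@decomposable k P)); [exact: y0|exact: dec_zero|] => a.
      by apply: decZ; apply: x2.
  (* A factor of positive weight vanishes in arity at most 1, so both arities may be taken at least
     2; then both are less than r = m + n - 1. *)
  have [m1|m1] := leqP m 1.
    rewrite (x1 w0 m1) op_comp0l; split=> // _; [exact: is_scalar0|exact: dec_zero].
  have [n1|n1] := leqP n 1.
    rewrite (y1 w'0 n1) op_comp0r; split=> // _; [exact: is_scalar0|exact: dec_zero].
  split.
  + by move/eqP; rewrite addn_eq0 => /andP[/eqP h _]; rewrite h in w0.
  + move=> _ r1; have h : (m + n <= 2)%N by rewrite -e.
    by have := leq_trans (leq_add m1 n1) h.
  + move=> _; apply: dec_comp; rewrite -ltnS e.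
      by rewrite -[X in (X < _)%N]addn1 ltn_add2l.
    by rewrite -[X in (X < _)%N]add1n ltn_add2r.
- split=> h.
  + move: (x0 h) => {hx x0 x1 x2}; case: n s x => [|[|n]] s x /=; try by move=> ->; rewrite linear0.
    by move=> [a ->]; exists a; rewrite (_ : s = 1%g) ?sm_act1 //; apply/permP => u; rewrite !ord1.
  + by move=> n1; rewrite x1 // linear0.
  + by apply: dec_act; apply: x2.
- by split=> // _; [exact: is_scalar0|exact: dec_zero].
- split=> h.
  + by apply: is_scalarP; [apply: x0|apply: y0].
  + by move=> n1; rewrite x1 // y1 // scaler0 addr0.
  + by apply: dec_lin; [apply: x2|apply: y2].
Qed.

Lemma weight_ge2_decomposable n (x : P n) : weight_ge G 2 x -> decomposable x.
Proof.
elim=> [|w y z w2 hy _ hz]; first exact: dec_zero.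
rewrite -[y]scale1r; apply: dec_lin => //.
by have [_ _ h] := weight_cases hy; apply: h.
Qed.

End Weight.

Lemma minimal_decomposable (k : fieldType) (M : bioperad k) : is_minimal M ->
  forall n (x : M n), decomposable (bo_d (bo_db x)).
Proof.
move=> [C h] n x; apply: (weight_ge2_decomposable _ (h n x)) => m _ [i [z ->]].
case: m z => [|[|m]] z //= _.
  by rewrite (qf_gen0 z) !linear0.
by rewrite (qf_gen1 z) !linear0.
Qed.

Lemma decomposable_derivation (k : fieldType) (P : goperad k)
    (d : forall n, {linear P n -> P n}) n (x : P n) :
  operad_derivation d -> decomposable x -> decomposable (d n x).
Proof.
move=> der; elim=> {x} [m m' e i x y mn m'n|s x _ IH||a x y _ IHx _ IHy].
- rewrite (leibniz der) -[X in X + _]scale1r; apply: dec_lin; exact: dec_comp.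
- by rewrite (od_act der); apply: dec_act.
- by rewrite linear0; apply: dec_zero.
- by rewrite linearP; apply: dec_lin.
Qed.

(** In arities >= n the map is 0: the universal property of a free operad asks for a map of
    generators in every arity. *)
Lemma partial_inverse (k : fieldType) (M N : smodule k) (f : smod_hom M N) n :
  (forall m, (m < n)%N -> bijective (f m)) ->
  exists h : smod_hom N M, forall m, (m < n)%N -> cancel (f m) (h m) /\ cancel (h m) (f m).
Proof.
move=> bij.
have ex m : {g : {linear N m -> M m} |
    [/\ (m < n)%N -> cancel (f m) g /\ cancel g (f m),
      forall p q x, bg_hom p q x -> bg_hom p q (g x) &
      forall (s : 'S_m) x, g (sm_act s x) = sm_act s (g x)]}.
  have [mn|mn] := ltnP m n; last first.
    exists \0; split=> [|p q x _|s x] //=; first exact: bg_hom0.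
    by rewrite linear0.
  have [g [fK gK]] := linear_inverse (bij m mn); exists g; split=> // [p q x hx|s x].
    have <- : bg_proj (p, q) (g x) = g x.
      by apply: (can_inj fK); rewrite smh_proj gK bg_proj_id.
    exact: (bg_proj_hom (p, q)).
  by apply: (can_inj fK); rewrite smh_act !gK.
have exP m := projT2 (ex m).
exists (@SModHom _ N M (fun m => projT1 (ex m)) (fun m => let: And3 _ h _ := exP m in h)
  (fun m => let: And3 _ _ h := exP m in h)) => m mn /=.
by have [h _ _] := exP m; apply: h.
Qed.

(** A composite of arity 0 has an inner factor of arity 0, zero by induction. Without nullary
    operations, the factors of a nonzero composite have at most its arity. *)
Lemma quasi_free_arity0 (k : fieldType) (Q : quasi_free k) n (x : Q n) : n = 0%N -> x = 0.
Proof.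
elim: (free_generated (@qf_free k Q) x) => {n x} // [n x [y ->] n0|m n r e i x y _ _ _ IHy r0|n s x _ IH n0|n a x y _ IHx _ IHy n0].
- by subst n; rewrite (qf_gen0 y) linear0.
- subst r; case: m e i x => [|m] e i x; first by case: i.
  by rewrite IHy ?op_comp0r //; move: e; rewrite addSn => -[/esym/eqP]; rewrite addn_eq0 => /andP[_ /eqP].
- by rewrite IH // linear0.
- by rewrite IHx // IHy // scaler0 addr0.
Qed.

(* Since N is free, the inverse of f in arities < n extends to an operad map
   (forgetting the differentials), which is a left inverse of f on the part of
   M(n) that is determined by lower arities. *)
Lemma retraction_below (k : fieldType) (M N : bioperad k) (f : bioperad_hom M N) n :
  is_cofibrant N -> (forall m, (m < n)%N -> bijective (f m)) ->
  exists g : goperad_hom N M, forall m (x : M m), (m < n)%N -> g m (f m x) = x.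
Proof.
move=> [C] bij; have [h hP] := partial_inverse bij.
pose Q := cp_op C; pose j := cp_map C; pose c := cp_cocone C.
have colim := cp_colimit C.
have ex i : {phi : goperad_hom (Q i) M |
    forall m y, phi m (qf_inc m y) = h m (c i m (qf_inc m y))}.
  apply: cid; have [phi [phiE _]] := qf_free (smod_hom_comp h (smod_hom_comp (c i) (@qf_inc k (Q i)))).
  by exists phi.
pose phi i := projT1 (ex i); have phiE i := projT2 (ex i) : forall m y, phi i m _ = _.
have phij i m x : phi i.+1 m (j i m x) = phi i m x.
  apply: (free_hom_eq (f := goperad_hom_comp (phi i.+1) (j i)) (@qf_free k (Q i))) => l y.
  have [n' [E [d [theta [_ _ _ tj _]]]]] := cp_ext C i.
  by rewrite /= -tj phiE tj colim.1 phiE.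
have [g gE] := colimit_goperad_hom colim phij.
exists g => m x mn; have [fK gK] := hP m mn.
have [i [z zE]] := colimit_stage colim (f m x).
(* Below arity n, f phi_i is the cocone map: on generators by the choice of h, and on composites
   because their factors have arity below n as well. *)
suff fphi : f m (phi i m z) = c i m z.
  by rewrite zE gE; apply: (can_inj fK); rewrite fphi.
move: mn {x fK gK zE}; elim: (free_generated (@qf_free k (Q i)) z) => {m z}
  [_|m z [y ->] mn|m n' r e l x y _ IHx _ IHy rn|m s x _ IH mn|m _|m a x y _ IHx _ IHy mn].
- by rewrite !gh_id.
- by rewrite phiE; have [_ ->] := hP m mn.
- have [m'0|m'0] := posnP n'.
    by rewrite (quasi_free_arity0 y m'0) op_comp0r !linear0.
  have m0 : (0 < m)%N by case: m l {e x IHx} => // -[].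
  rewrite !gh_comp IHx ?IHy //; apply: leq_ltn_trans rn; rewrite -ltnS e.
    by rewrite -[X in (X < _)%N]add0n ltn_add2r.
  by rewrite -[X in (X < _)%N]addn0 ltn_add2l.
- by rewrite !smh_act IH.
- by rewrite !linear0.
- by rewrite !linearP /= IHx // IHy.
Qed.

(** * Bijectivity of f by induction on the arity *)

Section MinimalIso.
Variables (k : fieldType) (M N : bioperad k) (f : bioperad_hom M N).
Hypothesis fw : weq_elements f.
Hypothesis Mmin : forall n (x : M n), decomposable (bo_d (bo_db x)).
Hypothesis Nmin : forall n (x : N n), decomposable (bo_d (bo_db x)).
Hypothesis Ncof : is_cofibrant N.

Section Arity.
Variable n : nat.
Hypothesis below : forall m, (m < n)%N -> bijective (f m).

Lemma decomposable_lift (y : N n) : decomposable y -> exists2 x, decomposable x & f n x = y.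
Proof.
elim=> {y} [m m' e i x y mn m'n|s y _ [x hx <-]||a y y' _ [x hx <-] _ [x' hx' <-]].
- have [g _ gK] := below mn; have [g' _ gK'] := below m'n.
  by exists (op_comp e i (g x) (g' y)); [exact: dec_comp|rewrite gh_comp gK gK'].
- by exists (sm_act s x); [exact: dec_act|rewrite smh_act].
- by exists 0; [exact: dec_zero|rewrite linear0].
- by exists (a *: x + x'); [exact: dec_lin|rewrite linearP].
Qed.

Lemma decomposable_inj (x : M n) : decomposable x -> f n x = 0 -> x = 0.
Proof.
have [g gE] := retraction_below Ncof below => hx fx.
suff <- : g n (f n x) = x by rewrite fx linear0.
elim: hx => {x fx} [m m' e i x y mn m'n|s y _ IH||a y y' _ IH _ IH'].
- by rewrite !gh_comp !gE.
- by rewrite !smh_act IH.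
- by rewrite !linear0.
- by rewrite !linearP /= IH IH'.
Qed.

(** Minimality makes every value of del delbar decomposable, and on decomposables f is already
    bijective; this turns statements about classes in H_BC and H_A into statements about
    elements. *)
Lemma minimal_bijective : bijective (f n).
Proof.
have [_ _ Mdd Mdbdb Mddb] := bo_bicomplex M n.
have [_ _ Ndd Ndbdb Nddb] := bo_bicomplex N n.
have Manti (x : M n) : bo_db (bo_d x) = - bo_d (bo_db x).
  by apply/eqP; rewrite -addr_eq0 addrC; apply/eqP; apply: Mddb.
have Nanti (x : N n) : bo_db (bo_d x) = - bo_d (bo_db x).
  by apply/eqP; rewrite -addr_eq0 addrC; apply/eqP; apply: Nddb.
(* First del delbar a = 0, so a = del y + delbar z by H_A. Then del a and delbar a are values of del
   delbar up to sign, hence decomposable and zero, and a itself is in Im del delbar by H_BC. *)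
have inj0 (a : M n) : f n a = 0 -> a = 0.
  move=> fa; have a1 : bo_d (bo_db a) = 0.
    by apply: decomposable_inj => //; rewrite bh_d bh_db fa !linear0.
  have [|y [z aE]] := weq_A_inj fw a1.
    by exists 0, 0; rewrite fa !linear0 addr0.
  have da : bo_d a = 0.
    apply: decomposable_inj; last by rewrite bh_d fa linear0.
    by rewrite aE linearD Mdd add0r.
  have dba : bo_db a = 0.
    apply: decomposable_inj; last by rewrite bh_db fa linear0.
    rewrite aE linearD Mdbdb addr0 Manti -scaleN1r -[_ *: _]addr0.
    by apply: dec_lin => //; apply: dec_zero.
  have [|w wE] := weq_BC_inj fw da dba; first by exists 0; rewrite fa !linear0.
  by rewrite wE; apply: decomposable_inj; rewrite // -wE.
have dec_im (b : N n) : exists a, f n a = bo_d (bo_db b).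
  by have [a _ aE] := decomposable_lift (Nmin b); exists a.
(* The decomposable preimage c of del delbar b is closed for both differentials, because these
   preserve decomposables and f is injective there; so c = del delbar w by H_BC, and H_A applies to
   b - f w. *)
have split_im (b : N n) : exists a y z, b = f n a + bo_d y + bo_db z.
  have [c cdec cE] := decomposable_lift (Nmin b).
  have [w wE] : exists w, c = bo_d (bo_db w).
    apply: (weq_BC_inj fw).
    - apply: decomposable_inj; last by rewrite bh_d cE Ndd.
      exact: (decomposable_derivation (bo_d_der M)).
    - apply: decomposable_inj; last by rewrite bh_db cE Nanti Ndbdb linear0 ?oppr0.
      exact: (decomposable_derivation (bo_db_der M)).
    - by exists b.
  have [|x [dx [u [v E]]]] := weq_A_surj fw (y := b - f n w).
    by rewrite !linearB -cE wE !bh_d !bh_db subrr.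
  exists (w + x), u, v; rewrite linearD -[LHS](subrK (f n w)) E.
  by rewrite addrC !addrA.
(* [split_im] is applied again to y and z: after del and delbar, the terms outside the image of f
   become values of del delbar, which are in the image by [dec_im]. *)
have surj (b : N n) : exists x, f n x = b.
  have [a [y [z ->]]] := split_im b.
  have [a1 [y2 [y3 ->]]] := split_im y; have [a2 [z2 [z3 ->]]] := split_im z.
  have [c3 c3E] := dec_im y3; have [c2 c2E] := dec_im z2.
  exists (a + (bo_d a1 + c3) + (bo_db a2 - c2)).
  rewrite !linearD /= linearN bh_d bh_db c3E c2E Ndd Ndbdb !addr0 -Nanti.
  by rewrite !addrA.
exists (fun b => projT1 (cid (surj b))) => x; case: cid => // y /= yx.
by apply/eqP; rewrite -subr_eq0; apply/eqP/inj0; rewrite linearB yx subrr.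
Qed.

End Arity.

Lemma minimal_isomorphic : bioperad_isomorphic M N.
Proof.
have bij n : bijective (f n).
  by elim/ltn_ind: n => n; apply: minimal_bijective.
have [g [fK gK]] := smod_inverse bij.
have inj n := can_inj (fK n).
have g_id : g 1%N (op_id N) = op_id M by apply: inj; rewrite gK gh_id.
have g_comp m n r (e : r.+1 = (m + n)%N) (i : 'I_m) (x : N m) (y : N n) :
    g r (op_comp e i x y) = op_comp e i (g m x) (g n y).
  by apply: inj; rewrite gh_comp !gK.
pose go := @GOperadHom k N M g g_id g_comp.
have g_d n (x : N n) : go n (bo_d x) = bo_d (go n x) by apply: inj; rewrite bh_d !gK.
have g_db n (x : N n) : go n (bo_db x) = bo_db (go n x) by apply: inj; rewrite bh_db !gK.
by exists f, (@BiOperadHom k N M go g_d g_db).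
Qed.

End MinimalIso.

Theorem theorem4p15 (k : fieldType) (chark : [pchar k]%R =i pred0)
  (P M N : bioperad k)
  (alpha : bioperad_hom M P) (alpha' : bioperad_hom N P)
  (halpha : is_minimal_model alpha) (halpha' : is_minimal_model alpha') :
  bioperad_isomorphic M N.
Proof.
have [Mmin /operad_weqE weq] := halpha; have [Nmin /operad_weqE weq'] := halpha'.
have [C _] := Mmin; have [C' _] := Nmin.
have [f fw] := minimal_model_map chark C weq weq'.
exact: (minimal_isomorphic fw (minimal_decomposable Mmin) (minimal_decomposable Nmin)
  (inhabits C')).
Qed.
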